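(* Let $n>1$ be an odd integer, let $q$ be an odd prime power, and let $Q$ be a maximal parabolic subgroup of $SL_n(q)$ with Levi subgroup $(GL_{n-1}(q)\times GL_1(q))\cap SL_n(q)$. Then $Q$ is a $2$-restriction canonical subgroup of $SL_n(q)$.
   Context: For a finite group $X$ and a prime $p$, $\mathrm{Irr}_{p'}(X)$ is the set of complex irreducible characters of $X$ of degree not divisible by $p$; $\chi_H$ denotes the restriction of $\chi$ to $H$. A subgroup $H\le G$ of a finite group $G$ is called $p$-restriction good if for every $\chi\in\mathrm{Irr}_{p'}(G)$ there exists a unique $\chi^*\in\mathrm{Irr}_{p'}(H)$ such that $\chi_H=\chi^*+\Delta$, where either $\Delta=0$ or $\Delta$ is a character of $H$ all of whose irreducible constituents have degree divisible by $p$. A $p$-restriction good subgroup $H\le G$ is called $p$-restriction canonical if the map $\chi\mapsto\chi^*$ is a bijection $\mathrm{Irr}_{p'}(G)\to\mathrm{Irr}_{p'}(H)$. *)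

(* Defs.v *)
From HB Require Import structures.
From mathcomp Require Import all_boot all_order all_fingroup all_algebra.
From mathcomp Require Import all_solvable all_field all_character.

Set Implicit Arguments.
Unset Strict Implicit.
Unset Printing Implicit Defensive.

Import GroupScope GRing.Theory.
Local Open Scope ring_scope.

Section RestrictionGood.

Variable gT : finGroupType.
Implicit Types G H : {group gT}.

(* Irreducible characters are handled through their indices; i |-> 'chi_i is
   injective, so uniqueness and bijectivity may be read on indices. *)
Definition Irr_p' (p : nat) G : {set Iirr G} :=
  [set i | ~~ (p %| 'chi_i 1%g)%C].

(* 'chi_j can play the role of chi^* for chi = 'chi_i.  The predicate
   `character' holds of 0, which has no constituent, so the case Delta = 0 is
   included. *)
Definition p'_part_of_restriction (p : nat) G H (i : Iirr G) (j : Iirr H) :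
    Prop :=
  j \in Irr_p' p H /\
  exists Delta : 'CF(H),
    [/\ 'Res[H] 'chi_i = 'chi_j + Delta,
        Delta \is a character
      & {in irr_constt Delta, forall k, (p %| 'chi_k 1%g)%C}].

Definition restriction_good (p : nat) G H : Prop :=
  H \subset G /\
  {in Irr_p' p G, forall i, exists! j : Iirr H, p'_part_of_restriction p i j}.

(* When H is p-restriction good in G, the function `star' below is determined
   on Irr_p' p G: it is the map chi |-> chi^*. *)
Definition restriction_canonical (p : nat) G H : Prop :=
  restriction_good p G H /\
  exists star : Iirr G -> Iirr H,
    [/\ {in Irr_p' p G, forall i, p'_part_of_restriction p i (star i)},
        {in Irr_p' p G &, injective star}
      & star @: Irr_p' p G = Irr_p' p H].

End RestrictionGood.

(* Matrices act on row vectors from the right, and a subspace of F^n is the row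
   space of a square matrix.  The underlying type of {'GL_n[F]} consists of
   matrices of size n.-1.+1, which is n as soon as n > 0. *)
Section SpecialLinear.

Variables (n : nat) (F : finFieldType).

Definition SL_set : {set {'GL_n[F]}} := [set g | \det (GLval g) == 1].

Lemma SL_group_set : group_set SL_set.
Proof.
apply/group_setP; split=> [|g h]; rewrite !inE; first by rewrite GL_1E det1.
by rewrite GL_MxE det_mulmx => /eqP-> /eqP->; rewrite mulr1.
Qed.

Canonical SL_group := Group SL_group_set.

Definition SL_stab (s : seq 'M[F]_n.-1.+1) : {set {'GL_n[F]}} :=
  [set g in SL_set | all (fun U => stablemx U (GLval g)) s].

Definition flag (s : seq 'M[F]_n.-1.+1) : bool :=
  sorted (fun U V => (U <= V)%MS) s.

Definition parabolic (P : {set {'GL_n[F]}}) : Prop :=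
  exists2 s, flag s & P = SL_stab s.

Definition maximal_parabolic (P : {set {'GL_n[F]}}) : Prop :=
  [/\ parabolic P, P \proper SL_set
    & forall R : {set {'GL_n[F]}},
        parabolic R -> R \proper SL_set -> P \subset R -> R = P].

(* L is a Levi subgroup of P: for some decomposition F^n = W_0 (+) ... (+)
   W_(k-1), P is the stabilizer of the flag of partial sums W_0 (+) ... (+) W_i
   and L is the stabilizer of all the summands W_i. *)
Definition Levi_subgroup (P L : {set {'GL_n[F]}}) : Prop :=
  exists k (W : 'I_k -> 'M[F]_n.-1.+1),
    [/\ mxdirect (\sum_i W i), row_full (\sum_i W i)%MS,
        P = SL_stab [seq (\sum_(j < k | (j <= i)%N) W j)%MS | i : 'I_k]
      & L = SL_stab [seq W i | i : 'I_k]].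

(* (GL_(n-1)(F) x GL_1(F)) :&: SL_n(F), embedded block-diagonally. *)
Definition GL_GL1_cap_SL : {set {'GL_n[F]}} :=
  [set g in SL_set | [forall i, forall j,
     ((i == ord_max) != (j == ord_max)) ==> (GLval g i j == 0)]].

End SpecialLinear.

(* Main.v *)
Require Import Defs.
From HB Require Import structures.
From mathcomp Require Import all_boot all_order all_fingroup all_algebra.
From mathcomp Require Import all_solvable all_field all_character.
From mathcomp Require Import mpoly.
From mathcomp Require Import ring lra zify.

Set Implicit Arguments.
Unset Strict Implicit.
Unset Printing Implicit Defensive.

Import GroupScope GRing.Theory Num.Theory.
Local Open Scope ring_scope.

(** Let m = n - 1 and let [C] be the set of characters ("colours") of F^*.  To a
    sequence of pairs (k_i, c_i) with sum of the k_i equal to dim W, attach the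
    character of GL(W) induced from the parabolic subgroup of type (k_i) by the
    product of the c_i o det.  Pairs of flags have adapted bases, so the scalar
    product of two such characters counts contingency matrices whose nonzero
    entries match colours; hence these characters have the Gram matrix of
    coloured products h_k of complete symmetric polynomials.  Linear relations
    between products of h_k therefore hold between the characters, and the
    Jacobi-Trudi determinants give an orthonormal family X_s of virtual
    characters of GL(W), indexed by bead configurations [s] (coloured partitions).

    The sum P of the characters of type (1, .., 1) is (h_1)^m, that is the sum of
    f(s) X_s, where f(s) is the number of ways to build [s] from the ground
    state one box at a time.  On the stabilizer Q of a hyperplane, P is a multiple
    of the number of complete flags [t] of the hyperplane such that A acts trivially
    on the quotients of [t].  A group of diagonal signs acts on these A with 1 as
    only fixed point, so <psi, P> = psi(1) mod 2 for each irreducible psi of Q.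
    Hence the odd characters of Q are the X_t with f(t) odd (up to sign).
    Inducing X_t from Q to SL_n adds one box of trivial colour, and Frobenius
    reciprocity shows that the odd characters of SL_n are X_(t + box) with f odd
    at [t] and [t + box].

    It remains to study f mod 2.  In characteristic 2, h_1^w is a power sum for
    w = 2^k, so f(s) mod 2 is the sum of f over the configurations obtained by
    lowering one bead by w.  When w is the largest power of 2 below the size of
    [s] only one bead can be moved; by induction, a configuration of odd size with f
    odd has a unique odd predecessor, and one of even size has at most one odd
    successor in each colour.  This makes the restriction multiplicities of odd
    characters 0 or 1 and the correspondence injective; it is bijective because
    the index of Q is odd.

    The stabilizer of a line is mapped to that of a hyperplane by inverse
    transposition. *)

(** * Complete symmetric polynomials and Jacobi-Trudi determinants *)

(** The irreducible characters of [SL_n] and of Q are never classified and no degree is computed: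
    the parity of a degree is read off from the scalar product with P, and this also shows that the
    odd characters of Q are inflated from the action on the hyperplane. The price is that each X_s
    is known to be irreducible only up to a sign; the sign disappears at the end because a
    restriction multiplicity is never negative. The Gram matrix is computed for a group [H] that
    induces all of GL(W) on W, so that one computation serves both GL_n on the whole space and Q on
    the hyperplane. Passing from GL_n to SL_n is the delicate point: two X_s that differ by a twist
    with a character of the determinant coincide on SL_n. For n odd, an X_s obtained from an odd X_t
    by a box of trivial colour has the trivial colour as its only colour of odd size; a nontrivial
    twist moves that colour, so these X_s stay orthonormal on SL_n. Each colour gets r = n beads:
    while fewer than n boxes are present, every colour keeps a bead at 0, as the Pieri rule
    requires. *)

Lemma mcoeffMXE (A : nzRingType) (R : nat) (p : {mpoly A[R]}) (m k : 'X_{1..R}) :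
  (p * 'X_[m])@_k = if (m <= k)%MM then p@_(k - m) else 0.
Proof.
case: ifPn => [le_mk|]; first by rewrite -{1}(submK le_mk) addmC mcoeffMX.
move=> nle; rewrite mcoeffM big1 // => -[a b] /= /eqP Dk.
rewrite mcoeffX; case: eqP => [mb|]; last by rewrite mulr0.
by case/negP: nle; rewrite Dk /= mb lem_addl.
Qed.

Section CompleteSymmetric.

Variable R : nat.
Implicit Types (A : {set 'I_R}) (k : nat) (m : 'X_{1..R}).

Definition mvars m : {set 'I_R} := [set i | m i != 0%N].

Definition hsym A k : {mpoly int[R]} :=
  \sum_(m : 'X_{1..R < k.+1} | (mdeg m == k) && (mvars m \subset A)) 'X_[m].

Lemma mcoeff_hsym A k m :
  (hsym A k)@_m = ((mdeg m == k) && (mvars m \subset A))%:R.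
Proof.
rewrite /hsym raddf_sum /=.
case: (boolP (_ && _)) => [|nP]; last first.
  rewrite big1 // => i Pi; rewrite mcoeffX; case: eqP => // mi.
  by rewrite -mi Pi in nP.
move=> Pm; have lt_mk: (mdeg m < k.+1)%N by case/andP: Pm => /eqP->.
rewrite (bigD1 (BMultinom lt_mk : 'X_{1..R < k.+1})) //= mcoeffX eqxx big1 ?addr0 // => i.
case/andP=> _ ni; rewrite mcoeffX; case: eqP => // mi; case/eqP: ni.
exact/val_inj.
Qed.

Lemma hsym0 A : hsym A 0 = 1.
Proof.
apply/mpolyP=> m; rewrite mcoeff_hsym mcoeff1 mdeg_eq0; case: eqP => //= ->.
by rewrite (_ : mvars 0%MM = set0) ?sub0set //; apply/setP=> i; rewrite !inE mnm0E.
Qed.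

Lemma hsym_set1 i k : hsym [set i] k = 'X_i ^+ k.
Proof.
apply/mpolyP=> m; rewrite mcoeff_hsym mcoeffXn.
congr (_ %:R); congr nat_of_bool; apply/andP/eqP => [[/eqP Dk /subsetP sm]|<-].
  apply/mnmP=> j; rewrite mulmnE mnm1E.
  have m0 l : l != i -> m l = 0%N.
    by move=> li; apply/eqP; apply: contraNT li => ml; rewrite -in_set1 sm ?inE.
  move: Dk; rewrite mdegE (bigD1 i) //= big1 // addn0 => mi.
  by case: (eqVneq i j) => [<-|ij]; rewrite ?mi ?mul1n // m0 // eq_sym.
rewrite mdegMn mdeg1 mul1n eqxx; split=> //; apply/subsetP=> j.
by rewrite !inE mulmnE mnm1E (eq_sym j i); case: (i == j).
Qed.

Lemma hsymU1 A i k : i \notin A ->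
  hsym (i |: A) k.+1 = hsym A k.+1 + hsym (i |: A) k * 'X_i.
Proof.
move=> iA; apply/mpolyP=> m; rewrite mcoeffD mcoeffMXE !mcoeff_hsym.
have le1: (U_(i) <= m)%MM = (0 < m i)%N.
  apply/mnm_lepP/idP => [/(_ i)|mi j]; first by rewrite mnm1E eqxx.
  by rewrite mnm1E; case: eqP => // <-.
rewrite le1; case: posnP => [mi0|mi].
  rewrite addr0; congr (_ %:R); congr nat_of_bool; congr (_ && _).
  apply/subsetP/subsetP=> sm j jm; last by rewrite setU1r ?sm.
  have:= sm j jm; rewrite in_setU1 => /predU1P[ji|//].
  by move: jm; rewrite inE ji mi0.
have -> : mvars m \subset A = false.
  by apply: contraNF iA => /subsetP/(_ i)->//; rewrite inE -lt0n.
rewrite andbF add0r; congr (_ %:R); congr nat_of_bool.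
have le1m: (U_(i) <= m)%MM by rewrite le1.
have -> : mdeg m = (mdeg (m - U_(i))%MM).+1.
  by rewrite -[in LHS](submK le1m) mdegD mdeg1 addn1.
rewrite eqSS; congr (_ && _); apply/subsetP/subsetP=> sm j; rewrite !inE.
  by rewrite mnmBE => mj; rewrite -in_setU1 sm // inE; lia.
move=> mj; case: (eqVneq j i) => //= ji.
by have:= sm j; rewrite !inE (negPf ji) /= mnmBE mnm1E (eq_sym i) (negPf ji) subn0; apply.
Qed.

End CompleteSymmetric.

(* Truncated subtraction must not turn [h_(a-b)] with [a < b] into [h_0]. *)
Definition shiftsub (A : nzRingType) (h : nat -> A) (a b : nat) : A :=
  if (b <= a)%N then h (a - b)%N else 0.

(** The [e i] are the signed elementary symmetric polynomials in the variables of [A] other than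
    [k]: multiplying the generating series of the [hsym A] by the factors [1 - 'X_l t] for [l != k]
    leaves [1 / (1 - 'X_k t)]. *)
Lemma hsym_power R (A : {set 'I_R}) k : k \in A ->
  exists e : nat -> {mpoly int[R]},
    forall s, \sum_(i < #|A|) shiftsub (hsym A) s i * e i = 'X_k ^+ s.
Proof.
elim: {A}_.+1 {-2}A (ltnSn #|A|) => // N IH A cA kA.
case: (set_0Vmem (A :\ k)) => [A0 | [l]].
  have ->: A = [set k] by rewrite -(setD1K kA) A0 setU0.
  exists (fun=> 1) => s; rewrite cards1 big_ord1 mulr1 /shiftsub subn0.
  by rewrite hsym_set1.
rewrite !inE => /andP[lk lA].
have [||e De] := IH (A :\ l); first by move: cA; rewrite (cardsD1 l A) lA.
  by rewrite !inE eq_sym lk.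
have cA': #|A| = #|A :\ l|.+1 by rewrite (cardsD1 l A) lA.
(* Multiplication of the generating polynomial of [e] by [1 - 'X_l t]. *)
pose e' i := (if (i < #|A :\ l|)%N then e i else 0)
            - (if (0 < i)%N then 'X_l * e i.-1 else 0).
exists e' => s; rewrite -De.
have rec i : shiftsub (hsym (A :\ l)) s i
  = shiftsub (hsym A) s i - shiftsub (hsym A) s i.+1 * 'X_l.
  rewrite /shiftsub; case: ltngtP => [lt|gt|->].
  - rewrite (_ : (s - i = (s - i.+1).+1)%N); last by lia.
    by rewrite -{2 3}(setD1K lA) hsymU1 ?setD11 // addrK.
  - by rewrite mul0r subr0.
  - by rewrite subnn !hsym0 mul0r subr0.
under [RHS]eq_bigr => i _ do rewrite rec mulrBl.
rewrite sumrB cA' /e'.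
under eq_bigr => i _ do rewrite mulrBr.
rewrite sumrB; congr (_ - _).
  rewrite big_ord_recr /= ltnn mulr0 addr0.
  by apply: eq_bigr => i _; rewrite ltn_ord.
rewrite big_ord_recl /= mulr0 add0r; apply: eq_bigr => i _.
by rewrite -mulrA.
Qed.

(* The indices [p : 'I_R] are the beads of an abacus with [r] beads of each colour
   in [C]: bead [p] has colour [col p] and initial position [dl p], and
   [pos c k] is the bead with these data.  A configuration [s] gives the current
   position of each bead. *)
Section JacobiTrudi.

Variables (C : finType) (R r : nat) (col : 'I_R -> C) (dl : 'I_R -> nat).
Variable pos : C -> nat -> 'I_R.
Hypothesis dl_lt : forall p, (dl p < r)%N.
Hypothesis posK : forall p, pos (col p) (dl p) = p.
Hypothesis col_pos : forall c k, (k < r)%N -> col (pos c k) = c.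
Hypothesis dl_pos : forall c k, (k < r)%N -> dl (pos c k) = k.

Definition vars (c : C) : {set 'I_R} := [set p | col p == c].

Lemma cdl_inj p q : col p = col q -> dl p = dl q -> p = q.
Proof. by move=> Ec Ed; rewrite -(posK p) -(posK q) Ec Ed. Qed.

Lemma sum_vars (A : nmodType) (c : C) (f : nat -> A) :
  \sum_(p | col p == c) f (dl p) = \sum_(i < r) f i.
Proof.
rewrite (reindex_onto (fun i : 'I_r => pos c i)
          (fun p => Ordinal (dl_lt p))) /=; last first.
  by move=> p /eqP <-; rewrite posK.
apply: eq_big => [i|i _]; last by rewrite dl_pos.
rewrite col_pos // eqxx /=; apply/eqP/val_inj => /=; exact: dl_pos.
Qed.

Lemma card_vars c : #|vars c| = r.
Proof.
rewrite -sum1_card; under eq_bigl => p do rewrite inE.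
by have /= -> := sum_vars c (fun=> 1%N); rewrite sum1_card card_ord.
Qed.

Section Ring.
Variables (A : comNzRingType) (h : C -> nat -> A).
Implicit Types s : 'I_R -> nat.

(** One block per colour. With rows and columns reversed, the block is the usual Jacobi-Trudi matrix
    [h_(lambda_i - i + j)] of the partition [s - dl]. *)
Definition JTmx s : 'M[A]_R := \matrix_(p, j)
  if col p == col j then shiftsub (h (col p)) (s p) (dl j) else 0.

Definition cpres (sg : 'S_R) : bool := [forall p, col (sg p) == col p].

Definition dlm (sg : 'S_R) : 'X_{1..R} := [multinom dl (sg p) | p < R].

Lemma dlm_le sg (s : 'X_{1..R}) :
  (dlm sg <= s)%MM = [forall p, dl (sg p) <= s p]%N.
Proof.
apply/mnm_lepP/forallP => le p; have := le p; first by rewrite mnmE.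
by rewrite mnmE.
Qed.

Lemma det_JTmx s : \det (JTmx s) =
  \sum_(sg : 'S_R | cpres sg && [forall p, dl (sg p) <= s p]%N)
    (-1) ^+ sg * \prod_p h (col p) (s p - dl (sg p))%N.
Proof.
rewrite /determinant [RHS]big_mkcond; apply: eq_bigr => sg _.
case: ifPn => [/andP[/forallP cs /forallP ls]|].
  congr (_ * _); apply: eq_bigr => p _; rewrite !mxE /shiftsub.
  by rewrite eq_sym cs ls.
rewrite negb_and => /orP[] /forallPn[p np];
  rewrite (bigD1 p) //= !mxE /shiftsub.
  by rewrite eq_sym (negPf np) mul0r mulr0.
by rewrite (negPf np) if_same mul0r mulr0.
Qed.

Hypothesis h0 : forall c, h c 0%N = 1.

(** Unitriangularity: a permutation does not change the sum of [dl], so the inequalities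
    [dl (sg p) <= dl p] are all equalities and only the identity contributes. *)
Lemma det_JTmx_dl : \det (JTmx dl) = 1.
Proof.
rewrite det_JTmx (bigD1 1%g) /=; last first.
  by apply/andP; split; apply/forallP=> p; rewrite perm1.
rewrite odd_perm1 expr0 mul1r big1 => [|p _]; last by rewrite perm1 subnn h0.
rewrite big1 ?addr0 // => sg /andP[/andP[/forallP cs /forallP ls] /eqP[]].
have sum_dl : (\sum_p dl (sg p) = \sum_p dl p)%N.
  by rewrite [RHS](reindex_perm sg).
apply/permP=> p; rewrite perm1; apply: cdl_inj; first exact/eqP.
have/leqif_sum[_] : forall p, xpredT p ->
  (dl (sg p) <= dl p ?= iff (dl (sg p) == dl p))%N by move=> q _; split.
by rewrite sum_dl eqxx => /esym/forallP/(_ p)/eqP.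
Qed.

(* Both sides are the sum over [p], [j] of colour [c] of
   [h_(s_p + 1 - dl_j)] times the cofactor: a column shift makes two columns
   equal unless [dl_j = 0], and then the row of [p0] is [(h_1, 0, .., 0)]. *)
Lemma det_JTmx_Pieri s c p0 : col p0 = c -> s p0 = 0%N ->
  h c 1%N * \det (JTmx s) =
    \sum_(p | col p == c) \det (JTmx (fun q => s q + (q == p))%N).
Proof.
move=> cp0 sp0.
have r0 : (0 < r)%N by apply: leq_ltn_trans (dl_lt p0).
pose H := JTmx s.
pose u p j : A := if (col p == c) && (col j == c)
  then shiftsub (h c) (s p).+1 (dl j) else 0.
have rowE p : col p = c -> \det (JTmx (fun q => s q + (q == p))%N)
    = \sum_j u p j * cofactor H p j.
  move=> cp; rewrite (expand_det_row _ p); apply: eq_bigr => j _.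
  rewrite /u !mxE eqxx addn1 cp eqxx /= eq_sym; congr (_ * _).
  congr (_ * \det _); apply/matrixP=> i k; rewrite !mxE.
  by rewrite [lift p i == p]eq_sym (negPf (neq_lift _ _)) addn0.
rewrite (eq_bigr _ (fun p (cp : col p == c) => rowE p (eqP cp))) exchange_big /=.
pose repl j := \matrix_(p, k) if k == j then u p j else H p k.
have colE j : \sum_(p | col p == c) u p j * cofactor H p j = \det (repl j).
  rewrite (expand_det_col _ j) [LHS]big_mkcond; apply: eq_bigr => p _.
  rewrite !mxE eqxx; case: ifPn => [cp|/negPf cp]; last by rewrite /u cp mul0r.
  congr (_ * (_ * \det _)); apply/matrixP=> i k; rewrite !mxE.
  by rewrite [lift j k == j]eq_sym (negPf (neq_lift _ _)).
under eq_bigr => j _ do rewrite colE.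
pose j0 := pos c 0.
have cj0 : col j0 = c by apply: col_pos.
have dj0 : dl j0 = 0%N by apply: dl_pos.
rewrite (bigD1 j0) //= big1 ?addr0 => [|j nj]; last first.
  case: (eqVneq (col j) c) => [cj|cj]; last first.
    rewrite (expand_det_col _ j) big1 // => p _; rewrite mxE eqxx /u (negPf cj).
    by rewrite andbF mul0r.
  have dj : dl j != 0%N.
    by apply: contra_neq nj => dj; apply: cdl_inj; rewrite ?cj0 ?dj0.
  have lt1 : ((dl j).-1 < r)%N by have := dl_lt j; lia.
  pose j' := pos c (dl j).-1.
  have [cj' dj'] : col j' = c /\ dl j' = (dl j).-1.
    by split; [apply: col_pos | apply: dl_pos].
  have jj' : j' != j by apply/eqP => jj; move: dj'; rewrite jj; lia.
  rewrite -det_tr; apply: (determinant_alternate jj') => p.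
  rewrite !mxE eqxx (negPf jj') /u cj eqxx andbT cj'.
  case: eqP => // cp; rewrite /shiftsub dj' cp.
  rewrite (_ : (dl j <= (s p).+1)%N = ((dl j).-1 <= s p)%N); last by lia.
  by case: ifP => // _; congr (h _ _); lia.
rewrite (expand_det_row _ p0) (expand_det_row (repl j0) p0).
rewrite (bigD1 j0) //= big1 ?addr0 => [|j nj]; last first.
  rewrite !mxE /shiftsub; case: eqP; rewrite ?mul0r // cp0 => cj.
  have dj : dl j != 0%N.
    by apply: contra_neq nj => dj; apply: cdl_inj; rewrite ?cj0 ?dj0.
  by rewrite sp0 leqn0 (negPf dj) mul0r.
rewrite [RHS](bigD1 j0) //= [X in _ = _ + X]big1 ?addr0 => [|j nj]; last first.
  rewrite !mxE (negPf nj) /shiftsub; case: eqP; rewrite ?mul0r // cp0 => cj.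
  have dj : dl j != 0%N.
    by apply: contra_neq nj => dj; apply: cdl_inj; rewrite ?cj0 ?dj0.
  by rewrite sp0 leqn0 (negPf dj) mul0r.
rewrite !mxE eqxx /u cp0 cj0 eqxx /= /shiftsub dj0 sp0 /= !subn0 h0 mul1r.
congr (_ * (_ * \det _)); apply/matrixP=> i k; rewrite !mxE.
by rewrite [lift j0 k == j0]eq_sym (negPf (neq_lift _ _)).
Qed.

End Ring.

Definition hcol (c : C) (k : nat) : {mpoly int[R]} := hsym (vars c) k.

(** The product over the colours of the alternants in the variables of that colour; [alt dl] is a
    product of Vandermonde determinants. *)
Definition alt (s : 'I_R -> nat) : {mpoly int[R]} :=
  \det (\matrix_(p, k) if col p == col k then 'X_k ^+ s p else 0).

Lemma altE s : alt s = \sum_(sg : 'S_R | cpres sg)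
  (-1) ^+ sg * 'X_[[multinom s (sg p) | p < R]].
Proof.
rewrite /alt -det_tr /determinant [RHS]big_mkcond; apply: eq_bigr => sg _.
case: ifPn => [/forallP cs|/forallPn[p np]].
  congr (_ * _); rewrite mpolyXE_id; apply: eq_bigr => p _.
  by rewrite !mxE mnmE cs.
by rewrite (bigD1 p) //= !mxE (negPf np) mul0r mulr0.
Qed.

(** The bialternant formula. The matrix [E] of signed elementary polynomials turns complete
    symmetric polynomials into powers and does not depend on [s]; the case [s = dl] identifies its
    determinant as [alt dl]. *)
Theorem Jacobi_Trudi s : \det (JTmx hcol s) * alt dl = alt s.
Proof.
have Ek k : exists e : nat -> {mpoly int[R]}, forall m,
    \sum_(i < r) shiftsub (hcol (col k)) m i * e i = 'X_k ^+ m.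
  have [|e De] := @hsym_power _ (vars (col k)) k; first by rewrite inE.
  by exists e => m; rewrite -De card_vars.
have [e De] := fin_all_exists Ek.
pose E : 'M[{mpoly int[R]}]_R := \matrix_(j, k) if col j == col k then e k (dl j) else 0.
have mulE m : JTmx hcol m *m E
    = \matrix_(p, k) if col p == col k then 'X_k ^+ m p else 0.
  apply/matrixP=> p k; rewrite !mxE -De.
  rewrite -(sum_vars (col k) (fun i => shiftsub (hcol (col k)) (m p) i * e k i)).
  case: (eqVneq (col p) (col k)) => [cp|ncp]; last first.
    rewrite big1 // => j _; rewrite !mxE; case: eqP => [cj|]; rewrite ?mul0r //.
    by rewrite -cj (negPf ncp) mulr0.
  rewrite [RHS]big_mkcond; apply: eq_bigr => j _.
  by rewrite !mxE cp eq_sym; case: ifP; rewrite ?mul0r.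
have /(congr1 determinant) := mulE dl.
rewrite det_mulmx det_JTmx_dl => [|c]; last exact: hsym0.
by rewrite mul1r -/(alt dl) => <-; rewrite -det_mulmx mulE.
Qed.

Lemma mcoeff_alt_dlM (P : {mpoly int[R]}) (m : 'X_{1..R}) :
  (alt dl * P)@_m = \sum_(sg : 'S_R | cpres sg && (dlm sg <= m)%MM)
    (-1) ^+ sg * P@_(m - dlm sg).
Proof.
rewrite altE mulr_suml raddf_sum /= big_mkcondr /=; apply: eq_bigr => sg _.
rewrite -mulrA; have -> : (-1) ^+ sg = ((-1) ^+ sg)%:MP :> {mpoly int[R]}.
  by rewrite rmorphXn rmorphN rmorph1.
rewrite mcoeffCM ['X_[_] * P]mulrC mcoeffMXE -/(dlm sg).
by case: ifP; rewrite ?mulr0.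
Qed.

(* The beads of each colour are in their initial order: [s - dl] is a coloured
   partition. *)
Definition mono (s : 'X_{1..R}) : bool :=
  [forall p, forall q, (col p == col q) && (dl p < dl q)%N ==> (s p < s q)%N].

Lemma monoP (s : 'X_{1..R}) : reflect (forall p q, col p = col q -> (dl p < dl q)%N -> (s p < s q)%N)
  (mono s).
Proof.
apply: (iffP forallP) => [ms p q cpq dpq | ms p].
  by have /forallP/(_ q)/implyP := ms p; rewrite cpq eqxx dpq; apply.
by apply/forallP=> q; apply/implyP=> /andP[/eqP cpq dpq]; apply: ms.
Qed.

(** Such an [sg] is increasing on each colour, so it lowers no [dl] ([key], by induction on [dl p]);
    its inverse has the same property. *)
Lemma mono_perm (s t : 'X_{1..R}) sg : mono s -> mono t -> cpres sg ->
  (forall p, t p = s (sg p)) -> sg = 1%g.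
Proof.
have key (s' t' : 'X_{1..R}) sg' : mono s' -> mono t' -> cpres sg' ->
    (forall p, t' p = s' (sg' p)) -> forall p, (dl p <= dl (sg' p))%N.
  move=> /monoP ms /monoP mt /forallP cs Dt.
  have mon p q : col p = col q -> (dl p < dl q)%N -> (dl (sg' p) < dl (sg' q))%N.
    move=> cpq dpq; case: ltngtP => // [gt|eq].
      have := mt p q cpq dpq; rewrite !Dt ltnNge leq_eqVlt => /negP[].
      apply/orP; right; apply: ms => //.
      by rewrite (eqP (cs p)) (eqP (cs q)).
    have /perm_inj pq : sg' p = sg' q.
      by apply: cdl_inj => //; rewrite (eqP (cs p)) (eqP (cs q)).
    by rewrite pq ltnn in dpq.
  move=> p; move Dk: (dl p) => k; elim: k p Dk => // k IH p Dp.
  have lt1 : (k < r)%N by have := dl_lt p; lia.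
  have dq := dl_pos (col p) lt1; have cq := col_pos (col p) lt1.
  have := mon (pos (col p) k) p cq; rewrite dq Dp => /(_ (ltnSn _)).
  exact: leq_ltn_trans (IH _ dq).
move=> ms mt cs Dt; apply/permP=> p; rewrite perm1.
apply: cdl_inj; first exact/eqP/(forallP cs).
apply/eqP; rewrite eqn_leq (key _ _ _ ms mt cs) // andbT.
have csV : cpres sg^-1%g.
  by apply/forallP=> q; rewrite -{2}(permKV sg q) eq_sym; apply: (forallP cs).
have Ds q : s q = t (sg^-1%g q) by rewrite Dt permKV.
by have := key t s sg^-1%g mt ms csV Ds (sg p); rewrite permK.
Qed.

(** Through the bialternant formula this coefficient becomes the scalar product of X_s and X_t. *)
Lemma mcoeff_alt_mono (s t : 'X_{1..R}) :
  mono s -> mono t -> (alt s)@_t = (s == t)%:R.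
Proof.
move=> ms mt; rewrite altE raddf_sum /=.
have cf (sg : 'S_R) : ((-1) ^+ sg * 'X_[[multinom s (sg p) | p < R]] : {mpoly int[R]})@_t
  = (-1) ^+ sg * ([multinom s (sg p) | p < R] == t)%:R.
  have -> : (-1) ^+ sg = ((-1) ^+ sg)%:MP :> {mpoly int[R]}.
    by rewrite rmorphXn rmorphN rmorph1.
  by rewrite mcoeffCM mcoeffX.
under eq_bigr => sg _ do rewrite cf.
rewrite (bigD1 1%g) /=; last by apply/forallP=> p; rewrite perm1.
rewrite odd_perm1 expr0 mul1r big1 ?addr0 => [|sg /andP[cs n1]].
  congr (_ == _)%:R; apply/mnmP=> p; by rewrite mnmE perm1.
case: eqP => [Dt|]; last by rewrite mulr0.
case/eqP: n1; apply: (mono_perm ms mt cs) => p.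
by rewrite -Dt mnmE.
Qed.

End JacobiTrudi.

Lemma sum_inj_ge (T : finType) (A : {set T}) (f : T -> nat) :
  {in A &, injective f} -> (\sum_(i < #|A|) i <= \sum_(a in A) f a)%N.
Proof.
elim: {A}_.+1 {-2}A (ltnSn #|A|) => // N IH A cA injf.
case: (set_0Vmem A) => [->|[a0 a0A]]; first by rewrite cards0 big_ord0.
case: (arg_maxnP f a0A) => a aA' maxa; have aA : a \in A by [].
have cA' : #|A| = #|A :\ a|.+1 by rewrite (cardsD1 a A) aA.
rewrite (big_setD1 a) //= cA' big_ord_recr /= addnC leq_add //; last first.
  apply: IH; first by rewrite cA' in cA; lia.
  by apply: sub_in2 injf => x; rewrite inE => /andP[].
rewrite -ltnS -cA' -[X in (_ <= X)%N]card_ord.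
rewrite -(card_in_imset (f := fun x => inord (f x) : 'I_(f a).+1) (D := A)).
  exact: max_card.
move=> x y xA yA /(congr1 val) /=; rewrite !inordK ?ltnS; first exact: injf.
  exact: maxa.
exact: maxa.
Qed.

(** * Parity of path numbers *)

Section PathCount.

Variables (C : finType) (R r : nat) (col : 'I_R -> C) (dl : 'I_R -> nat).
Variable pos : C -> nat -> 'I_R.
Hypothesis dl_lt : forall p, (dl p < r)%N.
Hypothesis posK : forall p, pos (col p) (dl p) = p.
Hypothesis col_pos : forall c k, (k < r)%N -> col (pos c k) = c.
Hypothesis dl_pos : forall c k, (k < r)%N -> dl (pos c k) = k.

Implicit Types s t u : 'X_{1..R}.

Definition d0 : nat := (\sum_p dl p)%N.

Definition level s : nat := (mdeg s - d0)%N.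

(* By the Pieri rule this is, up to sign, the number of ways to reach [s] from [dl]
   in [m] steps that raise one bead by 1 and never put two beads together. *)
Definition npaths m s : int := (alt col dl * (\sum_p 'X_p) ^+ m)@_s.

Definition par m s : 'F_2 := (npaths m s)%:~R.

Definition bead_inj s := forall p q, col p = col q -> s p = s q -> p = q.

Lemma psum_coef m (u : 'X_{1..R}) :
  ((\sum_p 'X_p) ^+ m : {mpoly int[R]})@_u != 0 -> mdeg u = m.
Proof.
elim: m u => [|m IH] u.
  by rewrite expr0 mcoeff1; case: (eqVneq u 0%MM) => [->|]; rewrite ?mdeg0 ?eqxx.
rewrite exprSr mulr_sumr raddf_sum /= => nz.
have [p] : exists p, ((\sum_p 'X_p) ^+ m * 'X_p : {mpoly int[R]})@_u != 0.
  apply/existsP; apply: contraNT nz => /existsPn nz.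
  by rewrite big1 // => p _; apply/eqP; rewrite -[_ == _]negbK nz.
rewrite mcoeffMXE; case: ifP => // le /IH.
by rewrite -[in mdeg u](submK le) mdegD mdeg1 addn1 => ->.
Qed.

Lemma npaths_deg m s : npaths m s != 0 -> mdeg s = (m + d0)%N.
Proof.
rewrite /npaths mcoeff_alt_dlM => nz.
have [sg /andP[/andP[_ le] nz']] : exists sg, (cpres col sg && (dlm dl sg <= s)%MM)
   && (((\sum_p 'X_p) ^+ m : {mpoly int[R]})@_(s - dlm dl sg) != 0).
  apply/existsP; apply: contraNT nz => /existsPn nz.
  rewrite big1 // => sg Hsg; have := nz sg; rewrite Hsg negbK => /eqP->.
  by rewrite mulr0.
rewrite -(submK le) mdegD (psum_coef nz'); congr (_ + _)%N.
rewrite mdegE /d0 [RHS](reindex_perm sg).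
by apply: eq_bigr => p _; rewrite mnmE.
Qed.

Lemma npaths_perm m s (tau : 'S_R) : cpres col tau ->
  npaths m [multinom s (tau p) | p < R] = (-1) ^+ tau * npaths m s.
Proof.
move=> ct; rewrite /npaths -mcoeff_sym msymM.
have -> : msym tau ((\sum_p 'X_p) ^+ m) = (\sum_p 'X_p) ^+ m :> {mpoly int[R]}.
  elim: m => [|m IH]; first exact: msym1.
  rewrite !exprS msymM IH raddf_sum /=; congr (_ * _).
  rewrite [RHS](reindex_perm tau) /=; apply: eq_bigr => p _.
  rewrite msymX; congr 'X_[_]; apply/mnmP=> q; rewrite !mnmE; congr nat_of_bool.
  by rewrite -(inj_eq (@perm_inj _ tau)) permKV.
have -> : msym tau (alt col dl) = ((-1) ^+ tau)%:MP * alt col dl.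
  rewrite !altE raddf_sum /= mulr_sumr.
  rewrite (reindex_inj (mulgI tau)) /=; apply: eq_big => [sg|sg cs].
    apply/forallP/forallP => cs p.
      by have := cs (tau^-1%g p); rewrite permM permKV => /eqP->;
         rewrite -{2}(permKV tau p) eq_sym (forallP ct).
    by rewrite permM (eqP (cs _)) (forallP ct).
  have sgnC (s' : 'S_R) : (-1) ^+ s' = ((-1) ^+ s')%:MP :> {mpoly int[R]}.
    by rewrite rmorphXn rmorphN rmorph1.
  have msym_sgn (s' : 'S_R) p : msym tau ((-1) ^+ s' * p)
      = (-1) ^+ s' * msym tau p :> {mpoly int[R]}.
    by rewrite sgnC !mul_mpolyC msymZ.
  rewrite msym_sgn -sgnC mulrA odd_permM signr_addb; congr (_ * _).
  rewrite msymX; congr 'X_[_]; apply/mnmP=> p; rewrite !mnmE permM.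
  by rewrite permKV.
by rewrite -mulrA mcoeffCM.
Qed.

(** Two beads of one colour at the same place can be exchanged without changing [s], yet the
    exchange changes the sign of [npaths]. *)
Lemma npaths_inj m s : npaths m s != 0 -> bead_inj s.
Proof.
move=> nz p q cpq spq; apply/eqP; apply: contraNT nz => npq.
have ct : cpres col (tperm p q).
  by apply/forallP=> x; case: tpermP => [->|->|_ _] //; rewrite cpq.
have Es : [multinom s (tperm p q x) | x < R] = s.
  by apply/mnmP=> x; rewrite mnmE; case: tpermP => [->|->|_ _].
have := npaths_perm m s ct; rewrite Es odd_tperm npq expr1 mulN1r.
by move=> H; apply/eqP; lia.
Qed.

Lemma par_nz m s : par m s != 0 -> npaths m s != 0.
Proof. by apply: contra_neq; rewrite /par => ->. Qed.

Lemma par_perm m s (tau : 'S_R) : cpres col tau ->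
  par m [multinom s (tau p) | p < R] = par m s.
Proof.
move=> ct; rewrite /par npaths_perm //.
case: (odd_perm tau); rewrite ?expr1 ?mul1r // mulN1r mulrNz.
by move: (_%:~R) => x; apply/val_inj; case: x => [[|[|]]].
Qed.

(* [(\sum_p 'X_p) ^+ (2 ^ k)] is [\sum_p 'X_p ^+ (2 ^ k)] modulo 2. *)
Lemma par_step k m s : (2 ^ k <= m)%N ->
  par m s = \sum_(p | (2 ^ k <= s p)%N) par (m - 2 ^ k) (s - U_(p) *+ (2 ^ k))%MM.
Proof.
move=> le_km; pose a2 : {mpoly 'F_2[R]} := map_mpoly intr (alt col dl).
have parE m' s' : par m' s' = (a2 * (\sum_p 'X_p) ^+ m')@_s'.
  have psE : map_mpoly intr (\sum_(p < R) 'X_p) = \sum_(p < R) 'X_p :> {mpoly 'F_2[R]}.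
    by rewrite (raddf_sum (map_mpoly intr)); apply: eq_bigr => q _; exact: map_mpolyX.
  by rewrite /par /npaths -(mcoeff_map_mpoly intr) rmorphM rmorphXn /= psE.
have ch2 : 2 \in [pchar {mpoly 'F_2[R]}].
  by rewrite inE /= -(rmorph_nat (@mpolyC R 'F_2)) (_ : 2%:R = 0 :> 'F_2) ?rmorph0 //; apply/val_inj.
have frob : (\sum_p 'X_p) ^+ (2 ^ k) = \sum_p 'X_p ^+ (2 ^ k) :> {mpoly 'F_2[R]}.
  elim: (k) => [|j IH]; first by rewrite expn0 expr1.
  rewrite expnSr exprM IH -(pFrobenius_autE ch2) rmorph_sum /=.
  by apply: eq_bigr => p _; rewrite pFrobenius_autE -exprM.
rewrite parE -{1}(subnK le_km) exprD mulrA.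
rewrite frob mulr_sumr raddf_sum [RHS]big_mkcond /=; apply: eq_bigr => p _.
rewrite mpolyXn mcoeffMXE.
have -> : (U_(p) *+ 2 ^ k <= s)%MM = (2 ^ k <= s p)%N.
  apply/mnm_lepP/idP => [/(_ p)|le q]; rewrite mulmnE mnm1E ?eqxx ?mul1n //.
  by case: (eqVneq p q) => [<-|]; rewrite ?mul1n.
by case: ifP => // _; rewrite parE.
Qed.

Definition oddc s : bool := par (level s) s != 0.

Lemma oddc_deg s : oddc s -> mdeg s = (level s + d0)%N.
Proof. by move/par_nz/npaths_deg. Qed.

Lemma oddc_inj s : oddc s -> bead_inj s.
Proof. by move/par_nz/npaths_inj. Qed.

Lemma oddc_perm s t (tau : 'S_R) : cpres col tau ->
  (forall p, t p = s (tau p)) -> oddc s = oddc t.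
Proof.
move=> ct Dt; have -> : t = [multinom s (tau p) | p < R].
  by apply/mnmP=> p; rewrite mnmE.
rewrite /oddc par_perm // /level; congr (par (_ - _) _ != 0).
rewrite !mdegE [LHS](reindex_perm tau).
by apply: eq_bigr => p _; rewrite mnmE.
Qed.

Lemma mdeg_subD s p w : (w <= s p)%N -> (mdeg (s - U_(p) *+ w)%MM + w = mdeg s)%N.
Proof.
move=> le; have le' : (U_(p) *+ w <= s)%MM.
  apply/mnm_lepP=> q; rewrite mulmnE mnm1E; case: (eqVneq p q) => [<-|] //=.
  by rewrite mul1n.
by rewrite -[in RHS](submK le') mdegD mdegMn mdeg1 mul1n.
Qed.

Lemma mdeg_sub s p w : (w <= s p)%N -> mdeg (s - U_(p) *+ w)%MM = (mdeg s - w)%N.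
Proof. by move/mdeg_subD <-; rewrite addnK. Qed.

Lemma oddc_step k s : oddc s -> (2 ^ k <= level s)%N ->
  exists p, (2 ^ k <= s p)%N && oddc (s - U_(p) *+ (2 ^ k))%MM.
Proof.
move=> os le; apply/existsP; apply: contraTT os => /existsPn no.
rewrite /oddc negbK (par_step _ le) big1 // => p lep.
have := no p; rewrite lep /= negbK => /eqP; rewrite /level mdeg_sub //.
by rewrite (_ : mdeg s - 2 ^ k - d0 = mdeg s - d0 - 2 ^ k)%N //; lia.
Qed.

Lemma colour_sum_ge s c : bead_inj s ->
  (\sum_(p | col p == c) dl p <= \sum_(p | col p == c) s p)%N.
Proof.
move=> inj_s; pose A := vars col c.
have [-> ->] : (\sum_(p | col p == c) dl p = \sum_(i < #|A|) i)%N /\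
   (\sum_(p | col p == c) s p = \sum_(p in A) s p)%N.
  split; last by apply: eq_bigl => p; rewrite inE.
  rewrite (card_vars dl_lt posK col_pos dl_pos).
  exact: (sum_vars dl_lt posK col_pos dl_pos c id).
apply: sum_inj_ge => p q; rewrite !inE => /eqP cp /eqP cq; apply: inj_s.
by rewrite cp cq.
Qed.

(** All exclusions below rest on this bound: if moves without collision were to bring the size below
    [d0], they cannot all be possible. *)
Lemma bead_inj_deg s : bead_inj s -> (d0 <= mdeg s)%N.
Proof.
move=> inj_s; rewrite mdegE /d0 (partition_big col predT) //=.
rewrite [X in (_ <= X)%N](partition_big col predT) //=.
by apply: leq_sum => c _; apply: colour_sum_ge.
Qed.

Lemma level0_coef t : oddc t -> level t = 0%N ->
  exists2 sg : 'S_R, cpres col sg & forall p, t p = dl (sg p).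
Proof.
rewrite /oddc => ot l0; move: ot; rewrite l0 => /par_nz.
rewrite /npaths expr0 mulr1 altE raddf_sum /= => nz.
have [sg /andP[cs /eqP Dt]] : exists sg : 'S_R, cpres col sg &&
    ([multinom dl (sg p) | p < R] == t).
  apply/existsP; apply: contraNT nz => /existsPn no.
  rewrite big1 // => sg cs; have := no sg; rewrite cs /= => ne.
  have -> : (-1) ^+ sg = ((-1) ^+ sg)%:MP :> {mpoly int[R]}.
    by rewrite rmorphXn rmorphN rmorph1.
  by rewrite mcoeffCM mcoeffX (negPf ne) mulr0.
by exists sg => // p; rewrite -Dt mnmE.
Qed.

(** At level 0 the beads of a colour fill the places below [r], so raising any bead but the top one
    hits the bead [q] just above it. *)
Lemma level0_top t p : oddc t -> level t = 0%N -> bead_inj (t + U_(p))%MM ->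
  t p = r.-1.
Proof.
move=> ot l0 inj_s; have [sg cs Dt] := level0_coef ot l0.
have ltr := dl_lt (sg p); rewrite -Dt in ltr.
apply/eqP; apply: contraT => ne.
have lt1 : ((t p).+1 < r)%N by lia.
pose q := (sg^-1)%g (pos (col p) (t p).+1).
have cq : col q = col p.
  by have /forallP/(_ q)/eqP <- := cs; rewrite /q permKV col_pos.
have tq : t q = (t p).+1 by rewrite Dt /q permKV dl_pos.
have npq : q != p by apply/eqP=> qp; move: tq; rewrite qp; lia.
by case/eqP: npq; apply: inj_s => //; rewrite !mnmDE !mnm1E eqxx eq_sym
  (_ : (q == p) = false) ?tq ?addn0 ?addn1 //; apply/eqP=> qp; move: tq; rewrite qp; lia.
Qed.

Lemma dnE s p w q : (s - U_(p) *+ w)%MM q = (s q - (if q == p then w else 0))%N.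
Proof. by rewrite mnmBE mulmnE mnm1E eq_sym; case: ifP; rewrite ?mul1n. Qed.

Lemma dn_id s p w : (s - U_(p) *+ w)%MM p = (s p - w)%N.
Proof. by rewrite dnE eqxx. Qed.

Lemma dn_neq s p w q : q != p -> (s - U_(p) *+ w)%MM q = s q.
Proof. by move=> /negPf qp; rewrite dnE qp subn0. Qed.

Lemma up_id s p : (s + U_(p))%MM p = (s p).+1.
Proof. by rewrite mnmDE mnm1E eqxx addn1. Qed.

Lemma up_neq s p q : q != p -> (s + U_(p))%MM q = s q.
Proof. by move=> /negPf qp; rewrite mnmDE mnm1E eq_sym qp addn0. Qed.

Lemma bead_inj_repl (v u : 'X_{1..R}) (b : 'I_R) : (forall x, x != b -> u x = v x) -> bead_inj v ->
  (forall x, x != b -> col x = col b -> u x <> u b) -> bead_inj u.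
Proof.
move=> uv iv ub x y cxy.
case: (eqVneq x b) => [xb|xb]; case: (eqVneq y b) => [yb|yb] //; subst => //.
- by move=> E; case: (ub y yb) => //; rewrite E.
- by move=> E; case: (ub x xb) => //; rewrite E.
- by rewrite !uv //; apply: iv.
Qed.

Lemma bead_inj_neq s p q : bead_inj s -> p != q -> col p = col q -> s p <> s q.
Proof. by move=> is_ /eqP npq cpq /is_ E; apply: npq; apply: E. Qed.

(** Each move is harmless by itself and the two lowered beads stay apart, so both can be performed
    together; but this would bring the size below [d0]. *)
Lemma two_moves s p q w : (level s < w + w)%N -> p != q ->
  (w <= s p)%N -> (w <= s q)%N -> mdeg s = (level s + d0)%N -> bead_inj s ->
  bead_inj (s - U_(p) *+ w)%MM -> bead_inj (s - U_(q) *+ w)%MM -> False.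
Proof.
move=> lt2 npq wp wq deg i0 ip iq; have nqp : q != p by rewrite eq_sym.
have wq' : (w <= (s - U_(p) *+ w)%MM q)%N by rewrite dn_neq.
have /bead_inj_deg : bead_inj (s - U_(p) *+ w - U_(q) *+ w)%MM.
  apply: (bead_inj_repl (b := q) _ ip) => [x xq|x xq cx]; first by rewrite dn_neq.
  rewrite dn_neq // dn_id [X in _ <> (X - _)%N]dn_neq //.
  case: (eqVneq x p) => [xp|xp].
    by have := bead_inj_neq i0 xq cx; rewrite xp dn_id; lia.
  by have := bead_inj_neq iq xq cx; rewrite dn_id !dn_neq.
by have := mdeg_subD wp; have := mdeg_subD wq'; lia.
Qed.

Lemma level_sub s p w : (w <= s p)%N -> level (s - U_(p) *+ w)%MM = (level s - w)%N.
Proof. by move=> le; rewrite /level mdeg_sub //; lia. Qed.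

Lemma level_up t p : oddc t -> level (t + U_(p))%MM = (level t).+1.
Proof. by move=> ot; rewrite /level mdegD mdeg1 (oddc_deg ot); lia. Qed.

(* The largest power [w] of 2 below the level moves a unique bead [b] of [t] and
   a unique bead [c] of [t] with [a] raised.  Either the two beads agree, or three
   beads at [x], [x + w], [x + w + 1] are involved and get cyclically permuted. *)
Lemma edge_step k t a :
    oddc t -> oddc (t + U_(a))%MM -> (1 < 2 ^ k <= level t)%N ->
    ((level t).+1 < 2 ^ k + 2 ^ k)%N ->
  exists b c, [/\ (2 ^ k <= t b)%N && oddc (t - U_(b) *+ 2 ^ k)%MM,
    (2 ^ k <= (t + U_(a))%MM c)%N && oddc (t + U_(a) - U_(c) *+ 2 ^ k)%MM
    & c = b \/ [/\ [&& c != b, c != a & b != a], col b = col a, col c = col a,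
                   t b = (t a + 2 ^ k).+1 & t c = (t a + 2 ^ k)%N]].
Proof.
have := oddc_step (k := k); move: (2 ^ k)%N => w step.
move=> ot os /andP[w1 lew] ltw.
have lvs := level_up a ot.
have [b /andP[wb ob]] := step _ ot lew.
have [|c /andP[wc oc]] := step _ os _; first by rewrite lvs; lia.
exists b, c; split; rewrite ?wb ?ob ?wc ?oc //.
case: (eqVneq c b) => [->|ncb]; [by left | right].
have nbc : b != c by rewrite eq_sym.
have it := oddc_inj ot; have is_ := oddc_inj os.
have ib := oddc_inj ob; have ic := oddc_inj oc.
have degs := oddc_deg os; rewrite lvs in degs.
have degt := oddc_deg ot.
move Ds: (t + U_(a))%MM => s in os wc oc is_ ic degs *.
(* The level of [s] is less than [2 w], so no collision-free configuration arises from [s] by two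
   lowerings. *)
have small u : bead_inj u -> (mdeg u + w + w = mdeg s)%N -> False.
  by move=> /bead_inj_deg; lia.
have wbs : (w <= (s - U_(c) *+ w)%MM b)%N.
  rewrite dn_neq // -Ds; case: (eqVneq b a) => [ba|?]; last by rewrite up_neq.
  by rewrite ba up_id; rewrite ba in wb; lia.
(* If [c = a], the other beads stand at the same places in [s] and in [t], so [b] can be lowered in
   [s] as it can in [t], in addition to [c]. *)
have nca : c != a.
  apply/eqP=> ca; have nba : b != a by rewrite -ca.
  have sb : s b = t b by rewrite -Ds up_neq.
  apply: (small (s - U_(c) *+ w - U_(b) *+ w)%MM); last by rewrite !mdeg_subD.
  apply: (bead_inj_repl (b := b) _ ic) => [x xb|x xb cx]; first by rewrite dn_neq.
  rewrite dn_neq // dn_id [X in _ <> (X - _)%N]dn_neq //; case: (eqVneq x c) => [xc|xc].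
    by have := bead_inj_neq is_ xb cx; rewrite xc dn_id; lia.
  have := bead_inj_neq ib xb cx; rewrite dn_id !dn_neq // sb.
  by rewrite -Ds up_neq // -ca.
have sc : s c = t c by rewrite -Ds up_neq.
have wct : (w <= t c)%N by rewrite -sc.
have wct' : (w <= (t - U_(b) *+ w)%MM c)%N by rewrite dn_neq.
(* Lowering [c] is harmless in [s]; done in [t] after [b], it can only hit [a], the one bead whose
   place differs in [s] and [t]. Some hit must occur, by the size bound. *)
have [nba cca tc] : [/\ b != a, col c = col a & t c = (t a + w)%N].
  case E: ((b != a) && (col c == col a) && (t c == (t a + w)%N)).
    by move: E => /andP[/andP[? /eqP ?] /eqP ?].
  have {}E : b != a -> col c = col a -> t c = (t a + w)%N -> False.
    by move=> h1 h2 h3; rewrite h1 h2 h3 !eqxx in E.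
  have /bead_inj_deg : bead_inj (t - U_(b) *+ w - U_(c) *+ w)%MM; last first.
    by have := mdeg_subD wb; have := mdeg_subD wct'; lia.
  apply: (bead_inj_repl (b := c) _ ib) => [x xc|x xc cx]; first by rewrite dn_neq.
  rewrite dn_neq // dn_id [X in _ <> (X - _)%N]dn_neq //.
  case: (eqVneq x b) => [xb|xb].
    by have := bead_inj_neq it xc cx; rewrite xb dn_id; lia.
  rewrite dn_neq //; case: (eqVneq x a) => [xa|xa].
    move=> E'; rewrite xa in E' xb cx.
    by case: E; [rewrite eq_sym | | clear -E' wct; lia].
  by have := bead_inj_neq ic xc cx; rewrite dn_id dn_neq // sc -Ds up_neq.
(* In the same way, lowering [b] in [s] after [c] must hit a bead, and this can only be the raised
   bead [a]. *)
suff [cba tb] : col b = col a /\ t b = (t a + w).+1 by split=> //; apply/and3P.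
have sb : s b = t b by rewrite -Ds up_neq.
case E: ((col b == col a) && (t b == (t a + w).+1)).
  by case/andP: E => /eqP ? /eqP.
have {}E : col b = col a -> t b = (t a + w).+1 -> False.
  by move=> h1 h2; rewrite h1 h2 !eqxx in E.
case: (small (s - U_(c) *+ w - U_(b) *+ w)%MM); last by rewrite !mdeg_subD.
apply: (bead_inj_repl (b := b) _ ic) => [x xb|x xb cx]; first by rewrite dn_neq.
rewrite dn_neq // dn_id [X in _ <> (X - _)%N]dn_neq // sb.
case: (eqVneq x c) => [xc|xc].
  by have := bead_inj_neq is_ xb cx; rewrite xc dn_id sb; clear -wb wc; lia.
rewrite dn_neq //; case: (eqVneq x a) => [xa|xa].
  by rewrite xa in cx *; rewrite -Ds up_id => E'; case: E => //; clear -E' wb; lia.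
by have := bead_inj_neq ib xb cx; rewrite dn_id !dn_neq // -Ds !up_neq.
Qed.

(** With [a], [c], [b] at [x], [x + w], [x + w + 1]: raising [a] and lowering [c] occupies the
    places [x], [x + 1], [x + w + 1], and so does lowering [b] and raising [c]. Hence, up to
    renaming beads, lowering by [w] carries the edge from [t] to [t] with [a] raised to an edge one
    power of 2 further down. *)
Lemma edge_rot t a b c w : (1 < w)%N -> [&& c != b, c != a & b != a] ->
    col b = col a -> col c = col a ->
    t b = (t a + w).+1 -> t c = (t a + w)%N ->
  let tau := (tperm a b * tperm a c)%g in
  [/\ cpres col tau,
      forall p, (t + U_(a) - U_(c) *+ w)%MM p = (t - U_(b) *+ w + U_(c))%MM (tau p)
    & forall p, (t + U_(a) - U_(c) *+ w - U_(b))%MM p = (t - U_(b) *+ w)%MM (tau p)].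
Proof.
move=> w1 /and3P[ncb nca nba] cb cc tb tc tau.
have nbc : b != c by rewrite eq_sym.
have nac : a != c by rewrite eq_sym.
have nab : a != b by rewrite eq_sym.
have ta : tau a = b by rewrite permM tpermL tpermD.
have tau_b : tau b = c by rewrite permM tpermR tpermL.
have tau_c : tau c = a by rewrite permM (@tpermD _ a b c) ?tpermR.
have tau_x x : x != a -> x != b -> x != c -> tau x = x.
  move=> xa xb xc; rewrite permM (@tpermD _ a b x) 1?[_ == x]eq_sym //.
  by rewrite tpermD // eq_sym.
split=> [|p|p].
- apply/forallP=> x; case: (eqVneq x a) => [->|xa]; first by rewrite ta cb.
  case: (eqVneq x b) => [->|xb]; first by rewrite tau_b cb cc.
  by case: (eqVneq x c) => [->|xc]; [rewrite tau_c cc | rewrite tau_x].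
- case: (eqVneq p a) => [->|pa].
    by rewrite ta dn_neq // up_id up_neq // dn_id tb; lia.
  case: (eqVneq p b) => [->|pb].
    by rewrite tau_b dn_neq // up_neq // up_id dn_neq // tb tc.
  case: (eqVneq p c) => [->|pc].
    by rewrite tau_c dn_id up_neq // up_neq // dn_neq // tc; lia.
  by rewrite tau_x // dn_neq // !up_neq // dn_neq.
rewrite -[X in (_ - X)%MM p]mulm1n; case: (eqVneq p a) => [->|pa].
  by rewrite ta dn_neq // dn_neq // up_id dn_id tb; lia.
case: (eqVneq p b) => [->|pb].
  by rewrite tau_b dn_id dn_neq // up_neq // dn_neq // tb tc; lia.
case: (eqVneq p c) => [->|pc].
  by rewrite tau_c dn_neq // dn_id up_neq // dn_neq // tc; lia.
by rewrite tau_x // dn_neq // dn_neq // up_neq // dn_neq.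
Qed.

(** Evenness makes the same power of 2 the largest one below both [m] and [m + 1], the levels of the
    two ends of an edge. *)
Lemma top_power m : (1 < m)%N -> ~~ odd m ->
  exists k, (1 < 2 ^ k <= m)%N && (m.+1 < 2 ^ k + 2 ^ k)%N.
Proof.
move=> m1 em; have m0 : (0 < m)%N by lia.
have /andP[le lt] := trunc_log_bounds (isT : (1 < 2)%N) m0.
exists (trunc_log 2 m); have k0 : trunc_log 2 m != 0%N.
  by apply/eqP=> k0; rewrite k0 expn1 in lt; lia.
rewrite le -{1}(expn0 2) ltn_exp2l // lt0n k0 /=.
rewrite expnS mul2n -addnn in lt.
move: (trunc_log 2 m) k0 lt => [|k] // _; rewrite expnS; lia.
Qed.

Lemma dn_comm s a c w v : (s - U_(a) *+ w - U_(c) *+ v = s - U_(c) *+ v - U_(a) *+ w)%MM.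
Proof. by apply/mnmP=> p; rewrite !dnE; lia. Qed.

Lemma up_dn_comm s a c w : (w <= s c)%N ->
  (s + U_(a) - U_(c) *+ w = s - U_(c) *+ w + U_(a))%MM.
Proof.
move=> le; apply/mnmP=> p; rewrite mnmDE !dnE mnmDE.
by case: (eqVneq p c) => [->|]; lia.
Qed.

Lemma dn1K s p : (0 < s p)%N -> (s - U_(p) + U_(p))%MM = s.
Proof.
move=> sp; apply: submK; apply/mnm_lepP=> q; rewrite mnm1E.
by case: eqP => // <-.
Qed.

(** Lowering by the top power carries both edges out of [t] to edges out of one smaller
    configuration whose level is again even; the raised bead may change but not its colour, so
    induction applies. *)
Lemma oddc_up_inj N t p q : (level t <= N)%N -> ~~ odd (level t) -> oddc t ->
  oddc (t + U_(p))%MM -> oddc (t + U_(q))%MM -> col p = col q -> p = q.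
Proof.
elim: N t p q => [|N IH] t p q leN ev ot op oq cpq.
  have l0 : level t = 0%N by lia.
  apply: (oddc_inj ot) => //.
  by rewrite (level0_top ot l0 (oddc_inj op)) (level0_top ot l0 (oddc_inj oq)).
have [l0|l1] := leqP (level t) 1.
  have {}l0 : level t = 0%N by case: (level t) l0 ev => [|[]].
  by apply: (IH t) cpq; rewrite ?l0.
have [k /andP[wt lt2]] := top_power l1 ev.
have [b [c [/andP[wb ob] /andP[wc oc] bc]]] := edge_step ot op wt lt2.
have [b' [c' [/andP[wb' ob'] /andP[wc' oc'] bc']]] := edge_step ot oq wt lt2.
have w1 : (1 < 2 ^ k)%N by case/andP: wt.
have ew : ~~ odd (2 ^ k) by rewrite oddX orbF; case: (k) w1.
(* The bead lowered in [t] does not depend on the edge. *)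
have Db : b' = b.
  apply/eqP; apply/negPn/negP => nb.
  apply: (two_moves _ nb wb' wb (oddc_deg ot) (oddc_inj ot) (oddc_inj ob') (oddc_inj ob)).
  exact: ltnW.
subst b'; move: (2 ^ k)%N w1 ew wt lt2 wb ob wc oc bc wc' oc' bc' {wb' ob'} => w
  w1 ew wt lt2 wb ob wc oc bc wc' oc' bc'.
(* The image of an edge: the raised bead is still [a], or it is [e] after the rotation. *)
have red a e : (w <= (t + U_(a))%MM e)%N -> oddc (t + U_(a) - U_(e) *+ w)%MM ->
    e = b \/ [/\ [&& e != b, e != a & b != a], col b = col a, col e = col a,
      t b = (t a + w).+1 & t e = (t a + w)%N] ->
  oddc (t - U_(b) *+ w + U_(if e == b then a else e))%MM.
  move=> we oe [Eb|[nn cb ce tb te]]; first by rewrite Eb eqxx -up_dn_comm // -{1}Eb.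
  have [ct Et _] := edge_rot w1 nn cb ce tb te.
  by case/and3P: nn => /negPf -> _ _; rewrite (oddc_perm ct Et).
have op' := red _ _ wc oc bc; have oq' := red _ _ wc' oc' bc'.
have colE a e : e = b \/ [/\ [&& e != b, e != a & b != a], col b = col a,
      col e = col a, t b = (t a + w).+1 & t e = (t a + w)%N] ->
    col (if e == b then a else e) = col a.
  by move=> [->|[_ _ ce _ _]]; [rewrite eqxx | case: ifP].
have lt' := level_sub wb.
have := IH (t - U_(b) *+ w)%MM _ _ _ _ ob op' oq' _; rewrite lt' !colE //.
have le' : (level t - w <= N)%N by clear -leN w1 wt; lia.
have ev' : ~~ odd (level t - w) by case/andP: wt => _ wt; rewrite oddB // (negPf ew) addbF.
move=> /(_ le' ev' cpq).
(* If the edge of [y] is rotated, [b] stands just above [e] in [t], so that [e] cannot be raised.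
   Thus a rotated edge and an unrotated one have different images. *)
have clash x y e : oddc (t + U_(x))%MM -> [/\ [&& e != b, e != y & b != y],
     col b = col y, col e = col y, t b = (t y + w).+1 & t e = (t y + w)%N] -> x <> e.
  move=> ox [/and3P[neb ney nby] cb ce tb te] xe; rewrite xe in ox.
  have nbe : b != e by rewrite eq_sym.
  case/eqP: neb; apply: (oddc_inj ox); first by rewrite ce.
  by rewrite up_id up_neq // tb te.
case: bc => [->|H]; case: bc' => [->|H']; rewrite ?eqxx //.
- by case: (H') => /and3P[/negPf-> _ _] _ _ _ _ /(clash _ _ _ op H').
- by case: (H) => /and3P[/negPf-> _ _] _ _ _ _ /esym/(clash _ _ _ oq H).
case: H => /and3P[/negPf-> _ _] _ cc _ tc; case: H' => /and3P[/negPf-> _ _] _ cc' _ tc' E.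
by apply: (oddc_inj ot) => //; rewrite E tc' in tc; clear -tc; lia.
Qed.

(** The same descent for edges into [s]: what the two edges share is the bead [c] lowered in [s]. At
    level 1 the removed box lies on a bead at place [r], and only one bead can stand outside the
    places of the ground state. *)
Lemma oddc_down_inj N s p q : (level s <= N)%N -> odd (level s) -> oddc s ->
  (0 < s p)%N -> oddc (s - U_(p))%MM -> (0 < s q)%N -> oddc (s - U_(q))%MM -> p = q.
Proof.
elim: N s p q => [|N IH] s p q leN od os sp op sq oq; first by lia.
have lev x : (0 < s x)%N -> level (s - U_(x))%MM = (level s).-1.
  by move=> sx; rewrite -[X in (_ - X)%MM]mulm1n level_sub // subn1.
have osp : oddc (s - U_(p) + U_(p))%MM by rewrite dn1K.
have osq : oddc (s - U_(q) + U_(q))%MM by rewrite dn1K.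
have [l1|l1] := leqP (level s) 2.
  have {}l1 : level s = 1%N by case: (level s) l1 od => [|[|[]]].
  have lp : level (s - U_(p))%MM = 0%N by rewrite lev // l1.
  have lq : level (s - U_(q))%MM = 0%N by rewrite lev // l1.
  have tp := level0_top op lp (oddc_inj osp); have tq := level0_top oq lq (oddc_inj osq).
  have [sg _ Dt] := level0_coef op lp.
  apply/eqP; apply/negPn/negP => npq.
  have := dl_lt (sg q); rewrite -Dt -[X in (_ - X)%MM]mulm1n dn_neq 1?eq_sym //.
  by move: tq; rewrite -[X in (_ - X)%MM]mulm1n dn_id; have := dl_lt q; lia.
have ev : ~~ odd (level s).-1 by case: (level s) od l1.
have l2 : (1 < (level s).-1)%N by lia.
have [k /andP[wt lt2]] := top_power l2 ev.
have := edge_step (k := k) op osp; have := edge_step (k := k) oq osq; rewrite !lev // !dn1K //.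
move=> /(_ wt lt2)[b' [c' [/andP[wb' ob'] /andP[wc' oc'] bc']]].
move=> /(_ wt lt2)[b [c [/andP[wb ob] /andP[wc oc] bc]]].
have w1 : (1 < 2 ^ k)%N by case/andP: wt.
have ew : ~~ odd (2 ^ k) by rewrite oddX orbF; case: (k) w1.
have Dc : c' = c.
  apply/eqP; apply/negPn/negP => nc.
  apply: (two_moves _ nc wc' wc (oddc_deg os) (oddc_inj os) (oddc_inj oc') (oddc_inj oc)).
  by rewrite -[level s]prednK // (ltn_trans _ l1).
subst c'; move: (2 ^ k)%N w1 ew wt lt2 wb ob wc oc bc wb' ob' bc' {wc' oc'} => w
  w1 ew wt lt2 wb ob wc oc bc wb' ob' bc'.
pose cyc a e := [/\ [&& c != e, c != a & e != a], col e = col a, col c = col a,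
   (s - U_(a))%MM e = ((s - U_(a))%MM a + w).+1 & (s - U_(a))%MM c = ((s - U_(a))%MM a + w)%N].
(* The third identity of [edge_rot] describes the image of an edge seen from its upper end. *)
have red a e : (0 < s a)%N -> (w <= (s - U_(a))%MM e)%N -> oddc (s - U_(a) - U_(e) *+ w)%MM ->
    c = e \/ cyc a e ->
  let x := if c == e then a else e in
  (0 < (s - U_(c) *+ w)%MM x)%N && oddc (s - U_(c) *+ w - U_(x))%MM.
  move=> sa we oe [Eb|[nn ce cc te tc]] /=.
    rewrite -Eb eqxx; rewrite -Eb -{1}[U_(a)%MM]mulm1n in we.
    rewrite -Eb -{1}[U_(a)%MM]mulm1n dn_comm mulm1n in oe.
    rewrite oe andbT; case: (eqVneq a c) => [ac|ac]; last by rewrite dn_neq.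
    by rewrite ac in sa we *; move: we; rewrite !dn_id; clear -sa w1; lia.
  have [ct _ Et] := edge_rot w1 nn ce cc te tc; rewrite dn1K // in Et.
  case/and3P: nn => nce _ nea; rewrite (negPf nce) -(oddc_perm ct Et) oe andbT.
  rewrite dn_neq 1?eq_sym //; move: te.
  by rewrite -[X in (_ - X)%MM]mulm1n dn_neq // => ->.
have /andP[xp op'] := red _ _ sp wb ob bc; have /andP[xq oq'] := red _ _ sq wb' ob' bc'.
have ls' := level_sub wc.
have := IH (s - U_(c) *+ w)%MM _ _ _ _ oc xp op' xq oq'; rewrite ls'.
have wls : (w <= level s)%N by clear -wt l1; lia.
have le' : (level s - w <= N)%N by clear -leN w1 wls; lia.
have od' : odd (level s - w) by rewrite oddB // od (negPf ew).
move=> /(_ le' od').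
have cycE a e : (0 < s a)%N -> cyc a e -> s e = (s a + w)%N /\ s e = (s c).+1.
  move=> sa [/and3P[nce nca nea] _ _ te tc]; move: te tc.
  by rewrite -[X in (_ - X)%MM]mulm1n dn_id !dn_neq //; clear -sa; lia.
have clash x y e : (0 < s x)%N -> (0 < s y)%N -> oddc (s - U_(x))%MM -> cyc y e -> x <> e.
  move=> sx sy ox H xe; have [_ se] := cycE _ _ sy H; subst x.
  case: H => /and3P[nce nca nea] ce cc _ _.
  case/eqP: nce; apply: (oddc_inj ox); first by rewrite cc.
  rewrite -[X in (_ - X)%MM]mulm1n dn_id dn_neq ?se ?subn1 //.
  by apply/eqP=> E; rewrite E in se; clear -se; lia.
case: bc => [E1|H]; case: bc' => [E2|H'].
- by rewrite -{1}E1 -{1}E2 !eqxx.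
- have [/and3P[/negPf nce _ _] _ _ _ _] := H'.
  by rewrite nce -{1}E1 eqxx => /(clash _ _ _ sp sq op H').
- have [/and3P[/negPf nce _ _] _ _ _ _] := H.
  by rewrite nce -{1}E2 eqxx => /esym/(clash _ _ _ sq sp oq H).
have [/and3P[/negPf-> _ _] cb _ _ _] := H; have [/and3P[/negPf-> _ _] cb' _ _ _] := H'.
move=> E; have [sb _] := cycE _ _ sp H; have [sb' _] := cycE _ _ sq H'.
by apply: (oddc_inj os); [rewrite -cb -cb' E | rewrite E sb' in sb; clear -sb; lia].
Qed.

(** At even level the descent to the ground state lowers beads only by even powers of 2, so no
    parity changes. Hence every colour has even size, which is what later separates the characters
    of SL_n. *)
Lemma oddc_even_colour N t c : (level t <= N)%N -> ~~ odd (level t) -> oddc t ->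
  odd (\sum_(p | col p == c) t p) = odd (\sum_(p | col p == c) dl p).
Proof.
elim: N t => [|N IH] t leN ev ot; last first.
  have [l0|l1] := leqP (level t) 1.
    by apply: IH => //; case: (level t) l0 ev => [|[]].
  have [k /andP[/andP[w1 wt] _]] := top_power l1 ev.
  have ew : ~~ odd (2 ^ k) by rewrite oddX orbF; case: (k) w1.
  have [b /andP[wb ob]] := oddc_step ot wt.
  rewrite -(IH _ _ _ ob) ?level_sub //; try lia.
  case: (eqVneq (col b) c) => [cb|ncb].
    rewrite (bigD1 b) ?cb //= [in RHS](bigD1 b) ?cb //= dn_id.
    rewrite [X in odd (_ + X) = _](eq_bigr (fun p => (t - U_(b) *+ 2 ^ k)%MM p)).
      by rewrite !oddD oddB // (negPf ew) addbF.
    by move=> p /andP[_ pb]; rewrite dn_neq.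
  congr odd; apply: eq_bigr => p /eqP cp; rewrite dn_neq //.
  by apply: contra_neq ncb => <-.
have l0 : level t = 0%N by lia.
have [sg /forallP cs Dt] := level0_coef ot l0.
congr odd; rewrite [RHS](reindex_perm sg) /=.
by apply: eq_big => [p|p _]; [rewrite (eqP (cs p)) | rewrite Dt].
Qed.

End PathCount.

(** * Powers of [h_1] as combinations of Jacobi-Trudi determinants *)

Section PowerSum.

Variables (C : finType) (R r : nat) (col : 'I_R -> C) (dl : 'I_R -> nat).
Variable pos : C -> nat -> 'I_R.
Hypothesis dl_lt : forall p, (dl p < r)%N.
Hypothesis posK : forall p, pos (col p) (dl p) = p.
Hypothesis col_pos : forall c k, (k < r)%N -> col (pos c k) = c.
Hypothesis dl_pos : forall c k, (k < r)%N -> dl (pos c k) = k.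

Notation mono := (mono col dl).
Notation npaths := (npaths col dl).
Notation d0 := (d0 dl).
Implicit Types s t : 'X_{1..R}.

Lemma mono_step s p q e : mono s -> col p = col q -> (dl p <= dl q)%N ->
  (dl p + e <= s p)%N -> (dl q + e <= s q)%N.
Proof.
move=> /monoP ms; move Dk : (dl q - dl p)%N => k; elim: k q Dk => [|k IH] q Dk cpq le_pq ge_p.
  by rewrite -(cdl_inj posK cpq _) //; lia.
have lt_qr : ((dl q).-1 < r)%N by have := dl_lt q; lia.
pose q' := pos (col q) (dl q).-1.
have cq' : col q' = col q by apply: col_pos.
have dq' : dl q' = (dl q).-1 by apply: dl_pos.
have lt : (s q' < s q)%N by apply: ms; rewrite // dq'; lia.
have := IH q'; rewrite cq' dq' => /(_ _ cpq _ ge_p); lia.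
Qed.

Lemma mono_ge s p : mono s -> (dl p <= s p)%N.
Proof.
move=> ms; have r0 : (0 < r)%N by have := dl_lt p; lia.
have cp : col (pos (col p) 0%N) = col p by apply: col_pos.
by have := @mono_step s (pos (col p) 0%N) p 0%N ms cp; rewrite dl_pos // !addn0; apply.
Qed.

(** Otherwise all [r] beads of colour [c] would be raised, which takes at least [r] boxes. This
    supplies the bead at 0 that the Pieri rule asks for. *)
Lemma mono_bead0 s c : (0 < r)%N -> mono s -> (mdeg s < d0 + r)%N ->
  exists2 p, col p = c & s p = 0%N.
Proof.
move=> r0 ms lt; exists (pos c 0%N); first exact: col_pos.
apply/eqP; rewrite -leqn0 leqNgt; apply/negP => gt0.
suff : (d0 + r <= mdeg s)%N by lia.
have gt p : col p = c -> (dl p + 1 <= s p)%N.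
  move=> cp; apply: (@mono_step s (pos c 0%N)); rewrite ?col_pos ?dl_pos //.
have := card_vars dl_lt posK col_pos dl_pos c; rewrite -sum1_card => {1}<-.
rewrite big_mkcond mdegE /d0 -big_split /=; apply: leq_sum => p _.
rewrite inE; case: eqP => [/gt //|_]; rewrite addn0; exact: mono_ge.
Qed.

Lemma det_JTmx_rep (A : comNzRingType) (h : C -> nat -> A) (s : 'I_R -> nat) p q :
  p != q -> col p = col q -> s p = s q -> \det (JTmx col dl h s) = 0.
Proof.
move=> npq cpq spq; apply: (determinant_alternate npq) => j.
by rewrite !mxE cpq spq.
Qed.

Lemma mono_up_rep s p : mono s -> ~~ mono (s + U_(p))%MM ->
  exists q, [/\ p != q, col p = col q & (s + U_(p))%MM p = (s + U_(p))%MM q].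
Proof.
move=> /monoP ms /forallPn[x /forallPn[q]]; rewrite negb_imply => /andP[/andP[/eqP cxq lt]].
have := ms _ _ cxq lt; rewrite !mnmDE !mnm1E.
have nxq : x != q by apply: contraTneq lt => ->; rewrite ltnn.
case: (eqVneq p x) => [->|npx]; last by case: eqP; lia.
rewrite (negPf nxq) => lt2 ge; exists q; split=> //.
by rewrite !mnmDE !mnm1E eqxx (negPf nxq); lia.
Qed.

Lemma mono_down s p : bead_inj col s -> mono (s + U_(p))%MM -> mono s.
Proof.
move=> bs /monoP ms; apply/monoP=> x q cxq lt; have := ms _ _ cxq lt.
have nxq : x != q by apply: contraTneq lt => ->; rewrite ltnn.
rewrite !mnmDE !mnm1E; case: (eqVneq p x) => [->|npx]; first by rewrite (negPf nxq); lia.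
have sxq : s x != s q by apply: contraNneq nxq => /(bs _ _ cxq) ->.
by move: sxq; case: eqP; lia.
Qed.

Lemma npaths0 s : mono s -> npaths 0 s = (s == [multinom dl p | p < R])%:R.
Proof.
move=> ms; rewrite /npaths expr0 mulr1 eq_sym -(mcoeff_alt_mono dl_lt posK col_pos dl_pos) //.
  by congr (_ @_ _); congr (\det _); apply/matrixP=> x y; rewrite !mxE mnmE.
by apply/monoP=> p q; rewrite !mnmE.
Qed.

Lemma npaths_sum N m : (m + d0 < N)%N ->
  alt col dl * (\sum_p 'X_p) ^+ m = \sum_(s : 'X_{1..R < N}) npaths m s *: 'X_[s].
Proof.
move=> ltN; apply/mpolyP=> u; rewrite raddf_sum /= -/(npaths m u).
under eq_bigr => s _ do rewrite mcoeffZ mcoeffX.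
have [uN|uN] := ltnP (mdeg u) N.
  rewrite (bigD1 (BMultinom uN)) //= eqxx mulr1 big1 ?addr0 // => s ns.
  by case: eqP => [E|]; rewrite ?mulr0 //; case/eqP: ns; apply: val_inj.
rewrite big1 => [|s _]; last first.
  by case: eqP => [E|]; rewrite ?mulr0 //; have := bmdeg s; rewrite E; lia.
apply/eqP; apply: contraTT uN => /(npaths_deg) ->; lia.
Qed.

Lemma npathsS N m s : (m + d0 < N)%N ->
  npaths m.+1 s = \sum_(t : 'X_{1..R < N}) \sum_p npaths m t * (t + U_(p) == s)%MM%:R.
Proof.
move=> ltN.
transitivity ((alt col dl * (\sum_p 'X_p) ^+ m * \sum_p 'X_p : {mpoly int[R]})@_s).
  by rewrite -mulrA -exprSr.
rewrite (npaths_sum ltN) mulr_suml raddf_sum /=; apply: eq_bigr => t _.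
rewrite mulr_sumr raddf_sum /=; apply: eq_bigr => p _.
by rewrite -scalerAl -mpolyXD mcoeffZ mcoeffX.
Qed.

Variables (A : comNzRingType) (h : C -> nat -> A).
Hypothesis h0 : forall c, h c 0%N = 1.

(** The iterated Pieri rule. It holds in any ring and for any [h] with [h_0 = 1], in particular for
    the polynomials in the Gram matrix of the characters. *)
Lemma psum_JT N m : (m + d0 < N)%N -> (m <= r)%N ->
  (\sum_c h c 1%N) ^+ m = \sum_(s : 'X_{1..R < N} | mono s)
     (npaths m s)%:~R * \det (JTmx col dl h s).
Proof.
elim: m => [|m IH] ltN ler.
  have dlN : (mdeg [multinom dl p | p < R] < N)%N.
    by rewrite mdegE (eq_bigr dl) // => i _; rewrite mnmE.
  have mdl : mono (BMultinom dlN) by apply/monoP=> p q; rewrite !mnmE.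
  rewrite expr0 (bigD1 (BMultinom dlN)) //= npaths0 // eqxx mul1r big1 ?addr0.
    rewrite -[LHS](det_JTmx_dl posK h0); congr (\det _).
    by apply/matrixP=> x y; rewrite !mxE mnmE.
  move=> s /andP[ms ns]; rewrite npaths0 //.
  by case: eqP => [E|]; rewrite ?mul0r //; case/eqP: ns; apply: val_inj.
(* Cutting the determinant off outside [mono] loses nothing: a step that leaves [mono] puts two
   beads together and creates two equal rows. *)
pose G (s : 'X_{1..R}) : A := if mono s then \det (JTmx col dl h s) else 0.
have GE s p : mono s -> \det (JTmx col dl h (fun q => s q + (q == p))%N) = G (s + U_(p))%MM.
  move=> ms; have E : \det (JTmx col dl h (fun q => s q + (q == p))%N)
      = \det (JTmx col dl h (s + U_(p))%MM).
    by congr (\det _); apply/matrixP=> x y; rewrite !mxE mnmDE mnm1E (eq_sym p).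
  rewrite E /G; case: ifPn => // /(mono_up_rep ms)[q [npq cpq spq]].
  exact: det_JTmx_rep npq cpq spq.
transitivity (\sum_(s : 'X_{1..R < N}) (npaths m s)%:~R * \sum_p G (s + U_(p))%MM).
  rewrite exprS IH ?(ltnW ler) //; last by lia.
  rewrite mulr_sumr [LHS]big_mkcond /=; apply: eq_bigr => s _.
  have [->|nz] := eqVneq (npaths m s) 0; first by rewrite !mul0r mulr0 if_same.
  case: ifPn => [ms|nms]; last first.
    rewrite big1 ?mulr0 // => p _; rewrite /G; case: ifPn => // /mono_down E.
    by rewrite E // in nms; apply: npaths_inj nz.
  rewrite mulrCA; congr (_ * _); rewrite mulr_suml (partition_big col predT) //=.
  apply: eq_bigr => c _.
  have lts : (mdeg s < d0 + r)%N.
    by have -> := npaths_deg nz; lia.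
  have [p0 cp0 sp0] := mono_bead0 c (leq_ltn_trans (leq0n m) ler) ms lts.
  rewrite (det_JTmx_Pieri dl_lt posK col_pos dl_pos h0 cp0 sp0).
  by apply: eq_bigr => p _; rewrite GE.
transitivity (\sum_(s : 'X_{1..R < N}) (npaths m.+1 s)%:~R * G s); last first.
  by rewrite [RHS]big_mkcond; apply: eq_bigr => s _; rewrite /G; case: ifP; rewrite ?mulr0.
have -> : \sum_(s : 'X_{1..R < N}) (npaths m s)%:~R * \sum_p G (s + U_(p))%MM
   = \sum_(s : 'X_{1..R < N}) \sum_p (npaths m s)%:~R * G (s + U_(p))%MM.
  by apply: eq_bigr => s _; rewrite mulr_sumr.
have E2 s := npathsS s (ltnW ltN).
transitivity (\sum_(s : 'X_{1..R < N}) \sum_(t : 'X_{1..R < N}) \sum_p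
    (npaths m t)%:~R * ((t + U_(p) == s)%MM%:R * G s)); last first.
  apply: eq_bigr => s _; rewrite E2 rmorph_sum mulr_suml; apply: eq_bigr => t _.
  rewrite rmorph_sum mulr_suml; apply: eq_bigr => p _.
  by rewrite /= intrM rmorph_nat mulrA.
rewrite [RHS]exchange_big /=; apply: eq_bigr => t _; rewrite [RHS]exchange_big /=; apply: eq_bigr => p _.
rewrite -mulr_sumr.
have [->|nz] := eqVneq (npaths m t) 0; first by rewrite !mul0r.
congr (_ * _); have tN : (mdeg (t + U_(p))%MM < N)%N.
  by rewrite mdegD mdeg1 (npaths_deg nz); lia.
rewrite (bigD1 (BMultinom tN)) //= eqxx mul1r big1 ?addr0 // => s ns.
by case: eqP => [E|]; rewrite ?mul0r //; case/eqP: ns; apply: val_inj.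
Qed.

End PowerSum.

(** * Pairs of flags *)

Section DetRes.

Variables (F : fieldType) (n : nat).
Implicit Types (A B U W K L : 'M[F]_n).

(* The determinant of [A] on the row space of [W]; meaningful only if that space
   is stable under [A]. *)
Definition detres W A : F := \det (row_base W *m A *m pinvmx (row_base W)).

Lemma detres_unique r (B : 'M_(r, n)) (M : 'M_r) W A :
  row_free B -> (B :=: W)%MS -> B *m A = M *m B -> detres W A = \det M.
Proof.
move=> fB eqBW BA; have Er : r = \rank W by rewrite -eqBW (eqP fB).
subst r; pose B0 := row_base W; pose T := B *m pinvmx B0.
have DB : B = T *m B0.
  by rewrite mulmxKpV // eqBW eq_row_base.
have fB0 : row_free B0 by apply: row_base_free.
have uT : T \in unitmx.
  by rewrite -row_free_unit -row_leq_rank -{1}(eqP fB) DB mxrankM_maxl.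
have B0A : B0 *m A = invmx T *m M *m T *m B0.
  have -> : B0 *m A = invmx T *m B *m A by rewrite DB mulKmx.
  by rewrite -mulmxA BA DB !mulmxA.
rewrite /detres -/B0 B0A -(mulmxA _ B0) mulmxVp // mulmx1 !det_mulmx det_inv mulrAC.
by rewrite mulVr ?mul1r // -unitmxE.
Qed.

Lemma detres_base W A : stablemx W A ->
  row_base W *m A = row_base W *m A *m pinvmx (row_base W) *m row_base W.
Proof.
move=> sWA; rewrite mulmxKpV // eq_row_base; apply: submx_trans sWA.
by apply: submxMr; rewrite eq_row_base.
Qed.

Lemma detres_eqmx U W A : (U :=: W)%MS -> stablemx W A -> detres U A = detres W A.
Proof.
move=> eqUW sWA; apply: (detres_unique (row_base_free W)); last exact: detres_base.
by apply: eqmx_trans (eqmx_sym eqUW); apply: eq_row_base.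
Qed.

Lemma detres_eq_act W A B : W *m A = W *m B -> detres W A = detres W B.
Proof.
have /submxP[X DX] : (row_base W <= W)%MS by rewrite eq_row_base.
move=> E; rewrite /detres; congr (\det (_ *m _)).
by rewrite DX -!mulmxA E.
Qed.

Lemma detresM W A B : stablemx W A -> stablemx W B ->
  detres W (A *m B) = detres W A * detres W B.
Proof.
move=> sA sB; rewrite -det_mulmx; apply: (detres_unique (row_base_free W)).
  exact: eq_row_base.
rewrite mulmxA [X in X *m B = _](detres_base sA) -mulmxA.
by rewrite [X in _ *m X = _](detres_base sB) !mulmxA.
Qed.

Lemma detres_conj W A G : G \in unitmx -> stablemx W A ->
  detres (W *m G) (invmx G *m A *m G) = detres W A.
Proof.
move=> uG sA; apply: (@detres_unique _ (row_base W *m G)).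
- by rewrite /row_free mxrankMfree ?row_free_unit // (eqP (row_base_free W)).
- exact: eqmxMr (eq_row_base W).
- have -> : row_base W *m G *m (invmx G *m A *m G) = row_base W *m A *m G.
    by rewrite !mulmxA mulmxK.
  by rewrite [X in X *m G = _](detres_base sA) -!mulmxA.
Qed.

Lemma detres_full W A : (W :=: 1%:M)%MS -> detres W A = \det A.
Proof.
move=> eqW1; apply: (@detres_unique _ 1%:M); rewrite ?mul1mx ?mulmx1 //.
  by rewrite row_free_unit unitmx1.
exact: eqmx_sym.
Qed.

Lemma detres0 W A : \rank W = 0%N -> detres W A = 1.
Proof.
move/eqP; rewrite mxrank_eq0 => /eqP ->.
rewrite (@detres_unique 0 (0 : 'M_(0, n)) (0 : 'M_0)) ?det_mx00 //.
- by rewrite /row_free mxrank0.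
- by apply/eqmxP; rewrite !sub0mx.
- by rewrite !mul0mx.
Qed.

Lemma detres_id W A : W *m A = W -> detres W A = 1.
Proof.
move=> WA; rewrite (@detres_unique _ (row_base W) 1%:M) ?det1 ?mul1mx //.
- exact: row_base_free.
- exact: eq_row_base.
have /submxP[X ->] : (row_base W <= W)%MS by rewrite eq_row_base.
by rewrite -mulmxA WA.
Qed.

Lemma detres_neq0 W A : A \in unitmx -> stablemx W A -> detres W A != 0.
Proof.
move=> uA sA; rewrite /detres; set M := _ *m _ *m _.
have uM : M \in unitmx.
  rewrite -row_free_unit -row_leq_rank.
  apply: leq_trans (mxrankM_maxl M (row_base W)); rewrite -detres_base //.
  by rewrite mxrankMfree ?row_free_unit // eq_row_base.
by rewrite -unitfE -unitmxE.
Qed.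

Lemma row_free_col_mx m1 m2 (A : 'M[F]_(m1, n)) (B : 'M[F]_(m2, n)) :
  row_free A -> row_free B -> (A :&: B)%MS = 0 -> row_free (col_mx A B).
Proof.
move=> /eqP fA /eqP fB AB; have /mxdirect_addsP/mxdirectP /= := AB.
by rewrite addsmxE fA fB => /eqP.
Qed.

Lemma detres_quot U W (r : nat) (B : 'M_(r, n)) (X : 'M_(r, \rank U)) (M : 'M_r) A :
  stablemx U A -> row_free B -> (U :&: B)%MS = 0 -> (U + B :=: W)%MS ->
  B *m A = X *m row_base U + M *m B -> detres W A = detres U A * \det M.
Proof.
move=> sA fB UB eqW BA.
pose N := row_base U *m A *m pinvmx (row_base U).
rewrite (@detres_unique _ (col_mx (row_base U) B) (block_mx N 0 X M)).
- by rewrite det_lblock.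
- apply: row_free_col_mx => //; first exact: row_base_free.
  apply/eqP; rewrite -submx0 -UB; apply: capmxS => //; by rewrite eq_row_base.
- apply: eqmx_trans (eqmx_sym (addsmxE _ _)) _.
  apply: eqmx_trans eqW; apply: adds_eqmx => //.
  exact: eq_row_base.
by rewrite mul_col_mx mul_block_col mul0mx addr0 -BA -detres_base.
Qed.

Lemma stablemx_cap K L A : stablemx K A -> stablemx L A -> stablemx (K :&: L)%MS A.
Proof.
move=> sK sL; rewrite sub_capmx; apply/andP; split.
  by apply: submx_trans sK; apply: submxMr; rewrite capmxSl.
by apply: submx_trans sL; apply: submxMr; rewrite capmxSr.
Qed.

(** A complement [C] of the intersection in [K] is also a complement of [L] in the sum, and [A] acts
    on both quotients by the same matrix [M]. *)
Lemma detres_modular K L A : stablemx K A -> stablemx L A ->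
  detres (K + L)%MS A * detres (K :&: L)%MS A = detres K A * detres L A.
Proof.
move=> sK sL; pose C := row_base (K :\: L)%MS.
have fC : row_free C by apply: row_base_free.
have eqC : (C :=: K :\: L)%MS by apply: eq_row_base.
have CK : (C <= K)%MS by rewrite eqC diffmxSl.
have sKL := stablemx_cap sK sL.
have eqK : (K :&: L + C :=: K)%MS.
  apply: eqmx_trans (addsmx_diff_cap_eq K L).
  by rewrite addsmxC; apply: adds_eqmx.
have [X [M CA]] : exists X, exists M, C *m A = X *m row_base (K :&: L)%MS + M *m C.
  have : (C *m A <= row_base (K :&: L)%MS + C)%MS.
    rewrite (adds_eqmx (eq_row_base _) (eqmx_refl _)) eqK.
    by apply: submx_trans sK; apply: submxMr.
  by case/sub_addsmxP=> -[X M] /= E; exists X, M.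
have LC : (L :&: C)%MS = 0.
  apply/eqP; rewrite -submx0 -(capmx_diff K L) capmxC.
  by apply: capmxS; rewrite ?eqC.
have DK : detres K A = detres (K :&: L)%MS A * \det M.
  apply: (detres_quot sKL fC _ eqK CA).
  apply/eqP; rewrite -submx0 -LC; apply: capmxS => //; exact: capmxSr.
have -> : detres (K + L)%MS A = detres L A * \det M.
  have /submxP[Y DY] : (row_base (K :&: L)%MS <= row_base L)%MS.
    by rewrite !eq_row_base capmxSr.
  apply: (detres_quot (X := X *m Y) sL fC LC); last by rewrite -mulmxA -DY.
  apply: eqmx_trans (adds_eqmx (eqmx_refl L) eqC) _.
  apply/eqmxP/andP; split; rewrite addsmx_sub.
    by rewrite addsmxSr (submx_trans (diffmxSl K L) (addsmxSl _ _)).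
  rewrite addsmxSl andbT -{1}(addsmx_diff_cap_eq K L) addsmx_sub addsmxSr.
  by rewrite (submx_trans (capmxSr _ _) (addsmxSl _ _)).
by rewrite DK; ring.
Qed.

(** The matrix determinant lemma, from two triangular factorizations of one block matrix. *)
Lemma det_1D_rank1 r (u : 'cV[F]_r) (y : 'rV[F]_r) :
  \det (1%:M + u *m y) = 1 + (y *m u) 0 0.
Proof.
have E1 : block_mx (1%:M : 'M_1) 0 u 1%:M *m block_mx 1%:M (- y) 0 (1%:M + u *m y)
  = block_mx (1%:M : 'M_1) (- y) u 1%:M.
  rewrite mulmx_block !mul1mx !mulmx1 !mul0mx !addr0.
  by congr block_mx; rewrite mulmxN addrC addrK.
have E2 : block_mx (1%:M + y *m u) (- y) 0 1%:M *m block_mx (1%:M : 'M_1) 0 u 1%:M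
  = block_mx (1%:M : 'M_1) (- y) u 1%:M.
  rewrite mulmx_block !mul1mx !mulmx1 !mul0mx !mulmx0 !add0r.
  by rewrite mulNmx addrK.
have := congr1 determinant E1; rewrite -E2 !det_mulmx !det_lblock !det_ublock !det1.
rewrite !mul1r !mulr1 det_mx11 => ->.
by rewrite !mxE.
Qed.

(* The homothety of ratio [a] on the line [v] along the kernel of [phi]. *)
Definition homothety (a : F) (phi : 'cV[F]_n) (v : 'rV[F]_n) : 'M[F]_n :=
  1%:M + (a - 1) *: (phi *m v).

Lemma mulmx_homothety m (X : 'M_(m, n)) a phi v :
  X *m homothety a phi v = X + (a - 1) *: (X *m phi *m v).
Proof. by rewrite mulmxDr mulmx1 -scalemxAr mulmxA. Qed.

Lemma homothety_unit a phi v : a != 0 -> v *m phi = 1%:M ->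
  homothety a phi v \in unitmx.
Proof.
move=> a0 vphi; rewrite unitmxE unitfE /homothety scalemxAl det_1D_rank1.
by rewrite -scalemxAr vphi !mxE mulr1 addrC subrK.
Qed.

Lemma detres_homothety W a phi v : (v <= W)%MS -> v *m phi = 1%:M ->
  detres W (homothety a phi v) = a.
Proof.
rewrite -(eq_row_base W) => /submxP[y Dv] vphi.
rewrite (@detres_unique _ (row_base W) (1%:M + (a - 1) *: (row_base W *m phi) *m y)).
- by rewrite det_1D_rank1 -scalemxAr mulmxA -Dv vphi !mxE mulr1 addrC subrK.
- exact: row_base_free.
- exact: eq_row_base.
by rewrite mulmx_homothety mulmxDl mul1mx -[_ *m y *m _]mulmxA -Dv scalemxAl.
Qed.

Lemma stable_homothety W a phi v : (v <= W)%MS -> stablemx W (homothety a phi v).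
Proof.
by move=> vW; rewrite mulmx_homothety addmx_sub // scalemx_sub // mulmx_sub.
Qed.

End DetRes.

Lemma row_free_exchange (F : fieldType) (N n : nat) (B B' : 'M[F]_(N, n)) :
  row_free B -> row_free B' -> exists2 g, g \in unitmx & B *m g = B'.
Proof.
move=> fB fB'.
have complete (A : 'M[F]_(N, n)) : row_free A ->
    exists C : 'M[F]_(n - N, n), row_free (col_mx A C) && row_full (col_mx A C).
  move=> /[dup] fA /eqP rA.
  have rC : \rank A^C%MS = (n - N)%N by rewrite mxrank_compl rA.
  pose C := castmx (rC, erefl n) (row_base A^C%MS).
  have eqC : (C :=: A^C)%MS.
    exact: eqmx_trans (eqmx_cast _ _) (eq_row_base _).
  exists C; apply/andP; split.
    apply: row_free_col_mx => //; first by rewrite row_free_castmx row_base_free.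
    by apply/eqP; rewrite -submx0 -(capmx_compl A); apply: capmxS; rewrite ?eqC.
  rewrite -sub1mx; apply: submx_trans (submx_full _ (addsmx_compl_full A)) _.
  by rewrite -addsmxE; apply: addsmxS; rewrite ?eqC.
have [C /andP[fC uC]] := complete B fB; have [C' /andP[fC' uC']] := complete B' fB'.
pose g := pinvmx (col_mx B C) *m col_mx B' C'.
have Eg : col_mx B C *m g = col_mx B' C' by rewrite mulmxA mulmxVp // mul1mx.
exists g; last by have := congr1 usubmx Eg; rewrite mul_col_mx !col_mxKu.
rewrite -row_full_unit -col_leq_rank.
by move: uC'; rewrite -col_leq_rank => /leq_trans; apply; rewrite -Eg mxrankM_maxr.
Qed.

Section BlockSpan.

Variables (F : fieldType) (n : nat) (I : finType) (a : I -> nat).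

Notation N := (\sum_(k < #|I|) a (enum_val k))%N.
Variable B : 'M[F]_(N, n).
Implicit Types P Q : pred I.

(** The basis vectors in [B] come in blocks labelled by [I], with [a p] vectors in block [p]; this
    is the span of the blocks selected by [P]. A basis is adapted to two flags when the members of
    both are such spans. *)
Definition bspan P : 'M[F]_n :=
  (\sum_(k < #|I| | P (enum_val k)) <<submxcol B k>>)%MS.

Lemma sum_enum_val P (f : I -> nat) :
  (\sum_(k < #|I| | P (enum_val k)) f (enum_val k) = \sum_(p | P p) f p)%N.
Proof. by rewrite [RHS](reindex _ (onW_bij _ (enum_val_bij I))). Qed.

Lemma bspan_sub P Q : subpred P Q -> (bspan P <= bspan Q)%MS.
Proof. by move=> sPQ; apply/sumsmx_subP => k Pk; apply: (sumsmx_sup k); rewrite ?sPQ. Qed.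

Lemma bspan_block P k : P (enum_val k) -> (submxcol B k <= bspan P)%MS.
Proof. by move=> Pk; apply: (sumsmx_sup k); rewrite ?genmxE. Qed.

Lemma bspanU P Q : (bspan P + bspan Q :=: bspan (predU P Q))%MS.
Proof.
apply/eqmxP/andP; split.
  by rewrite addsmx_sub !bspan_sub // => p; rewrite !inE => ->; rewrite ?orbT.
apply/sumsmx_subP => k /orP[Pk|Qk]; rewrite genmxE.
  by apply: submx_trans (addsmxSl _ _); apply: bspan_block.
by apply: submx_trans (addsmxSr _ _); apply: bspan_block.
Qed.

Lemma bspanT : (bspan predT :=: B)%MS.
Proof.
by apply: eqmx_sym; rewrite -{1}[B]submxcolK; exact: eqmx_col.
Qed.

Lemma eq_bspan P Q : P =1 Q -> bspan P = bspan Q.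
Proof. by move=> E; apply: eq_bigl => k; rewrite E. Qed.

Hypothesis fB : row_free B.

(** The upper bound is immediate, and the bounds for [P] and for its complement add up to the rank
    of [B]. *)
Lemma rank_bspan P : \rank (bspan P) = (\sum_(p | P p) a p)%N.
Proof.
have le Q : (\rank (bspan Q) <= \sum_(p | Q p) a p)%N.
  rewrite -sum_enum_val; apply: leq_trans (mxrank_sum_leqif _) _.
  by rewrite /=; apply: leq_sum => k _; rewrite mxrank_gen rank_leq_row.
apply/eqP; rewrite eqn_leq le /=.
have tot : (\sum_(p | P p) a p + \sum_(p | ~~ P p) a p = \rank B)%N.
  by rewrite (eqP fB) (sum_enum_val predT) [RHS](bigID P).
have : (\rank B <= \rank (bspan P) + \rank (bspan [pred p | ~~ P p]))%N.
  rewrite -mxrank_sum_cap -bspanT; apply: leq_trans (leq_addr _ _); apply: mxrankS.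
  by rewrite bspanU bspan_sub // => p _; rewrite !inE orbN.
by rewrite -tot => H; have := le [pred p | ~~ P p]; move: H => /=; lia.
Qed.

Lemma bspan_cap P Q : (bspan P :&: bspan Q :=: bspan (predI P Q))%MS.
Proof.
apply: eqmx_sym; apply/eqmxP.
have sub : (bspan (predI P Q) <= bspan P :&: bspan Q)%MS.
  by rewrite sub_capmx !bspan_sub // => p /andP[].
rewrite -(mxrank_leqif_eq sub) rank_bspan.
have := mxrank_sum_cap (bspan P) (bspan Q); rewrite bspanU !rank_bspan => E.
have {E} : (\sum_(p | predU P Q p) a p + \rank (bspan P :&: bspan Q)%MS
  = \sum_(p | predU P Q p) a p + \sum_(p | predI P Q p) a p)%N.
  rewrite E !(big_mkcond P) !(big_mkcond Q) [X in (_ = X + _)%N]big_mkcond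
    [X in (_ = _ + X)%N]big_mkcond -!big_split /=; apply: eq_bigr => p _.
  by case: (P p); case: (Q p); rewrite /= ?addn0.
by move/addnI => ->.
Qed.

End BlockSpan.

Section AdaptedBasis.

Variables (F : fieldType) (n R S : nat).
Variables (E E' : nat -> 'M[F]_n) (W : 'M[F]_n).
Hypotheses (E0 : (E 0 :=: W)%MS) (E'0 : (E' 0 :=: W)%MS).
Hypotheses (decE : forall i, (i < R)%N -> (E i.+1 <= E i)%MS)
  (decE' : forall j, (j < S)%N -> (E' j.+1 <= E' j)%MS).
Hypotheses (ER : \rank (E R) = 0%N) (E'S : \rank (E' S) = 0%N).

Let I : finType := ('I_R * 'I_S)%type.

(* A complement: its rank is the number of vectors of an adapted basis in [E i] and
   [E' j] but in no smaller member of either flag. *)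
Definition cell (i j : nat) : 'M[F]_n :=
  ((E i :&: E' j) :\: (E i.+1 :&: E' j + E i :&: E' j.+1))%MS.

Lemma dec_mono i i' : (i <= i' <= R)%N -> (E i' <= E i)%MS.
Proof.
case/andP; elim: i' => [|i' IH]; first by rewrite leqn0 => /eqP->.
rewrite leq_eqVlt => /predU1P[->//|] /IH{}IH lt.
exact: submx_trans (decE lt) (IH (ltnW lt)).
Qed.

Lemma dec_mono' j j' : (j <= j' <= S)%N -> (E' j' <= E' j)%MS.
Proof.
case/andP; elim: j' => [|j' IH]; first by rewrite leqn0 => /eqP->.
rewrite leq_eqVlt => /predU1P[->//|] /IH{}IH lt.
exact: submx_trans (decE' lt) (IH (ltnW lt)).
Qed.

Lemma cell_cap i j : (i < R)%N -> (j < S)%N ->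
  ((E i.+1 :&: E' j + E i :&: E' j.+1) <= E i :&: E' j)%MS.
Proof. by move=> iR jS; rewrite addsmx_sub !capmxS ?decE ?decE'. Qed.

Lemma rank_cell i j : (i < R)%N -> (j < S)%N ->
  (\rank (cell i j) + \rank (E i.+1 :&: E' j)%MS + \rank (E i :&: E' j.+1)%MS
    = \rank (E i :&: E' j)%MS + \rank (E i.+1 :&: E' j.+1)%MS)%N.
Proof.
move=> iR jS.
have := mxrank_cap_compl (E i :&: E' j)%MS (E i.+1 :&: E' j + E i :&: E' j.+1)%MS.
rewrite -/(cell i j) (capmx_idPr (cell_cap iR jS)) => <-.
have := mxrank_sum_cap (E i.+1 :&: E' j)%MS (E i :&: E' j.+1)%MS.
have -> : \rank ((E i.+1 :&: E' j) :&: (E i :&: E' j.+1))%MS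
  = \rank (E i.+1 :&: E' j.+1)%MS.
  apply: eqmx_rank; apply/andP; split.
    rewrite sub_capmx; apply/andP; split.
      by apply: submx_trans (capmxSl _ _) (capmxSl _ _).
    by apply: submx_trans (capmxSr _ _) (capmxSr _ _).
  by rewrite sub_capmx !capmxS ?decE ?decE'.
by move=> H; rewrite -addnA -H addnCA addnA.
Qed.

Variable a : I -> nat.
Hypothesis Da : forall p, a p = \rank (cell p.1 p.2).

(** The Bruhat decomposition in the form needed here. Bases of the cells are put together: they span
    every [E i :&: E' j], and their number is the rank of [W], so they are free. *)
Lemma adapted_basis : exists B : 'M[F]_(\sum_(k < #|I|) a (enum_val k), n),
  [/\ row_free B, (B :=: W)%MS,
      forall i, (i <= R)%N -> (E i :=: bspan B [pred p : I | i <= p.1]%N)%MS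
    & forall j, (j <= S)%N -> (E' j :=: bspan B [pred p : I | j <= p.2]%N)%MS].
Proof.
pose V (k : 'I_#|I|) := cell (enum_val k).1 (enum_val k).2.
pose B_ (k : 'I_#|I|) : 'M[F]_(a (enum_val k), n) :=
  castmx (esym (Da (enum_val k)), erefl n) (row_base (V k)).
have eqB k : (B_ k :=: V k)%MS by exact: eqmx_trans (eqmx_cast _ _) (eq_row_base _).
pose B := \mxcol_k B_ k; exists B.
have bE (P : pred I) : (bspan B P :=: \sum_(k | P (enum_val k)) V k)%MS.
  apply: eqmx_sums => k _; apply: eqmx_trans (genmxE _) _.
  by rewrite /B mxcolK.
have capE i j : (i <= R)%N -> (j <= S)%N ->
    (E i :&: E' j :=: bspan B [pred p : I | (i <= p.1) && (j <= p.2)]%N)%MS.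
  move=> iR jS; apply/eqmxP/andP; split; last first.
    rewrite bE; apply/sumsmx_subP => k /andP[le1 le2].
    apply: submx_trans (diffmxSl _ _) _.
    apply: capmxS; [apply: dec_mono | apply: dec_mono'].
      by rewrite le1 (ltnW (ltn_ord _)).
    by rewrite le2 (ltnW (ltn_ord _)).
  (* Induction on the distance of [(i, j)] from the corner [(R, S)], where the intersection is 0. *)
  rewrite bE; move Dm: ((R - i) + (S - j))%N => m.
  elim: m {-2}m (leqnn m) i j iR jS Dm => [|m IH] m' lem i j iR jS Dm.
    have -> : (E i :&: E' j)%MS = 0; last by rewrite sub0mx.
    apply/eqP; rewrite -mxrank_eq0 -leqn0 -ER; apply: mxrankS.
    by apply: submx_trans (capmxSl _ _) _; rewrite (_ : i = R) //; clear -Dm lem iR; lia.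
  case: (ltngtP i R) iR => [iR _|//|iR _]; last first.
    have -> : (E i :&: E' j)%MS = 0; last by rewrite sub0mx.
    by apply/eqP; rewrite -mxrank_eq0 -leqn0 -ER -iR mxrankS // capmxSl.
  case: (ltngtP j S) jS => [jS _|//|jS _]; last first.
    have -> : (E i :&: E' j)%MS = 0; last by rewrite sub0mx.
    by apply/eqP; rewrite -mxrank_eq0 -leqn0 -E'S -jS mxrankS // capmxSr.
  have dec : (E i :&: E' j <= cell i j + (E i.+1 :&: E' j + E i :&: E' j.+1))%MS.
    rewrite -{1}(addsmx_diff_cap_eq (E i :&: E' j)%MS
      (E i.+1 :&: E' j + E i :&: E' j.+1)%MS).
    by apply: addsmxS; rewrite ?capmxSr.
  apply: submx_trans dec _.
  rewrite !addsmx_sub; apply/and3P; split.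
  - apply: (sumsmx_sup (enum_rank (Ordinal iR, Ordinal jS))).
      by rewrite /= enum_rankK !leqnn.
    by rewrite /V enum_rankK.
  - apply: submx_trans (IH _ _ i.+1 j iR (ltnW jS) (erefl _)) _; first by clear -Dm lem iR jS; lia.
    apply/sumsmx_subP => k /andP[le1 le2]; apply: (sumsmx_sup k) => //=.
    by rewrite le2 ltnW.
  apply: submx_trans (IH _ _ i j.+1 (ltnW iR) jS (erefl _)) _; first by clear -Dm lem iR jS; lia.
  apply/sumsmx_subP => k /andP[le1 le2]; apply: (sumsmx_sup k) => //=.
  by rewrite le1 ltnW.
have capE0 i : (i <= R)%N -> (E i :=: E i :&: E' 0)%MS.
  move=> iR; apply/eqmxP; rewrite capmxSl andbT sub_capmx submx_refl E'0 -E0.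
  by rewrite dec_mono.
have capE'0 j : (j <= S)%N -> (E' j :=: E 0 :&: E' j)%MS.
  move=> jS; apply/eqmxP; rewrite capmxSr andbT sub_capmx submx_refl E0 -E'0.
  by rewrite dec_mono'.
have E_span i : (i <= R)%N -> (E i :=: bspan B [pred p : I | i <= p.1]%N)%MS.
  move=> iR; apply: eqmx_trans (capE0 i iR) _; apply: eqmx_trans (capE i 0%N iR _) _ => //.
  by rewrite (eq_bspan B (Q := [pred p : I | i <= p.1]%N)) // => p /=; rewrite andbT.
have BW : (B :=: W)%MS.
  apply: eqmx_trans (eqmx_sym (bspanT B)) _; apply: eqmx_trans E0.
  by apply: eqmx_sym; apply: eqmx_trans (E_span 0%N _) _.
split=> //; last first.
  move=> j jS; apply: eqmx_trans (capE'0 j jS) _; apply: eqmx_trans (capE 0%N j _ jS) _ => //.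
rewrite /row_free BW -E0 (sum_enum_val predT a); apply/eqP.
(* The size of a cell is a mixed second difference of [d], so the sum over all cells telescopes to
   [d 0 0]. *)
pose d i j : int := (\rank (E i :&: E' j)%MS)%:Z.
have cellZ (i : 'I_R) (j : 'I_S) : (a (i, j))%:Z
    = (d i.+1 j.+1 - d i j.+1) - (d i.+1 j - d i j).
  by rewrite Da; have := rank_cell (ltn_ord i) (ltn_ord j); rewrite /d /=; clear; lia.
have dS i : d i S = 0.
  by apply/eqP; rewrite /d eqz_nat -leqn0 -E'S mxrankS // capmxSr.
have dR j : d R j = 0.
  by apply/eqP; rewrite /d eqz_nat -leqn0 -ER mxrankS // capmxSl.
apply/eqP; rewrite -eqz_nat; apply/eqP.
rewrite -[(\sum_p a p)%N]/(\sum_p a p) (raddf_sum Posz) /=.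
rewrite (eq_bigr (fun p => (a (p.1, p.2))%:Z)) => [|[]//].
rewrite -(pair_bigA _ (fun i j => (a (i, j))%:Z)) /=.
pose g i j := d i.+1 j - d i j.
have rowZ (i : 'I_R) : \sum_(j < S) (a (i, j))%:Z = - (d i.+1 0%N - d i 0%N).
  under eq_bigr => j _ do rewrite cellZ.
  rewrite (eq_bigr (fun j : 'I_S => g i j.+1 - g i j)); last first.
    by move=> j _; rewrite /g; ring.
  rewrite -(big_mkord xpredT (fun j => g i j.+1 - g i j)) telescope_sumr //.
  by rewrite /g !dS subr0 sub0r.
under eq_bigr => i _ do rewrite rowZ.
rewrite sumrN -(big_mkord xpredT (fun i => d i.+1 0%N - d i 0%N)) telescope_sumr //.
rewrite dR sub0r opprK /d; congr Posz; apply/eqmx_rank/eqmxP.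
exact: capE0.
Qed.

End AdaptedBasis.

Section CellSizes.

Variables (F : fieldType) (n R S : nat).
Let I : finType := ('I_R * 'I_S)%type.
Variables (a : I -> nat) (B : 'M[F]_(\sum_(k < #|I|) a (enum_val k), n)).
Hypothesis fB : row_free B.
Variables (E E' : nat -> 'M[F]_n).
Hypotheses
  (EB : forall i, (i <= R)%N -> (E i :=: bspan B [pred p : I | i <= p.1]%N)%MS)
  (EB' : forall j, (j <= S)%N -> (E' j :=: bspan B [pred p : I | j <= p.2]%N)%MS).

Lemma rank_cap_bspan i j : (i <= R)%N -> (j <= S)%N ->
  \rank (E i :&: E' j)%MS = (\sum_(p : I | (i <= p.1) && (j <= p.2)) a p)%N.
Proof.
move=> iR jS.
by rewrite (cap_eqmx (EB iR) (EB' jS)) bspan_cap // rank_bspan.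
Qed.

Lemma cell_size i j (iR : (i < R)%N) (jS : (j < S)%N) :
  (a (Ordinal iR, Ordinal jS) + \rank (E i.+1 :&: E' j)%MS
     + \rank (E i :&: E' j.+1)%MS
    = \rank (E i :&: E' j)%MS + \rank (E i.+1 :&: E' j.+1)%MS)%N.
Proof.
rewrite !rank_cap_bspan ?(ltnW iR) ?(ltnW jS) //.
have -> : a (Ordinal iR, Ordinal jS) = (\sum_(p : I | p == (Ordinal iR, Ordinal jS)) a p)%N.
  by rewrite big_pred1_eq.
rewrite [X in (X + _ + _)%N]big_mkcond [X in (_ + X + _)%N]big_mkcond
  [X in (_ + X = _)%N]big_mkcond [X in (_ = X + _)%N]big_mkcond
  [X in (_ = _ + X)%N]big_mkcond -!big_split /=; apply: eq_bigr => -[x y] _ /=.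
rewrite xpair_eqE -!val_eqE /=.
by case: (ltngtP i x); case: (ltngtP j y) => //= *; rewrite ?addn0.
Qed.

End CellSizes.

Section CoefficientCount.

Variables (S R N : nat) (A : 'I_R -> {set 'I_S}) (k : 'I_R -> nat).

(** Contingency matrices, each row being stored as a multinomial: row sums [k], column sums [l],
    nonzero entries of row [i] only in columns of [A i]. *)
Definition margins (l : 'X_{1..S}) (g : {ffun 'I_R -> 'X_{1..S < N}}) : bool :=
  [forall i, (mdeg (g i) == k i) && (mvars (g i) \subset A i)]
  && ((\sum_i (g i : 'X_{1..S}))%MM == l).

Lemma mcoeff_prod_hsym (l : 'X_{1..S}) : (forall i, (k i < N)%N) ->
  (\prod_i hsym (A i) (k i))@_l = #|[pred g | margins l g]|%:R.
Proof.
move=> kN.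
have hE i : hsym (A i) (k i) = \sum_(m : 'X_{1..S < N})
    ((mdeg m == k i) && (mvars m \subset A i))%:R * 'X_[m].
  apply/mpolyP=> m; rewrite mcoeff_hsym raddf_sum /=.
  have cE (b : bool) (u : 'X_{1..S}) :
      (b%:R * 'X_[u] : {mpoly int[S]})@_m = b%:R * (u == m)%:R.
    by case: b; rewrite ?mul1r ?mul0r ?mcoeff0 // mcoeffX.
  under eq_bigr => u _ do rewrite cE.
  case: (boolP (_ && _)) => [|nP].
    move=> Pm; have lt_mN: (mdeg m < N)%N by case/andP: Pm => /eqP->.
    rewrite (bigD1 (BMultinom lt_mN : 'X_{1..S < N})) //= eqxx Pm mulr1.
    rewrite big1 ?addr0 // => u nu; case: (eqVneq (bmnm u) m) => [um|]; rewrite ?mulr0 //.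
    by case/eqP: nu; apply: val_inj.
  rewrite big1 // => u _; case: (eqVneq (bmnm u) m) => [->|]; rewrite ?mulr0 //.
  by rewrite (negPf nP) mul0r.
under eq_bigr => i _ do rewrite hE.
rewrite bigA_distr_bigA /= raddf_sum /= -sum1_card natr_sum [RHS]big_mkcond /=.
apply: eq_bigr => g _; rewrite big_split /=.
rewrite -(big_morph (fun m : 'X_{1..S} => 'X_[m]) (@mpolyXD _ int) (@mpolyX0 _ int)).
rewrite unfold_in /margins; case: forallP => [ok|nok] /=.
  by rewrite big1 ?mul1r ?mcoeffX => [|i _]; [case: eqP | rewrite (ok i)].
have /forallPn[i /negPf ni] : ~~ [forall i, (mdeg (g i) == k i) && (mvars (g i) \subset A i)].
  by apply/forallP.
by rewrite (bigD1 i) //= ni !mul0r mcoeff0.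
Qed.

End CoefficientCount.

(** * Flags of subspaces and the functions that they induce *)

Section Chains.

Variables (F : finFieldType) (m : nat).
Notation n := m.+1.
Notation gT := {'GL_n[F]}.

(* [genmx] is a normal form, so that equal row spaces are equal matrices. *)
Record subsp := Subsp { smx :> 'M[F]_n; smxP : <<smx>>%MS == smx }.
HB.instance Definition _ := [isSub for smx].
HB.instance Definition _ := [Finite of subsp by <:].

Implicit Types (U V W : subsp) (A g h : gT).

Lemma GLval_unit g : GLval g \in unitmx.
Proof. exact: GL_unitmx. Qed.

Lemma GLval_free g : row_free (GLval g).
Proof. by rewrite row_free_unit GLval_unit. Qed.

Definition spn (A : 'M[F]_n) : subsp := @Subsp <<A>>%MS (introT eqP (genmx_id A)).

Lemma spnE (A : 'M[F]_n) : (spn A :=: A)%MS.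
Proof. exact: genmxE. Qed.

Lemma subsp_eq U V : (U :=: V)%MS -> U = V.
Proof.
by move=> /eqmxP/genmxP E; apply: val_inj => /=; rewrite -(eqP (smxP U)) E (eqP (smxP V)).
Qed.

Definition sact U g : subsp := spn (U *m GLval g).

Lemma sactE U g : (sact U g :=: U *m GLval g)%MS.
Proof. exact: spnE. Qed.

Lemma sact1 U : sact U 1%g = U.
Proof. by apply: subsp_eq; rewrite /sact GL_1E mulmx1; apply: spnE. Qed.

Lemma sactM U g h : sact U (g * h)%g = sact (sact U g) h.
Proof.
apply: subsp_eq; apply: eqmx_trans (sactE _ _) _; apply: eqmx_sym.
apply: eqmx_trans (sactE _ _) _; rewrite GL_MxE mulmxA.
exact: eqmxMr (sactE _ _).
Qed.

Lemma sact_rank U g : \rank (sact U g) = \rank U.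
Proof. by rewrite sactE mxrankMfree // GLval_free. Qed.

Lemma sact_sub U V g : (sact U g <= sact V g)%MS = (U <= V)%MS.
Proof. by rewrite sactE (sactE V g) submxMfree // GLval_free. Qed.

Lemma stable_sact U g : stablemx U (GLval g) = (sact U g == U).
Proof.
apply/idP/eqP => [sU|E]; last by rewrite -(sactE U g) E.
apply: subsp_eq; apply: eqmx_trans (sactE _ _) _; apply/eqmxP.
by rewrite -(mxrank_leqif_eq sU) mxrankMfree // GLval_free.
Qed.

Lemma sact0 g : sact (spn 0) g = spn 0.
Proof.
apply: subsp_eq; apply: eqmx_trans (sactE _ _) _; apply/eqmxP.
rewrite (eqmxMr (GLval g) (spnE 0)) mul0mx sub0mx /=.
by rewrite spnE sub0mx.
Qed.

Lemma sactK U g : sact (sact U g) g^-1%g = U.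
Proof. by rewrite -sactM mulgV sact1. Qed.

(* A flag of [W] is stored without its top member [W]. *)
Definition fl W (t : seq subsp) (i : nat) : subsp := nth (spn 0) (W :: t) i.

Definition stab W (t : seq subsp) g : bool := all (fun U => sact U g == U) (W :: t).

Lemma stab_fl W t g i : stab W t g -> sact (fl W t i) g = fl W t i.
Proof.
move=> st; rewrite /fl; case: (ltnP i (size (W :: t))) => [lt|ge].
  exact/eqP/(all_nthP _ st).
by rewrite nth_default // sact0.
Qed.

Lemma stab_stable W t g i : stab W t g -> stablemx (fl W t i) (GLval g).
Proof. by move=> st; rewrite stable_sact stab_fl. Qed.

Lemma stabM W t g h : stab W t g -> stab W t h -> stab W t (g * h)%g.
Proof.
move=> /allP sg /allP sh; apply/allP=> U Ut.
by rewrite sactM (eqP (sg U Ut)) sh.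
Qed.

Lemma stabV W t g : stab W t g -> stab W t g^-1%g.
Proof. by move=> /allP sg; apply/allP=> U /sg /eqP E; rewrite -{1}E sactK. Qed.

Lemma stab1 W t : stab W t 1%g.
Proof. by apply/allP=> U _; rewrite sact1. Qed.

Section Colours.

Variables (C : finType) (ch : C -> F -> algC).
Hypothesis chM : forall c x y, x != 0 -> y != 0 -> ch c (x * y) = ch c x * ch c y.
Hypothesis ch_unit : forall c x, x != 0 -> ch c x * (ch c x)^* = 1.
Hypothesis ch_sep : forall c d, c != d -> exists2 x, x != 0 & ch c x != ch d x.

Lemma ch_neq0 c x : x != 0 -> ch c x != 0.
Proof. by move=> x0; apply: contra_eq_neq (ch_unit c x0) => ->; rewrite mul0r eq_sym oner_eq0. Qed.

Lemma ch1 c : ch c 1 = 1.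
Proof.
have n0 := ch_neq0 c (oner_neq0 F); apply: (mulfI n0).
by rewrite -chM ?oner_eq0 // !mulr1.
Qed.

Lemma ch_prod (I : Type) (r : seq I) (P : pred I) c (x : I -> F) :
  (forall i, P i -> x i != 0) ->
  ch c (\prod_(i <- r | P i) x i) = \prod_(i <- r | P i) ch c (x i).
Proof.
move=> x0; suff [] : ch c (\prod_(i <- r | P i) x i) = \prod_(i <- r | P i) ch c (x i)
  /\ \prod_(i <- r | P i) x i != 0 by [].
elim/big_rec2: _ => [|i y1 y2 Pi [<- y0]]; first by rewrite ch1 oner_neq0.
by rewrite chM ?x0 // mulf_neq0 ?x0.
Qed.

Lemma detres_GL0 U g : sact U g = U -> detres U (GLval g) != 0.
Proof. by move=> /eqP sU; apply: detres_neq0; rewrite ?GLval_unit ?stable_sact. Qed.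

Section OneChain.

Variables (R : nat) (k : 'I_R -> nat) (c : 'I_R -> C).
Implicit Type t : R.-tuple subsp.

(** Steps of dimension 0 are allowed, because zero parts do occur in the Jacobi-Trudi expansion. *)
Definition chain W (t : seq subsp) : bool :=
  [forall i : 'I_R, (fl W t i.+1 <= fl W t i)%MS
     && (\rank (fl W t i) == k i + \rank (fl W t i.+1))%N] && (\rank (fl W t R) == 0%N).

Definition wt W (t : seq subsp) g : algC :=
  \prod_(i < R) ch (c i) (detres (fl W t i) (GLval g) / detres (fl W t i.+1) (GLval g)).

(* The value at [g] of the character of [GL(W)] induced from a parabolic subgroup
   with Levi factors [GL_(k i)], twisted by [ch (c i) \o \det]. *)
Definition hc W g : algC := \sum_(t : R.-tuple subsp | chain W t && stab W t g) wt W t g.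

Lemma wtM W t g h : stab W t g -> stab W t h -> wt W t (g * h)%g = wt W t g * wt W t h.
Proof.
move=> sg sh; rewrite /wt GL_MxE -big_split; apply: eq_bigr => i _ /=.
have nz j x : stab W t x -> detres (fl W t j) (GLval x) != 0.
  by move=> sx; rewrite detres_GL0 ?stab_fl.
rewrite !detresM ?stab_stable // -chM ?mulf_neq0 ?invr_eq0 ?nz //.
by rewrite invfM mulrACA.
Qed.

Lemma wt1 W t : wt W t 1%g = 1.
Proof. by rewrite /wt big1 // => i _; rewrite !detres_id ?GL_1E ?mulmx1 // divr1 ch1. Qed.

End OneChain.

End Colours.

End Chains.

Lemma telescope_div (K : fieldType) (f : nat -> K) n : (forall i, f i != 0) ->
  \prod_(i < n) (f i / f i.+1) = f 0%N / f n.
Proof.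
move=> f0; elim: n => [|n IH]; first by rewrite big_ord0 divff.
by rewrite big_ord_recr /= IH mulrA divfK.
Qed.

Lemma separating_functional (F : fieldType) n r (U : 'M[F]_(r, n)) (v : 'rV_n) :
  ~~ (v <= U)%MS -> exists2 phi : 'cV_n, U *m phi = 0 & v *m phi = 1%:M.
Proof.
rewrite submxE; move: (cokermx U) (mulmx_coker U) => K UK /rV0Pn[j nz].
exists (((v *m K) 0 j)^-1 *: col j K); first by rewrite -scalemxAr colE mulmxA UK mul0mx scaler0.
apply/rowP=> i; rewrite -scalemxAr colE mulmxA -colE !ord1.
by rewrite mxE [X in _ * X]mxE mulVf // mxE eqxx.
Qed.

(** * Scalar products of the induced functions *)

Section PairOfChains.

Variables (F : finFieldType) (m : nat).
Notation n := m.+1.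
Notation gT := {'GL_n[F]}.
Notation subsp := (subsp F m).
Variables (C : finType) (ch : C -> F -> algC).
Hypothesis chM : forall c x y, x != 0 -> y != 0 -> ch c (x * y) = ch c x * ch c y.
Hypothesis ch_unit : forall c x, x != 0 -> ch c x * (ch c x)^* = 1.
Hypothesis ch_sep : forall c d, c != d -> exists2 x, x != 0 & ch c x != ch d x.

Lemma GL_lift (A : 'M[F]_n) : A \in unitmx -> exists g : gT, GLval g = A.
Proof. by move=> uA; exists (Sub A uA); apply: SubK. Qed.

Variable W : subsp.

Lemma chain_sub R (k : 'I_R -> nat) t i : chain k W t -> (i < R)%N ->
  (fl W t i.+1 <= fl W t i)%MS.
Proof. by case/andP=> /forallP ct _ iR; have /andP[] := ct (Ordinal iR). Qed.

Lemma chain_rank R (k : 'I_R -> nat) t (i : 'I_R) : chain k W t ->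
  \rank (fl W t i) = (k i + \rank (fl W t i.+1))%N.
Proof. by case/andP=> /forallP ct _; have /andP[_ /eqP] := ct i. Qed.

Lemma chain_last R (k : 'I_R -> nat) t : chain k W t -> \rank (fl W t R) = 0%N.
Proof. by case/andP=> _ /eqP. Qed.

Lemma chain_top R (k : 'I_R -> nat) t i : chain k W t -> (i <= R)%N ->
  (fl W t i <= W)%MS.
Proof.
move=> ct; elim: i => [|i IH] iR; first exact: submx_refl.
exact: submx_trans (chain_sub ct iR) (IH (ltnW iR)).
Qed.

Lemma chain_rankW R (k : 'I_R -> nat) t : chain k W t -> (\sum_i k i)%N = \rank W.
Proof.
move=> ct; have : forall j, (j <= R)%N ->
    (\sum_(i < R | i < j) k i + \rank (fl W t j) = \rank W)%N.
  elim=> [|j IH] jR; first by rewrite big_pred0.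
  have /= E := chain_rank (Ordinal jR) ct.
  rewrite -(IH (ltnW jR)) E (bigD1 (Ordinal jR)) /= ?ltnSn // addnCA addnA.
  congr (_ + _ + _)%N.
  by apply: eq_bigl => i; rewrite ltnS -val_eqE ltn_neqAle andbC.
move=> /(_ R (leqnn R)); rewrite (chain_last ct) addn0 => <-.
by apply: eq_bigl => i; rewrite ltn_ord.
Qed.

Variables (R S : nat) (k : 'I_R -> nat) (c : 'I_R -> C) (l : 'I_S -> nat) (d : 'I_S -> C).
Let I : finType := ('I_R * 'I_S)%type.
Implicit Types (t : R.-tuple subsp) (u : S.-tuple subsp) (g : {ffun 'I_R -> 'X_{1..S < n.+1}}).

(** The relative position of two flags, that is a double coset of two parabolic subgroups, encoded
    by the matrix of cell ranks. *)
Definition isty t u g : bool :=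
  [forall i : 'I_R, forall j : 'I_S, \rank (cell (fl W t) (fl W u) i j) == g i j].

Definition cells g (p : I) : nat := g p.1 p.2.

Notation adapted t u a B := [/\ row_free B, (B :=: W)%MS,
  forall i, (i <= R)%N -> (fl W t i :=: bspan (a := a) B [pred p : I | i <= p.1]%N)%MS
  & forall j, (j <= S)%N -> (fl W u j :=: bspan (a := a) B [pred p : I | j <= p.2]%N)%MS].

Lemma pair_basis t u (a : I -> nat) : chain k W t -> chain l W u ->
  (forall p, a p = \rank (cell (fl W t) (fl W u) p.1 p.2)) ->
  exists B : 'M[F]_(\sum_(k < #|I|) a (enum_val k), n), adapted t u a B.
Proof.
move=> ct cu Da; apply: (adapted_basis (W := W)) => //.
- by move=> i; apply: chain_sub ct.
- by move=> j; apply: chain_sub cu.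
- exact: chain_last ct.
- exact: chain_last cu.
Qed.

Lemma istyE t u g : isty t u g ->
  forall p, cells g p = \rank (cell (fl W t) (fl W u) p.1 p.2).
Proof. by move=> /forallP ty p; have /forallP/(_ p.2)/eqP := ty p.1. Qed.

Lemma sum_rows (a : I -> nat) (i : 'I_R) :
  (\sum_(p : I | i <= p.1) a p = \sum_j a (i, j) + \sum_(p : I | i < p.1) a p)%N.
Proof.
rewrite (bigID (fun p : I => p.1 == i)) /=; congr (_ + _)%N; last first.
  by apply: eq_bigl => p; rewrite [RHS]ltn_neqAle andbC eq_sym.
have -> : (\sum_j a (i, j) = \sum_(i' | i' == i) \sum_j a (i', j))%N.
  by rewrite big_pred1_eq.
rewrite pair_big /=.
by apply: eq_big => [[x y]|[x y]] //=; case: eqP => [->|]; rewrite ?leqnn ?andbF.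
Qed.

Lemma sum_cols (a : I -> nat) (j : 'I_S) :
  (\sum_(p : I | j <= p.2) a p = \sum_i a (i, j) + \sum_(p : I | j < p.2) a p)%N.
Proof.
rewrite (bigID (fun p : I => p.2 == j)) /=; congr (_ + _)%N; last first.
  by apply: eq_bigl => p; rewrite [RHS]ltn_neqAle andbC eq_sym.
have -> : (\sum_i a (i, j) = \sum_i \sum_(j' | j' == j) a (i, j'))%N.
  by apply: eq_bigr => i _; rewrite big_pred1_eq.
rewrite pair_big /=.
by apply: eq_big => [[x y]|[x y]] //=; case: eqP => [->|]; rewrite ?leqnn ?andbF.
Qed.

Lemma cell_row t u (a : I -> nat) B (i : 'I_R) : chain k W t ->
  adapted t u a B -> (\sum_j a (i, j))%N = k i.
Proof.
move=> ct [fB _ EB _]; apply/eqP; rewrite -(eqn_add2r (\rank (fl W t i.+1))).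
by rewrite -(chain_rank i ct) !EB ?(ltnW (ltn_ord i)) // !rank_bspan //= -sum_rows.
Qed.

Lemma cell_col t u (a : I -> nat) B (j : 'I_S) : chain l W u ->
  adapted t u a B -> (\sum_i a (i, j))%N = l j.
Proof.
move=> cu [fB _ _ EB']; apply/eqP; rewrite -(eqn_add2r (\rank (fl W u j.+1))).
by rewrite -(chain_rank j cu) !EB' ?(ltnW (ltn_ord j)) // !rank_bspan //= -sum_cols.
Qed.

Lemma isty_exists t u : chain k W t -> chain l W u ->
  exists g, forall g', isty t u g' = (g' == g).
Proof.
move=> ct cu; pose a (p : I) := \rank (cell (fl W t) (fl W u) p.1 p.2).
have [B aB] := pair_basis ct cu (fun p => erefl (a p)).
have lt_deg i : (mdeg [multinom a (i, j) | j < S] < n.+1)%N.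
  rewrite mdegE (eq_bigr (fun j => a (i, j))) => [|j _]; last by rewrite mnmE.
  rewrite (cell_row i ct aB) ltnS (leq_trans _ (rank_leq_row W)) //.
  by rewrite -(chain_rankW ct) (bigD1 i) //= leq_addr.
exists [ffun i => BMultinom (lt_deg i)] => g'; apply/idP/eqP => [ty|->].
  apply/ffunP=> i; rewrite ffunE; apply/val_inj/mnmP=> j /=; rewrite mnmE.
  exact: (istyE ty (i, j)).
by apply/forallP=> i; apply/forallP=> j; rewrite ffunE /= mnmE.
Qed.

Lemma isty_margins t u g : chain k W t -> chain l W u -> isty t u g ->
  (forall i, mdeg (g i) = k i) /\ (\sum_i (g i : 'X_{1..S}))%MM = [multinom l j | j < S].
Proof.
move=> ct cu ty; have [B aB] := pair_basis ct cu (istyE ty); split=> [i|].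
  by rewrite mdegE -(cell_row i ct aB).
apply/mnmP=> j; rewrite mnm_sumE mnmE -(cell_col j cu aB); exact: eq_bigr.
Qed.

(* Cutting [det(A | E_i) / det(A | E_(i+1))] along the other chain gives one
   factor per cell, the same for both chains; it is 1 for an empty cell. *)
Lemma wt_good t u g A : chain k W t -> chain l W u -> isty t u g ->
  (forall i j, g i j != 0%N -> d j = c i) -> stab W t A -> stab W u A ->
  wt ch c W t A * (wt ch d W u A)^* = 1.
Proof.
move=> ct cu ty good st su.
pose x i j := detres (fl W t i :&: fl W u j)%MS (GLval A).
have s_t i : stablemx (fl W t i) (GLval A) by apply: stab_stable.
have s_u j : stablemx (fl W u j) (GLval A) by apply: stab_stable.
have x0 i j : x i j != 0 by rewrite detres_neq0 ?GLval_unit ?stablemx_cap.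
have xt i : (i <= R)%N -> detres (fl W t i) (GLval A) = x i 0%N.
  move=> iR; apply/esym/detres_eqmx => //; apply/capmx_idPl; exact: chain_top ct iR.
have xu j : (j <= S)%N -> detres (fl W u j) (GLval A) = x 0%N j.
  move=> jS; apply/esym/detres_eqmx => //; apply/capmx_idPr; exact: chain_top cu jS.
have xS i : x i S = 1.
  by apply/detres0/eqP; rewrite -leqn0 -(chain_last cu) mxrankS // capmxSr.
have xR j : x R j = 1.
  by apply/detres0/eqP; rewrite -leqn0 -(chain_last ct) mxrankS // capmxSl.
pose e i j := x i j / x i.+1 j / (x i j.+1 / x i.+1 j.+1).
have q0 i j : x i j / x i.+1 j != 0 by rewrite mulf_neq0 ?invr_eq0.
have q0' i j : x i j / x i j.+1 != 0 by rewrite mulf_neq0 ?invr_eq0.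
have e0 i j : e i j != 0 by rewrite mulf_neq0 ?invr_eq0.
have e_cell (i : 'I_R) (j : 'I_S) : g i j = 0%N -> e i j = 1.
  move=> gij; have := istyE ty (i, j); rewrite /cells /= gij => /esym r0.
  have sub := cell_cap (fun i => @chain_sub _ _ _ i ct) (fun j => @chain_sub _ _ _ j cu)
    (ltn_ord i) (ltn_ord j).
  have mod := detres_modular (stablemx_cap (s_t i.+1) (s_u j)) (stablemx_cap (s_t i) (s_u j.+1)).
  have E1 : detres (fl W t i.+1 :&: fl W u j + fl W t i :&: fl W u j.+1)%MS (GLval A) = x i j.
    apply: detres_eqmx; last exact: stablemx_cap.
    apply/eqmxP; rewrite sub /= -{1}(addsmx_diff_cap_eq (fl W t i :&: fl W u j)%MS
      (fl W t i.+1 :&: fl W u j + fl W t i :&: fl W u j.+1)%MS) addsmx_sub capmxSr andbT.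
    move/eqP: r0; rewrite mxrank_eq0 => /eqP; rewrite /cell => ->; exact: sub0mx.
  have E2 : detres ((fl W t i.+1 :&: fl W u j) :&: (fl W t i :&: fl W u j.+1))%MS (GLval A)
      = x i.+1 j.+1.
    apply: detres_eqmx; last exact: stablemx_cap.
    apply/eqmxP/andP; split.
      rewrite sub_capmx (submx_trans (capmxSl _ _) (capmxSl _ _)).
      by rewrite (submx_trans (capmxSr _ _) (capmxSr _ _)).
    by rewrite sub_capmx !capmxS ?(chain_sub ct) ?(chain_sub cu).
  rewrite E1 E2 -/(x i.+1 j) -/(x i j.+1) in mod.
  have -> : e i j = (x i j * x i.+1 j.+1) / (x i.+1 j * x i j.+1).
    by rewrite /e; field; rewrite !x0.
  by rewrite mod divff // mulf_neq0.
have rowE (i : 'I_R) : x i 0%N / x i.+1 0%N = \prod_(j < S) e i j.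
  by rewrite (telescope_div (f := fun j => x i j / x i.+1 j)) // !xS divr1 divr1.
have colE (j : 'I_S) : x 0%N j / x 0%N j.+1 = \prod_(i < R) e i j.
  rewrite (eq_bigr (fun i : 'I_R => (x i j / x i j.+1) / (x i.+1 j / x i.+1 j.+1))).
    by rewrite (telescope_div (f := fun i => x i j / x i j.+1)) // !xR divr1 divr1.
  move=> i _; rewrite /e; field; by rewrite !x0.
have -> : wt ch c W t A = \prod_(i < R) \prod_(j < S) ch (c i) (e i j).
  apply: eq_bigr => i _; rewrite !xt ?(ltnW (ltn_ord i)) // rowE.
  by rewrite (ch_prod chM ch_unit).
have -> : wt ch d W u A = \prod_(i < R) \prod_(j < S) ch (d j) (e i j).
  rewrite exchange_big /=; apply: eq_bigr => j _; rewrite !xu ?(ltnW (ltn_ord j)) // colE.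
  by rewrite (ch_prod chM ch_unit).
rewrite rmorph_prod -big_split big1 //= => i _.
rewrite rmorph_prod -big_split big1 //= => j _.
case: (eqVneq (g i j) 0%N) => [/e_cell->|/good->]; last exact: ch_unit.
by rewrite !(ch1 chM ch_unit) rmorph1 mulr1.
Qed.

(** [H] only has to induce every automorphism of [W]. This covers the whole of GL_n as well as the
    stabilizer of a hyperplane [W] in SL_n. *)
Variable H : {group gT}.
Hypothesis Hlift : forall g : gT, sact W g = W ->
  exists2 h, h \in H & W *m GLval h = W *m GLval g.

Lemma sub_act_eq (U : subsp) (A B : gT) : (U <= W)%MS ->
  W *m GLval A = W *m GLval B -> U *m GLval A = U *m GLval B.
Proof. by case/submxP=> D -> E; rewrite -!mulmxA E. Qed.

(* A cell with mismatched colours contains a vector on which a homothety acts with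
   a weight different from 1. *)
Lemma wt_bad t u g : chain k W t -> chain l W u -> isty t u g ->
  ~ (forall i j, g i j != 0%N -> d j = c i) ->
  exists h, [/\ h \in H, stab W t h, stab W u h & wt ch c W t h * (wt ch d W u h)^* != 1].
Proof.
move=> ct cu ty nogood.
have [[i0 j0] /= [gij dc]] : exists p : I, g p.1 p.2 != 0%N /\ d p.2 != c p.1.
  have [ex|nex] := boolP [exists p : I, (g p.1 p.2 != 0%N) && (d p.2 != c p.1)].
    by have /existsP[p /andP[]] := ex; exists p.
  case: nogood => i j gij; apply/eqP; apply: contraNT nex => dc.
  by apply/existsP; exists (i, j); rewrite /= gij dc.
have [B [fB EB EBt EBu]] := pair_basis ct cu (istyE ty).
pose p0 : I := (i0, j0); pose U := bspan B (predC1 p0).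
pose v := nz_row (bspan B (pred1 p0)).
have v0 : v != 0.
  by rewrite nz_row_eq0 -mxrank_eq0 rank_bspan // big_pred1_eq.
have vU : ~~ (v <= U)%MS.
  apply: contra v0 => vU; rewrite -submx0.
  have : (v <= bspan B (pred1 p0) :&: U)%MS by rewrite sub_capmx nz_row_sub.
  rewrite bspan_cap // => /submx_trans; apply.
  by rewrite submx0 -mxrank_eq0 rank_bspan // big_pred0 // => p /=; case: eqP.
have [phi Uphi vphi] := separating_functional vU.
have [al al0 chal] := ch_sep dc.
have [A DA] := GL_lift (homothety_unit al0 vphi).
have vin (P : pred I) : P p0 -> (v <= bspan B P)%MS.
  by move=> Pp; apply: submx_trans (nz_row_sub _) (bspan_sub B _) => p /eqP->.
have vout (X : 'M_n) P : (X :=: bspan B P)%MS -> ~~ P p0 -> X *m GLval A = X.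
  move=> XP Pp; rewrite DA mulmx_homothety.
  have /submxP[Y ->] : (X <= U)%MS.
    by rewrite XP bspan_sub // => p; apply: contraTneq => ->.
  by rewrite -[Y *m U *m phi]mulmxA Uphi mulmx0 mul0mx scaler0 addr0.
have sA_t i : sact (fl W t i) A = fl W t i.
  have [iR|] := leqP i R; last first.
    by move=> iR; rewrite /fl nth_default ?sact0 //= size_tuple.
  apply/eqP; rewrite -stable_sact.
  have [le|lt] := leqP i i0; last by rewrite (vout _ _ (EBt _ iR)) //= -ltnNge.
  by rewrite DA stable_homothety // EBt // vin.
have sA_u j : sact (fl W u j) A = fl W u j.
  have [jS|] := leqP j S; last first.
    by move=> jS; rewrite /fl nth_default ?sact0 //= size_tuple.
  apply/eqP; rewrite -stable_sact.
  have [le|lt] := leqP j j0; last by rewrite (vout _ _ (EBu _ jS)) //= -ltnNge.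
  by rewrite DA stable_homothety // EBu // vin.
have [h hH Eh] := Hlift (sA_t 0%N).
have act_t i : (i <= R)%N -> fl W t i *m GLval h = fl W t i *m GLval A.
  by move=> iR; apply: sub_act_eq Eh; apply: chain_top ct iR.
have act_u j : (j <= S)%N -> fl W u j *m GLval h = fl W u j *m GLval A.
  by move=> jS; apply: sub_act_eq Eh; apply: chain_top cu jS.
have det_t i : (i <= R)%N -> detres (fl W t i) (GLval h) = if (i <= i0)%N then al else 1.
  move=> iR; rewrite (detres_eq_act (act_t i iR)).
  case: leqP => le; last by apply: detres_id; rewrite (vout _ _ (EBt _ iR)) //= -ltnNge.
  by rewrite DA detres_homothety // EBt // vin.
have det_u j : (j <= S)%N -> detres (fl W u j) (GLval h) = if (j <= j0)%N then al else 1.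
  move=> jS; rewrite (detres_eq_act (act_u j jS)).
  case: leqP => le; last by apply: detres_id; rewrite (vout _ _ (EBu _ jS)) //= -ltnNge.
  by rewrite DA detres_homothety // EBu // vin.
have st : stab W t h.
  apply/(all_nthP (spn 0)) => i; rewrite /= size_tuple ltnS => iR.
  by apply/eqP; rewrite -[RHS]sA_t /sact -/(fl W t i) act_t.
have su : stab W u h.
  apply/(all_nthP (spn 0)) => j; rewrite /= size_tuple ltnS => jS.
  by apply/eqP; rewrite -[RHS]sA_u /sact -/(fl W u j) act_u.
exists h; split=> //.
have -> : wt ch c W t h = ch (c i0) al.
  rewrite /wt (bigD1 i0) //= !det_t ?(ltnW (ltn_ord i0)) // leqnn ltnn divr1.
  rewrite big1 ?mulr1 // => i ni; rewrite !det_t ?(ltnW (ltn_ord i)) //.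
  have /= := ni; rewrite -val_eqE; case: ltngtP => // _ _; rewrite ?divff ?al0 ?oner_neq0 //;
  exact: (ch1 chM ch_unit).
have -> : wt ch d W u h = ch (d j0) al.
  rewrite /wt (bigD1 j0) //= !det_u ?(ltnW (ltn_ord j0)) // leqnn ltnn divr1.
  rewrite big1 ?mulr1 // => i ni; rewrite !det_u ?(ltnW (ltn_ord i)) //.
  have /= := ni; rewrite -val_eqE; case: ltngtP => // _ _; rewrite ?divff ?al0 ?oner_neq0 //;
  exact: (ch1 chM ch_unit).
apply: contraNneq chal => E; rewrite -[ch (d _) _]mulr1 -E mulrCA (ch_unit (d j0) al0).
by rewrite mulr1.
Qed.

Lemma fl_map R' (t : R'.-tuple subsp) i h : (0 < i <= R')%N ->
  fl W [tuple of map (fun U : subsp => sact U h) t] i = sact (fl W t i) h.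
Proof. by case: i => // i /= iR; rewrite /fl /= (nth_map (spn 0)) ?size_tuple. Qed.

Lemma chain_act R' (k' : 'I_R' -> nat) (t : R'.-tuple subsp) h : sact W h = W ->
  chain k' W t -> chain k' W [tuple of map (fun U : subsp => sact U h) t].
Proof.
move=> sW ct.
have flE i : (i <= R')%N -> fl W [tuple of map (fun U : subsp => sact U h) t] i = sact (fl W t i) h.
  by case: i => [|i] iR; [rewrite /fl /= sW | rewrite fl_map].
apply/andP; split; last by rewrite flE // sact_rank (chain_last ct).
apply/forallP=> i; rewrite !flE ?(ltnW (ltn_ord i)) // !sact_rank sact_sub.
by case/andP: ct => /forallP.
Qed.

Lemma isty_act t u g h : sact W h = W -> chain k W t -> chain l W u ->
  isty [tuple of map (fun U : subsp => sact U h) t] [tuple of map (fun U : subsp => sact U h) u] g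
  = isty t u g.
Proof.
move=> sW ct cu.
have ftE i : (i <= R)%N -> fl W [tuple of map (fun U : subsp => sact U h) t] i = sact (fl W t i) h.
  by case: i => [|i] iR; [rewrite /fl /= sW | rewrite fl_map].
have fuE i : (i <= S)%N -> fl W [tuple of map (fun U : subsp => sact U h) u] i = sact (fl W u i) h.
  by case: i => [|i] iR; [rewrite /fl /= sW | rewrite fl_map].
have rcap i j : (i <= R)%N -> (j <= S)%N ->
    \rank (fl W [tuple of map (fun U : subsp => sact U h) t] i
           :&: fl W [tuple of map (fun U : subsp => sact U h) u] j)%MS
    = \rank (fl W t i :&: fl W u j)%MS.
  move=> iR jS; rewrite ftE // fuE // (cap_eqmx (sactE _ _) (sactE _ _)).
  have := mxrank_sum_cap (fl W t i *m GLval h) (fl W u j *m GLval h).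
  rewrite -addsmxMr !mxrankMfree ?GLval_free // -(mxrank_sum_cap (fl W t i) (fl W u j)).
  by move=> /eqP; rewrite eqn_add2l => /eqP.
have ct' := chain_act sW ct; have cu' := chain_act sW cu.
have rE (i : 'I_R) (j : 'I_S) :
  \rank (cell (fl W [tuple of map (fun U : subsp => sact U h) t])
              (fl W [tuple of map (fun U : subsp => sact U h) u]) i j)
   = \rank (cell (fl W t) (fl W u) i j).
  have := rank_cell (fun i => @chain_sub _ _ _ i ct') (fun j => @chain_sub _ _ _ j cu')
    (ltn_ord i) (ltn_ord j).
  have := rank_cell (fun i => @chain_sub _ _ _ i ct) (fun j => @chain_sub _ _ _ j cu)
    (ltn_ord i) (ltn_ord j).
  rewrite !rcap ?(ltnW (ltn_ord _)) // => <- /eqP.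
  by rewrite -!addnA eqn_add2r => /eqP.
by apply: eq_forallb => i; apply: eq_forallb => j; rewrite rE.
Qed.

(** The linear map that matches two adapted bases block by block carries both flags along; [Hlift]
    replaces it by an element of [H] with the same action on [W]. *)
Lemma pair_transitive t u t' u' g : chain k W t -> chain l W u -> isty t u g ->
  chain k W t' -> chain l W u' -> isty t' u' g ->
  exists2 h, h \in H & (t' = [tuple of map (fun U : subsp => sact U h) t])
    /\ (u' = [tuple of map (fun U : subsp => sact U h) u]).
Proof.
move=> ct cu ty ct' cu' ty'.
have [B [fB EB EBt EBu]] := pair_basis ct cu (istyE ty).
have [B' [fB' EB' EBt' EBu']] := pair_basis ct' cu' (istyE ty').
have [A0 uA0 BA0] := row_free_exchange fB fB'.
have [A DA] := GL_lift uA0; rewrite -DA in BA0.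
have spanE (P : pred I) : (bspan B P *m GLval A :=: bspan B' P)%MS.
  rewrite /bspan; apply: eqmx_trans (sumsmxMr _ _ _) _; apply/eqmx_sums => j Pj.
  apply: eqmx_trans (eqmxMr _ (genmxE _)) _; apply: eqmx_trans _ (eqmx_sym (genmxE _)).
  have -> : submxcol B j *m GLval A = submxcol B' j; last exact: eqmx_refl.
  by apply/matrixP=> x y; rewrite -BA0 !mxE; apply: eq_bigr => z _; rewrite !mxE.
have ftA i : (i <= R)%N -> sact (fl W t i) A = fl W t' i.
  move=> iR; apply: subsp_eq; apply: eqmx_trans (sactE _ _) _.
  apply: eqmx_trans (eqmxMr _ (EBt i iR)) _; apply: eqmx_trans (spanE _) _.
  exact/eqmx_sym/EBt'.
have fuA j : (j <= S)%N -> sact (fl W u j) A = fl W u' j.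
  move=> jS; apply: subsp_eq; apply: eqmx_trans (sactE _ _) _.
  apply: eqmx_trans (eqmxMr _ (EBu j jS)) _; apply: eqmx_trans (spanE _) _.
  exact/eqmx_sym/EBu'.
have [h hH Eh] := Hlift (ftA 0%N (leq0n _)).
exists h => //; split; apply/val_inj/(@eq_from_nth _ (spn 0)); rewrite /= ?size_map ?size_tuple //.
  move=> i iR; rewrite (nth_map (spn 0)) ?size_tuple // -[LHS](ftA i.+1) // /sact.
  by rewrite -[nth _ t i]/(fl W t i.+1 : subsp) (sub_act_eq _ Eh) ?(chain_top ct).
move=> i iR; rewrite (nth_map (spn 0)) ?size_tuple // -[LHS](fuA i.+1) // /sact.
by rewrite -[nth _ u i]/(fl W u i.+1 : subsp) (sub_act_eq _ Eh) ?(chain_top cu).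
Qed.

(** Any basis of [W], cut into blocks of sizes [g i j], yields two coordinate flags in this
    position. *)
Lemma pair_exists g : (\sum_i k i)%N = \rank W -> (forall i, mdeg (g i) = k i) ->
  (\sum_i (g i : 'X_{1..S}))%MM = [multinom l j | j < S] ->
  exists t, exists u, [/\ chain k W t, chain l W u & isty t u g].
Proof.
move=> sk gk gl.
have rowE i : (\sum_j cells g (i, j) = k i)%N by rewrite -gk mdegE.
have colE j : (\sum_i cells g (i, j) = l j)%N.
  by have /mnmP/(_ j) := gl; rewrite mnm_sumE mnmE.
have EN : (\sum_(q < #|I|) cells g (enum_val q))%N = \rank W.
  rewrite (sum_enum_val predT) -sk -(eq_bigr _ (fun i _ => rowE i)) pair_big.
  by apply: eq_bigr => -[].
pose B := castmx (esym EN, erefl n) (row_base W).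
have EB : (B :=: W)%MS by apply: eqmx_trans (eqmx_cast _ _) (eq_row_base _).
have fB : row_free B by rewrite row_free_castmx row_base_free.
have EW (P : pred I) : P =1 predT -> (W :=: bspan B P)%MS.
  by move=> /eq_bspan->; apply: eqmx_sym; apply: eqmx_trans (bspanT _) EB.
(* Flags are stored without their top, so entry [i] is member [i + 1]; hence the strict
   inequality. *)
pose t := [tuple spn (bspan B [pred p : I | i < p.1]%N) | i < R].
pose u := [tuple spn (bspan B [pred p : I | j < p.2]%N) | j < S].
have ft i : (i <= R)%N -> (fl W t i :=: bspan B [pred p : I | i <= p.1]%N)%MS.
  case: i => [|i] iR; first exact: EW.
  rewrite /fl /= -[i]/(nat_of_ord (Ordinal iR)) nth_mktuple; exact: spnE.
have fu j : (j <= S)%N -> (fl W u j :=: bspan B [pred p : I | j <= p.2]%N)%MS.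
  case: j => [|j] jS; first exact: EW.
  rewrite /fl /= -[j]/(nat_of_ord (Ordinal jS)) nth_mktuple; exact: spnE.
have ct : chain k W t.
  apply/andP; split; last first.
    by rewrite ft // rank_bspan // big_pred0 // => p /=; rewrite leqNgt ltn_ord.
  apply/forallP=> i; rewrite !ft ?(ltnW (ltn_ord i)) // bspan_sub; last by move=> p /ltnW.
  by rewrite !rank_bspan //= sum_rows rowE.
have cu : chain l W u.
  apply/andP; split; last first.
    by rewrite fu // rank_bspan // big_pred0 // => p /=; rewrite leqNgt ltn_ord.
  apply/forallP=> i; rewrite !fu ?(ltnW (ltn_ord i)) // bspan_sub; last by move=> p /ltnW.
  by rewrite !rank_bspan //= sum_cols colE.
exists t, u; split=> //; apply/forallP=> i; apply/forallP=> j.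
have := rank_cell (fun i => @chain_sub _ _ _ i ct) (fun j => @chain_sub _ _ _ j cu)
    (ltn_ord i) (ltn_ord j).
rewrite -(cell_size fB ft fu (ltn_ord i) (ltn_ord j)) => /eqP.
rewrite !eqn_add2r => /eqP ->; rewrite /cells /=.
by apply/eqP; congr (g _ _); apply: val_inj.
Qed.

Hypothesis HW : forall h, h \in H -> sact W h = W.

Definition tact R' (h : gT) (t : R'.-tuple subsp) : R'.-tuple subsp :=
  [tuple of map (fun U : subsp => sact U h) t].

Lemma stabE R' (t : R'.-tuple subsp) h : h \in H -> stab W t h = (tact h t == t).
Proof.
move=> hH; rewrite /stab /= HW // eqxx /=.
apply/allP/eqP => [s|E U Ut].
  by apply/val_inj; rewrite /= -[RHS]map_id; apply/eq_in_map => U /s /eqP.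
apply/eqP; have /(congr1 val) /= := E.
by rewrite -[in RHS](map_id t) => /eq_in_map/(_ U Ut).
Qed.

Lemma tactM R' (t : R'.-tuple subsp) (g h : gT) : tact (g * h)%g t = tact h (tact g t).
Proof. by apply/val_inj; rewrite /= -map_comp; apply: eq_map => U; rewrite sactM. Qed.

Definition pstab t u := [set A in H | stab W t A && stab W u A].

(** The pairs in a given position form a single orbit of [H], and [pstab] is the stabilizer of a
    pair. *)
Lemma orbit_count g : (\sum_i k i)%N = \rank W -> (forall i, mdeg (g i) = k i) ->
  (\sum_i (g i : 'X_{1..S}))%MM = [multinom l j | j < S] ->
  (\sum_(x : R.-tuple subsp * S.-tuple subsp |
      [&& chain k W x.1, chain l W x.2 & isty x.1 x.2 g]) #|pstab x.1 x.2| = #|H|)%N.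
Proof.
move=> sk gk gl; have [t0 [u0 [ct0 cu0 ty0]]] := pair_exists sk gk gl.
pose act h := (tact h t0, tact h u0).
rewrite -[RHS]sum1_card [RHS](partition_big act (fun x : R.-tuple subsp * S.-tuple subsp =>
      [&& chain k W x.1, chain l W x.2 & isty x.1 x.2 g])) /=; last first.
  by move=> h hH; rewrite !chain_act ?HW // isty_act ?HW.
apply: eq_bigr => -[t u] /= /and3P[ct cu ty].
have [h0 h0H [Dt Du]] := pair_transitive ct0 cu0 ty0 ct cu ty.
rewrite sum1dep_card -(card_lcoset (pstab t u) h0); apply: eq_card => h.
rewrite mem_lcoset !inE; case hH: (h \in H); last by rewrite groupMl ?groupV // hH.
have AH : (h0^-1 * h)%g \in H by rewrite groupM ?groupV.
rewrite AH !stabE // Dt Du -!tactM mulKVg xpair_eqE /act.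
by [].
Qed.

Lemma hc_prod A : A \in H -> hc ch k c W A * (hc ch l d W A)^* =
  \sum_(x : R.-tuple subsp * S.-tuple subsp | chain k W x.1 && chain l W x.2)
    (A \in pstab x.1 x.2)%:R * (wt ch c W x.1 A * (wt ch d W x.2 A)^*).
Proof.
move=> AH; rewrite /hc rmorph_sum big_distrlr /= pair_big /=.
rewrite big_mkcond [RHS]big_mkcond; apply: eq_bigr => -[t u] _ /=; rewrite inE AH /=.
by case: (chain k W t); case: (chain l W u); case: (stab W t A); case: (stab W u A);
  rewrite /= ?mul1r ?mul0r.
Qed.

Definition good g := [forall i, forall j, (g i j != 0%N) ==> (d j == c i)].

(** The product of weights is a linear character of the stabilizer of the pair. It is trivial when
    the colours match, and otherwise its sum over the stabilizer vanishes. *)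
Lemma sum_pstab t u g : chain k W t -> chain l W u -> isty t u g ->
  \sum_(A in H) (A \in pstab t u)%:R * (wt ch c W t A * (wt ch d W u A)^*)
   = (good g * #|pstab t u|)%N%:R.
Proof.
move=> ct cu ty; pose la A := wt ch c W t A * (wt ch d W u A)^*.
have -> : \sum_(A in H) (A \in pstab t u)%:R * (wt ch c W t A * (wt ch d W u A)^*)
    = \sum_(A in pstab t u) la A.
  rewrite big_mkcond [RHS]big_mkcond; apply: eq_bigr => A _; rewrite !inE.
  by case: (A \in H); case: (stab W t A); case: (stab W u A); rewrite ?mul1r ?mul0r.
case: (boolP (good g)) => [gg|ng].
  rewrite mul1n -sum1_card natr_sum; apply: eq_bigr => A; rewrite inE => /and3P[_ st su].
  apply: wt_good ct cu ty _ st su => i j gij; apply/eqP.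
  by move/forallP: gg => /(_ i)/forallP/(_ j)/implyP/(_ gij).
have [|h [hH st su la1]] := wt_bad ct cu ty.
  move=> good'; case/negP: ng; apply/forallP=> i; apply/forallP=> j; apply/implyP=> gij.
  exact/eqP/good'.
rewrite mul0n; apply/eqP.
have : (1 - la h) * \sum_(A in pstab t u) la A = 0.
  rewrite mulrBl mul1r [X in X - _](reindex_inj (mulgI h)) /= mulr_sumr.
  apply/eqP; rewrite subr_eq0; apply/eqP; apply: eq_big => [A|A].
    rewrite !inE groupMl //; case AH: (A \in H) => //=; rewrite !stabE ?groupM //.
    have Et : tact h t = t by apply/eqP; rewrite -stabE.
    have Eu : tact h u = u by apply/eqP; rewrite -stabE.
    by rewrite !tactM Et Eu.
  rewrite !inE groupMl // => /and3P[AH sA sA'].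
  have tA : stab W t A by rewrite -(mulKg h A) stabM ?stabV.
  have uA : stab W u A by rewrite -(mulKg h A) stabM ?stabV.
  by rewrite /la (wtM chM c st tA) (wtM chM d su uA) rmorphM mulrACA.
move/eqP; rewrite mulf_eq0 subr_eq0 => /orP[/eqP E|//].
by case/eqP: la1; rewrite -/(la h) -E.
Qed.

(** Mackey's formula. The two arguments enter differently, one through products of [h_k] and the
    other through a monomial, as in the duality of complete and monomial symmetric functions. *)
Theorem Gram : (\sum_i k i)%N = \rank W -> (\sum_j l j)%N = \rank W ->
  #|H|%:R^-1 * (\sum_(A in H) hc ch k c W A * (hc ch l d W A)^*)
  = ((\prod_i hsym [set j | d j == c i] (k i))@_[multinom l j | j < S])%:~R.
Proof.
move=> sk sl.
rewrite (@mcoeff_prod_hsym _ _ n.+1); last first.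
  move=> i; rewrite ltnS (leq_trans _ (rank_leq_row W)) // -sk.
  by rewrite (bigD1 i) //= leq_addr.
apply: (canLR (mulKf _)); first by rewrite pnatr_eq0 -lt0n cardG_gt0.
rewrite (eq_bigr _ hc_prod) exchange_big /=.
pose T x g := isty (x : R.-tuple subsp * S.-tuple subsp).1 x.2 g.
transitivity (\sum_(x : R.-tuple subsp * S.-tuple subsp | chain k W x.1 && chain l W x.2)
   \sum_(g : {ffun 'I_R -> 'X_{1..S < n.+1}} | T x g) (good g * #|pstab x.1 x.2|)%N%:R : algC).
  apply: eq_bigr => -[t u] /= /andP[ct cu].
  have [g0 Dg0] := isty_exists ct cu.
  rewrite (big_pred1 g0) => [|g]; last by rewrite /T /= Dg0.
  by rewrite (sum_pstab (g := g0) ct cu) // Dg0.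
rewrite (exchange_big_dep predT) //= mulrC rmorph_nat.
rewrite -[X in _ = X%:R * _]sum1_card natr_sum mulr_suml.
rewrite [RHS]big_mkcond; apply: eq_bigr => g _.
rewrite unfold_in /margins mul1r.
case: ifP => [/andP[/forallP gk /eqP gl]|nm].
  have gk' i : mdeg (g i) = k i by case/andP: (gk i) => /eqP.
  rewrite -(orbit_count sk gk' gl) natr_sum.
  have -> : good g = true.
    apply/forallP=> i; apply/forallP=> j; apply/implyP=> gij.
    by case/andP: (gk i) => _ /subsetP/(_ j); rewrite !inE => ->.
  by apply: eq_big => [x|x _]; rewrite ?mul1n ?andbA.
rewrite big1 // => -[t u] /= /andP[/andP[ct cu]]; rewrite /T /= => ty.
case gg : (good g); rewrite ?mul0n //; case/negP: nm.
have [gk gl] := isty_margins ct cu ty; rewrite gl eqxx andbT.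
apply/forallP=> i; rewrite gk eqxx /=; apply/subsetP=> j; rewrite !inE => gij.
by have /forallP/(_ i)/forallP/(_ j)/implyP/(_ gij) := gg.
Qed.

End PairOfChains.

(** * Restriction multiplicities *)

Section Multiplicities.

Variables (gT : finGroupType) (p : nat) (G H : {group gT}).
Hypothesis sHG : H \subset G.

Lemma p'_part_of_mult i j : j \in Irr_p' p H ->
  {in Irr_p' p H, forall k, '['Res[H] 'chi[G]_i, 'chi_k] = (k == j)%:R} ->
  p'_part_of_restriction p i j.
Proof.
move=> jp mult; split=> //; exists ('Res[H] 'chi_i - 'chi_j).
have Rchar : 'Res[H] 'chi_i \is a character by apply/cfRes_char/irr_char.
have DE : 'Res[H] 'chi_i - 'chi_j = \sum_(k | k != j) '['Res[H] 'chi_i, 'chi_k] *: 'chi_k.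
  rewrite {1}(cfun_sum_cfdot ('Res[H] 'chi_i)) (bigD1 j) //= mult // eqxx scale1r.
  by rewrite addrAC subrr add0r.
split; first by rewrite addrC subrK.
  rewrite DE rpred_sum // => k _; have /natrP[d ->] := Cnat_cfdot_char_irr k Rchar.
  by rewrite scaler_nat rpredMn ?irr_char.
move=> k; rewrite irr_consttE; apply: contraR => kp.
have kpH : k \in Irr_p' p H by rewrite inE.
by rewrite cfdotBl mult // cfdot_irr [j == k]eq_sym subrr.
Qed.

Lemma mult_of_p'_part i j : p'_part_of_restriction p i j ->
  '['Res[H] 'chi[G]_i, 'chi_j] = 1.
Proof.
case=> jp [Delta [-> Dchar DP]]; rewrite cfdotDl cfdot_irr eqxx.
suff -> : '[Delta, 'chi_j] = 0 by rewrite addr0.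
apply/eqP; apply: contraTT jp; rewrite -irr_consttE => /DP; rewrite inE negbK.
by [].
Qed.

(* Surjectivity need not be required, as the degree of
   ['Ind[G] 'chi_j] is prime to [p] for each [j \in Irr_p' p H], hence so is that
   of one of its constituents. *)
Definition mult_canonical : Prop :=
  [/\ ~~ (p %| #|G : H|)%N,
     {in Irr_p' p G, forall i, exists2 j, j \in Irr_p' p H &
        {in Irr_p' p H, forall k, '['Res[H] 'chi_i, 'chi_k] = (k == j)%:R}}
   & forall i i' j, i \in Irr_p' p G -> i' \in Irr_p' p G -> j \in Irr_p' p H ->
       '['Res[H] 'chi[G]_i, 'chi_j] != 0 -> '['Res[H] 'chi[G]_i', 'chi_j] != 0 -> i = i'].

Lemma canonical_of_mult : prime p -> mult_canonical -> restriction_canonical p G H.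
Proof.
move=> pr_p [index_p mult inj]; split.
  split=> // i ip; have [j jp mij] := mult i ip; exists j; split; first exact: p'_part_of_mult.
  move=> k kpart; have kp : k \in Irr_p' p H by case: kpart.
  have /eqP := mult_of_p'_part kpart; rewrite mij //.
  by case: (eqVneq k j) => [->//|_]; rewrite eq_sym oner_eq0.
pose star (i : Iirr G) : Iirr H := odflt 0 [pick j in Irr_p' p H | '['Res[H] 'chi_i, 'chi_j] == 1].
have starP i : i \in Irr_p' p G -> star i \in Irr_p' p H /\
    {in Irr_p' p H, forall k, '['Res[H] 'chi_i, 'chi_k] = (k == star i)%:R}.
  move=> ip; have [j jp mij] := mult i ip.
  rewrite /star; case: pickP => [k /andP[kp]|/(_ j)]; last by rewrite /= jp mij // eqxx eqxx.
  rewrite mij //; case: (eqVneq k j) => [->//|_]; last by rewrite eq_sym oner_eq0.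
exists star; split.
- by move=> i /starP[sp m]; apply: p'_part_of_mult.
- move=> i i' ip ip' E; have [sp m] := starP i ip; have [_ m'] := starP i' ip'.
  apply: (inj _ _ (star i)) => //; first by rewrite m // eqxx oner_eq0.
  by rewrite m' // E eqxx oner_eq0.
apply/setP=> j; apply/imsetP/idP => [[i ip ->]|jp]; first by case: (starP i ip).
have [i ip nz] : exists2 i, i \in Irr_p' p G & '['Ind[G] 'chi_j, 'chi_i] != 0.
  apply/exists_inP; apply: contraTT (jp) => /exists_inPn none; rewrite inE negbK.
  have : (p %| ('Ind[G] 'chi_j) 1%g)%C.
    rewrite (cfun_sum_cfdot ('Ind[G] 'chi_j)) sum_cfunE rpred_sum // => i _.
    rewrite cfunE; case: (boolP (i \in Irr_p' p G)) => [ip|].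
      by have := none i ip; rewrite negbK => /eqP->; rewrite mul0r rpred0.
    rewrite inE negbK => pi; apply: dvdC_mull => //.
    by rewrite Cint_cfdot_vchar ?cfInd_vchar ?irr_vchar.
  rewrite cfInd1 //; have /natrP[d ->] := Cnat_irr1 j.
  rewrite -natrM !dvdC_nat Euclid_dvdM // (negPf index_p) //.
have [sp m] := starP i ip; exists i => //; apply/eqP.
move: nz; rewrite -cfdot_Res_r cfdotC fmorph_eq0 m //.
by rewrite pnatr_eq0 eqb0 negbK.
Qed.

End Multiplicities.

Section Transport.

Variables (gT rT : finGroupType) (p : nat) (G H : {group gT}) (f : {morphism G >-> rT}).
Hypotheses (sHG : H \subset G) (inj_f : ('injm f)%g).

Lemma morph_Iirr_bij (K : {group gT}) : K \subset G ->
  bijective (@morph_Iirr gT rT K G f).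
Proof.
move=> sKG; apply: inj_card_bij; first exact: morph_Iirr_inj.
by rewrite !card_ord !NirrE nclasses_injm.
Qed.

Lemma morph_Iirr_p' (K : {group gT}) (i : Iirr (f @* K)) : K \subset G ->
  (morph_Iirr i \in Irr_p' p K) = (i \in Irr_p' p (f @* K)%G).
Proof. by move=> sKG; rewrite !inE morph_IirrE // cfMorph1. Qed.

Lemma mult_morph (i : Iirr (f @* G)) (k : Iirr (f @* H)) :
  '['Res[f @* H] 'chi_i, 'chi_k] = '['Res[H] 'chi[G]_(morph_Iirr i), 'chi_(morph_Iirr k)].
Proof. by rewrite !morph_IirrE // cfResMorph // cfMorph_iso. Qed.

Lemma mult_canonical_morphim :
  mult_canonical p G H -> mult_canonical p (f @* G)%G (f @* H)%G.
Proof.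
case=> index_p mult inj; split; first by rewrite index_injm.
  move=> i ip; have ip' : morph_Iirr i \in Irr_p' p G by rewrite morph_Iirr_p'.
  have [j jp mj] := mult _ ip'; have [g Kg gK] := morph_Iirr_bij sHG.
  exists (g j); first by rewrite -morph_Iirr_p' // gK.
  move=> k kp; rewrite mult_morph mj ?morph_Iirr_p' //.
  by rewrite -{1}(gK j) (inj_eq (can_inj Kg)).
move=> i i' j ip ip' jp; rewrite !mult_morph => nz nz'.
apply: (bij_inj (morph_Iirr_bij (subxx G))); apply: inj nz nz'; by rewrite morph_Iirr_p'.
Qed.

End Transport.

(** * Virtual characters of general linear groups *)

Section Combinations.

Variables (F : finFieldType) (m : nat).
Notation n := m.+1.
Notation gT := {'GL_n[F]}.
Notation subsp := (subsp F m).
Variables (C : finType) (ch : C -> F -> algC).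
Hypothesis chM : forall c x y, x != 0 -> y != 0 -> ch c (x * y) = ch c x * ch c y.
Hypothesis ch_unit : forall c x, x != 0 -> ch c x * (ch c x)^* = 1.
Hypothesis ch_sep : forall c d, c != d -> exists2 x, x != 0 & ch c x != ch d x.

Notation shape := (seq (nat * C)).
Implicit Types (L M : shape) (W : subsp) (A : gT).

Definition hcs M W A : algC :=
  hc ch (fun i => (tnth (in_tuple M) i).1) (fun i => (tnth (in_tuple M) i).2) W A.

Definition wsum M : nat := (\sum_(x <- M) x.1)%N.

Definition hprod (Z : comNzRingType) (h : C -> nat -> Z) M : Z := \prod_(x <- M) h x.2 x.1.

Definition hvar S (d : 'I_S -> C) (c : C) k : {mpoly int[S]} := hsym [set j | d j == c] k.

Lemma Gram_seq (H : {group gT}) W L M :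
  (forall g : gT, sact W g = W -> exists2 h, h \in H & W *m GLval h = W *m GLval g) ->
  (forall h, h \in H -> sact W h = W) -> wsum L = \rank W -> wsum M = \rank W ->
  #|H|%:R^-1 * (\sum_(A in H) hcs L W A * (hcs M W A)^*)
  = ((hprod (hvar (fun j => (tnth (in_tuple M) j).2)) L)
      @_[multinom (tnth (in_tuple M) j).1 | j < size M])%:~R.
Proof.
move=> Hl HW wL wM; rewrite (Gram chM ch_unit ch_sep _ _ Hl HW).
- by congr (_@_ _)%:~R; rewrite /hprod [RHS]big_tnth.
- by rewrite -wL /wsum [RHS]big_tnth.
by rewrite -wM /wsum [RHS]big_tnth.
Qed.

(* Formal integral combinations of products of complete symmetric polynomials. *)
Notation comb := (seq (int * shape)).
Implicit Types cb : comb.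

Definition hcomb cb W A : algC := \sum_(x <- cb) x.1%:~R * hcs x.2 W A.

Definition heval (Z : comNzRingType) (h : C -> nat -> Z) cb : Z :=
  \sum_(x <- cb) x.1%:~R * hprod h x.2.

Definition cweight k cb : bool := all (fun x => wsum x.2 == k) cb.

Definition cscale (a : int) cb : comb := [seq (a * x.1, x.2) | x <- cb].

Definition box c cb : comb := [seq (x.1, (1%N, c) :: x.2) | x <- cb].

Lemma hcomb_cat cb cb' W A : hcomb (cb ++ cb') W A = hcomb cb W A + hcomb cb' W A.
Proof. by rewrite /hcomb big_cat. Qed.

Lemma hcomb_scale a cb W A : hcomb (cscale a cb) W A = a%:~R * hcomb cb W A.
Proof. by rewrite /hcomb big_map mulr_sumr; apply: eq_bigr => x _; rewrite intrM mulrA. Qed.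

Lemma hcomb_flatten (J : Type) (r : seq J) (f : J -> comb) W A :
  hcomb (flatten [seq f j | j <- r]) W A = \sum_(j <- r) hcomb (f j) W A.
Proof.
elim: r => [|j r IH] /=; first by rewrite /hcomb !big_nil.
by rewrite hcomb_cat big_cons IH.
Qed.

Lemma heval_cat (Z : comNzRingType) (h : C -> nat -> Z) cb cb' :
  heval h (cb ++ cb') = heval h cb + heval h cb'.
Proof. by rewrite /heval big_cat. Qed.

Lemma heval_scale (Z : comNzRingType) (h : C -> nat -> Z) a cb :
  heval h (cscale a cb) = a%:~R * heval h cb.
Proof. by rewrite /heval big_map mulr_sumr; apply: eq_bigr => x _; rewrite intrM mulrA. Qed.

Lemma heval_flatten (Z : comNzRingType) (h : C -> nat -> Z) (J : Type) (r : seq J) (f : J -> comb) :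
  heval h (flatten [seq f j | j <- r]) = \sum_(j <- r) heval h (f j).
Proof.
elim: r => [|j r IH] /=; first by rewrite /heval !big_nil.
by rewrite heval_cat big_cons IH.
Qed.

Lemma heval_box (Z : comNzRingType) (h : C -> nat -> Z) c cb :
  heval h (box c cb) = h c 1%N * heval h cb.
Proof.
rewrite /heval big_map mulr_sumr; apply: eq_bigr => x _.
by rewrite /hprod big_cons /= mulrCA.
Qed.

Lemma cweight_cat k cb cb' : cweight k (cb ++ cb') = cweight k cb && cweight k cb'.
Proof. exact: all_cat. Qed.

Lemma cweight_scale k a cb : cweight k (cscale a cb) = cweight k cb.
Proof. by rewrite /cweight all_map. Qed.

Lemma cweight_flatten k (J : eqType) (r : seq J) (f : J -> comb) :
  (forall j, j \in r -> cweight k (f j)) -> cweight k (flatten [seq f j | j <- r]).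
Proof.
elim: r => [|j r IH] //= H; rewrite cweight_cat H ?mem_head // IH // => i ir.
by rewrite H // inE ir orbT.
Qed.

Lemma cweight_box k c cb : cweight k.+1 (box c cb) = cweight k cb.
Proof. by rewrite /cweight all_map; apply: eq_all => x /=; rewrite /wsum big_cons. Qed.

Lemma Gram_comb (H : {group gT}) W cb M :
  (forall g : gT, sact W g = W -> exists2 h, h \in H & W *m GLval h = W *m GLval g) ->
  (forall h, h \in H -> sact W h = W) -> cweight (\rank W) cb -> wsum M = \rank W ->
  #|H|%:R^-1 * (\sum_(A in H) hcomb cb W A * (hcs M W A)^*)
  = ((heval (hvar (fun j => (tnth (in_tuple M) j).2)) cb)
      @_[multinom (tnth (in_tuple M) j).1 | j < size M])%:~R.
Proof.
move=> Hl HW hcb wM.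
rewrite (eq_bigr (fun A => \sum_(x <- cb) x.1%:~R * (hcs x.2 W A * (hcs M W A)^*))).
  rewrite exchange_big /= mulr_sumr /heval raddf_sum rmorph_sum /=.
  rewrite big_seq [RHS]big_seq; apply: eq_bigr => x xcb.
  rewrite -mulr_sumr mulrCA (Gram_seq Hl HW _ wM); last exact/eqP/(allP hcb).
  have E z S (P : {mpoly int[S]}) l : (z%:~R * P)@_l = z * P@_l.
    by rewrite mulrzl raddfMz /= -mulrzl intz.
  by rewrite E intrM.
by move=> A _; rewrite mulr_suml; apply: eq_bigr => x _; rewrite mulrA.
Qed.

Definition gstab W : {set gT} := [set A | sact W A == W].

Lemma gstab_group_set W : group_set (gstab W).
Proof.
apply/group_setP; split=> [|A B]; rewrite !inE ?sact1 // => /eqP sA /eqP sB.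
by rewrite sactM sA sB.
Qed.
Canonical gstab_group W := Group (gstab_group_set W).

(* The Gram matrix of the functions [hcs M] only depends on the polynomials
   [hprod], so linear relations among the latter carry over. *)
Lemma lin_rel W cb cb' A : cweight (\rank W) cb -> cweight (\rank W) cb' ->
  (forall S (d : 'I_S -> C), heval (hvar d) cb = heval (hvar d) cb') ->
  sact W A = W -> hcomb cb W A = hcomb cb' W A.
Proof.
move=> hcb hcb' rel sA; pose D := cb ++ cscale (-1) cb'.
have DE B : hcomb D W B = hcomb cb W B - hcomb cb' W B.
  by rewrite hcomb_cat hcomb_scale mulN1r.
have hD : cweight (\rank W) D by rewrite cweight_cat cweight_scale hcb.
have Hl (g : gT) : sact W g = W ->
  exists2 h, h \in gstab_group W & W *m GLval h = W *m GLval g.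
  by move=> sg; exists g => //; rewrite inE sg.
have HW h : h \in gstab_group W -> sact W h = W by rewrite inE => /eqP.
have DM M : wsum M = \rank W -> \sum_(B in gstab_group W) hcomb D W B * (hcs M W B)^* = 0.
  move=> wM; have := Gram_comb Hl HW hD wM.
  rewrite heval_cat heval_scale rel mulN1r subrr mcoeff0 => /eqP.
  by rewrite mulf_eq0 invr_eq0 pnatr_eq0 eqn0Ngt cardG_gt0 /= => /eqP.
(* The difference [D] is itself a combination of the functions [hcs M] to which it is orthogonal, so
   its norm is 0 and it vanishes on the group. *)
have DD : \sum_(B in gstab_group W) hcomb D W B * (hcomb D W B)^* = 0.
  rewrite (eq_bigr (fun B => \sum_(x <- D) x.1%:~R * (hcomb D W B * (hcs x.2 W B)^*))).
    rewrite exchange_big big_seq big1 //= => x xD.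
    by rewrite -mulr_sumr DM ?mulr0 //; apply/eqP/(allP hD).
  move=> B _; rewrite {2}/hcomb rmorph_sum mulr_sumr; apply: eq_bigr => x _.
  by rewrite rmorphM rmorph_int mulrCA.
apply/eqP; rewrite -subr_eq0 -DE; apply/eqP.
have /psumr_eq0P : forall B, B \in gstab_group W -> 0 <= hcomb D W B * (hcomb D W B)^*.
  by move=> B _; apply: mul_conjC_ge0.
move=> /(_ DD A); rewrite inE sA eqxx => /(_ isT) /eqP.
by rewrite mul_conjC_eq0 => /eqP.
Qed.

Definition csize c M : nat := (\sum_(x <- M | x.2 == c) x.1)%N.

(* Each variable carries a colour, and complete symmetric polynomials of a
   colour only involve variables of that colour. *)
Lemma hprod_colour S (d : 'I_S -> C) L (l : 'X_{1..S}) c :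
  (hprod (hvar d) L)@_l != 0 -> csize c L = (\sum_(j | d j == c) l j)%N.
Proof.
elim: L l => [|x L IH] l; rewrite /hprod.
  rewrite big_nil mcoeff1; case: (eqVneq l 0%MM) => [->|_ /eqP//] _.
  by rewrite /csize big_nil big1 // => j _; rewrite mnm0E.
rewrite big_cons -/(hprod _ L) => nz.
have [u [v [Dl nu nv]]] : exists u, exists v,
    [/\ l = (u + v)%MM, (hvar d x.2 x.1)@_u != 0 & (hprod (hvar d) L)@_v != 0].
  have : l \in msupp (hvar d x.2 x.1 * hprod (hvar d) L) by rewrite mcoeff_msupp.
  move/msuppM_le/allpairsP => [[u v] /= [us vs ->]].
  by exists u, v; rewrite -!mcoeff_msupp.
rewrite Dl /csize big_cons -/(csize c L) (IH v nv).
move: nu; rewrite mcoeff_hsym; case: andP => [[/eqP du /subsetP sub] _|]; last by rewrite eqxx.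
have uc j : u j != 0%N -> d j = x.2 by move=> uj; apply/eqP; move: (sub j); rewrite !inE; apply.
rewrite [RHS](eq_bigr (fun j => u j + v j)%N); last by move=> j _; rewrite mnmDE.
rewrite big_split /=; case: eqP => [xc|nxc].
  congr (_ + _)%N; rewrite -du mdegE [RHS]big_mkcond; apply: eq_bigr => j _.
  by case: eqP => // ndj; apply/eqP; apply: contra_notT ndj => /uc ->.
rewrite [X in (X + _)%N]big1 // => j /eqP dj; apply/eqP; apply: contra_notT nxc => /uc <-.
exact: dj.
Qed.

End Combinations.

Section SchurCombinations.

Variables (F : finFieldType) (m : nat).
Notation n := m.+1.
Notation gT := {'GL_n[F]}.
Notation subsp := (subsp F m).
Variables (C : finType) (ch : C -> F -> algC).
Hypothesis chM : forall c x y, x != 0 -> y != 0 -> ch c (x * y) = ch c x * ch c y.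
Hypothesis ch_unit : forall c x, x != 0 -> ch c x * (ch c x)^* = 1.
Hypothesis ch_sep : forall c d, c != d -> exists2 x, x != 0 & ch c x != ch d x.

Variables (R r : nat) (col : 'I_R -> C) (dl : 'I_R -> nat).
Variable pos : C -> nat -> 'I_R.
Hypothesis dl_lt : forall p, (dl p < r)%N.
Hypothesis posK : forall p, pos (col p) (dl p) = p.
Hypothesis col_pos : forall c k, (k < r)%N -> col (pos c k) = c.
Hypothesis dl_pos : forall c k, (k < r)%N -> dl (pos c k) = k.

Notation shape := (seq (nat * C)).
Notation comb := (seq (int * shape)).
Notation mono := (mono col dl).
Notation npaths := (npaths col dl).
Notation d0 := (d0 dl).
Notation hcs := (hcs ch).
Notation hcomb := (hcomb ch).
Implicit Types (s t : 'X_{1..R}) (W : subsp) (A : gT) (sg : 'S_R).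

Lemma eq_hc S (k k' : 'I_S -> nat) (c c' : 'I_S -> C) W A :
  k =1 k' -> c =1 c' -> hc ch k c W A = hc ch k' c' W A.
Proof.
move=> Ek Ec; apply: eq_big => [t|t _].
  by congr ((_ && _) && _); apply: eq_forallb => i; rewrite Ek.
by apply: eq_bigr => i _; rewrite Ec.
Qed.

Definition shape_of S (k : 'I_S -> nat) (c : 'I_S -> C) : shape :=
  [seq (k p, c p) | p <- enum 'I_S].

Lemma hcs_shape S (k : 'I_S -> nat) (c : 'I_S -> C) W A :
  hcs (shape_of k c) W A = hc ch k c W A.
Proof.
have cast S' (e : S' = S) (k' : 'I_S' -> nat) (c' : 'I_S' -> C) :
    (forall i, k' i = k (cast_ord e i)) -> (forall i, c' i = c (cast_ord e i)) ->
    hc ch k' c' W A = hc ch k c W A.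
  move: k' c'; have e0 := esym e; move: e; case: S' / e0 => e' k' c' Ek Ec.
  by apply: eq_hc => i; rewrite ?Ek ?Ec cast_ord_id.
have eS : size (shape_of k c) = S by rewrite size_map size_enum_ord.
have nthE i : tnth (in_tuple (shape_of k c)) i = (k (cast_ord eS i), c (cast_ord eS i)).
  have [iS nthi] : (i < size (enum 'I_S))%N /\ nth (cast_ord eS i) (enum 'I_S) i = cast_ord eS i.
    have iS : (i < S)%N by rewrite -[X in (_ < X)%N]eS.
    by rewrite size_enum_ord; split=> //; apply: val_inj; rewrite /= nth_enum_ord.
  rewrite (tnth_nth (k (cast_ord eS i), c (cast_ord eS i))) /= /shape_of.
  by rewrite (nth_map (cast_ord eS i)) // nthi.
by apply: (cast _ eS) => i; rewrite nthE.
Qed.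

Lemma wsum_shape S (k : 'I_S -> nat) (c : 'I_S -> C) : wsum (shape_of k c) = (\sum_p k p)%N.
Proof. by rewrite /wsum big_map big_enum. Qed.

Lemma csize_shape S (k : 'I_S -> nat) (c : 'I_S -> C) x :
  csize x (shape_of k c) = (\sum_(p | c p == x) k p)%N.
Proof. by rewrite /csize big_map big_enum_cond. Qed.

Lemma hprod_shape (Z : comNzRingType) (h : C -> nat -> Z) S (k : 'I_S -> nat) (c : 'I_S -> C) :
  hprod h (shape_of k c) = \prod_p h (c p) (k p).
Proof. by rewrite /hprod big_map big_enum. Qed.

Lemma Gram_shape (H : {group gT}) W cb S (k : 'I_S -> nat) (c : 'I_S -> C) :
  (forall g : gT, sact W g = W -> exists2 h, h \in H & W *m GLval h = W *m GLval g) ->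
  (forall h, h \in H -> sact W h = W) -> cweight (\rank W) cb ->
  (\sum_p k p)%N = \rank W ->
  #|H|%:R^-1 * (\sum_(A in H) hcomb cb W A * (hcs (shape_of k c) W A)^*)
  = ((heval (hvar c) cb)@_[multinom k j | j < S])%:~R.
Proof.
move=> Hl HW hcb wM.
rewrite (eq_bigr (fun A => \sum_(x <- cb) x.1%:~R * (hcs x.2 W A * (hc ch k c W A)^*))).
  rewrite exchange_big /= mulr_sumr /heval raddf_sum rmorph_sum /=.
  rewrite big_seq [RHS]big_seq; apply: eq_bigr => x xcb.
  have wx : wsum x.2 = \rank W by apply/eqP/(allP hcb).
  rewrite -mulr_sumr mulrCA (Gram chM ch_unit ch_sep _ _ Hl HW) //; last first.
    by rewrite -wx /wsum [RHS]big_tnth.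
  have E z S' (P : {mpoly int[S']}) l : (z%:~R * P)@_l = z * P@_l.
    by rewrite mulrzl raddfMz /= -mulrzl intz.
  by rewrite E intrM /hprod [in RHS]big_tnth.
by move=> A _; rewrite hcs_shape mulr_suml; apply: eq_bigr => x _; rewrite mulrA.
Qed.

(* Expansion of the Jacobi-Trudi determinant of [s]. *)
Definition xcb s : comb :=
  [seq ((-1) ^+ sg, shape_of (fun p => s p - dl (sg p))%N col) | sg : 'S_R <-
    enum [pred sg | cpres col sg && [forall p, dl (sg p) <= s p]%N]].

Lemma heval_xcb (Z : comNzRingType) (h : C -> nat -> Z) s :
  heval h (xcb s) = \det (JTmx col dl h s).
Proof.
rewrite det_JTmx /heval big_map big_enum /=; apply: eq_bigr => sg _.
by rewrite hprod_shape rmorph_sign.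
Qed.

Lemma xcb_csize s c x : x \in xcb s ->
  (csize c x.2 + \sum_(p | col p == c) dl p)%N = (\sum_(p | col p == c) s p)%N.
Proof.
case/mapP=> sg; rewrite mem_enum inE => /andP[/forallP cs /forallP le] -> /=.
rewrite csize_shape; have -> : (\sum_(p | col p == c) dl p = \sum_(p | col p == c) dl (sg p))%N.
  rewrite (reindex_inj (@perm_inj _ sg)) /=; apply: eq_bigl => p.
  by rewrite (eqP (cs p)).
by rewrite -big_split; apply: eq_bigr => p _ /=; rewrite subnK.
Qed.

Lemma d0_perm sg : d0 = (\sum_p dl (sg p))%N.
Proof. by rewrite -[LHS]/(\sum_p dl p)%N (reindex_inj (@perm_inj _ sg)). Qed.

Lemma cweight_xcb s k : mdeg s = (k + d0)%N -> cweight k (xcb s).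
Proof.
move=> ds; apply/allP=> x /mapP[sg]; rewrite mem_enum inE => /andP[_ /forallP le] -> /=.
rewrite wsum_shape -(eqn_add2r d0) -ds mdegE (d0_perm sg) -big_split.
by apply/eqP; apply: eq_bigr => p _; rewrite /= subnK.
Qed.

(** Only X_t is expanded. Paired with X_s, its terms give coefficients of the Jacobi-Trudi
    determinant of [s], and their signed sum is the coefficient of [t] in the product with [alt dl],
    which is [alt s]. *)
Lemma xcb_ortho (H : {group gT}) W s t :
  (forall g : gT, sact W g = W -> exists2 h, h \in H & W *m GLval h = W *m GLval g) ->
  (forall h, h \in H -> sact W h = W) -> mono s -> mono t ->
  mdeg s = (\rank W + d0)%N -> mdeg t = (\rank W + d0)%N ->
  #|H|%:R^-1 * (\sum_(A in H) hcomb (xcb s) W A * (hcomb (xcb t) W A)^*) = (s == t)%:R.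
Proof.
move=> Hl HW ms mt ds dt; have hs := cweight_xcb ds; have ht := cweight_xcb dt.
rewrite (eq_bigr (fun A => \sum_(x <- xcb t)
    x.1%:~R * (hcomb (xcb s) W A * (hcs x.2 W A)^*))); last first.
  move=> A _; rewrite {2}/hcomb rmorph_sum mulr_sumr; apply: eq_bigr => x _.
  by rewrite rmorphM rmorph_int mulrCA.
rewrite exchange_big /= mulr_sumr /xcb big_map big_enum /= -/(xcb s).
have -> : (s == t)%:R = ((alt col s)@_t)%:~R :> algC.
  by rewrite (mcoeff_alt_mono dl_lt posK col_pos dl_pos) // rmorph_nat.
rewrite -(Jacobi_Trudi dl_lt posK col_pos dl_pos) mulrC mcoeff_alt_dlM rmorph_sum /=.
apply: eq_big => [sg|sg /andP[cs /forallP le]]; first by rewrite dlm_le.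
rewrite -mulr_sumr mulrCA (Gram_shape _ Hl HW hs); last first.
  apply/eqP; rewrite -(eqn_add2r d0) -dt mdegE (d0_perm sg) -big_split.
  by apply/eqP; apply: eq_bigr => p _; rewrite /= subnK.
rewrite heval_xcb intrM; congr (_ * (_@_ _)%:~R).
by apply/mnmP=> p; rewrite !mnmE.
Qed.

Lemma hvar0 S (d : 'I_S -> C) c : hvar d c 0%N = 1.
Proof. exact: hsym0. Qed.

Lemma xcb_rep W s p A k : mono s -> mdeg s = (k + d0)%N -> ~~ mono (s + U_(p))%MM ->
  \rank W = k.+1 -> sact W A = W -> hcomb (xcb (s + U_(p))%MM) W A = 0.
Proof.
move=> ms ds nm rW sA; rewrite (lin_rel (cb' := [::]) chM ch_unit ch_sep _ _ _ sA) //.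
- by rewrite /hcomb big_nil.
- by rewrite rW; apply: cweight_xcb; rewrite mdegD mdeg1 ds; lia.
move=> S d; rewrite heval_xcb /heval big_nil.
have [q [npq cpq spq]] := mono_up_rep ms nm.
exact: det_JTmx_rep npq cpq spq.
Qed.

Lemma xcb_Pieri W s c A k : mono s -> mdeg s = (k + d0)%N -> (k < r)%N ->
  \rank W = k.+1 -> sact W A = W ->
  hcomb (box c (xcb s)) W A = \sum_(p | col p == c) hcomb (xcb (s + U_(p))%MM) W A.
Proof.
move=> ms ds kr rW sA.
rewrite -[RHS]big_enum -(hcomb_flatten ch (enum _) (fun p => xcb (s + U_(p))%MM)).
apply: (lin_rel chM ch_unit ch_sep) => //.
- by rewrite rW cweight_box cweight_xcb.
- apply: cweight_flatten => p _; rewrite rW; apply: cweight_xcb.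
  by rewrite mdegD mdeg1 ds; lia.
move=> S d; rewrite heval_box heval_flatten big_enum heval_xcb /=.
have lts : (mdeg s < d0 + r)%N by rewrite ds; lia.
have [p0 cp0 sp0] := mono_bead0 dl_lt posK col_pos dl_pos c (leq_ltn_trans (leq0n k) kr) ms lts.
rewrite (det_JTmx_Pieri dl_lt posK col_pos dl_pos (hvar0 d) cp0 sp0).
apply: eq_bigr => p _; rewrite heval_xcb; congr (\det _).
by apply/matrixP=> x y; rewrite !mxE mnmDE mnm1E (eq_sym p).
Qed.

(* Expansion of the [k]-th power of [\sum_c h_1^c]. *)
Definition pcb k : comb :=
  [seq (1, shape_of (fun=> 1%N) th) | th : {ffun 'I_k -> C} <- enum {ffun 'I_k -> C}].

Lemma pcb_expand N W A k : \rank W = k -> (k <= r)%N -> (k + d0 < N)%N -> sact W A = W ->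
  hcomb (pcb k) W A = \sum_(s : 'X_{1..R < N} | mono s && (mdeg s == k + d0)%N)
    (npaths k s)%:~R * hcomb (xcb s) W A.
Proof.
move=> rW kr kN sA.
rewrite (eq_bigr (fun s : 'X_{1..R < N} => hcomb (cscale (npaths k s) (xcb s)) W A)); last first.
  by move=> s _; rewrite hcomb_scale.
rewrite -[RHS]big_enum -(hcomb_flatten ch (enum _) (fun s : 'X_{1..R < N} => cscale (npaths k s) (xcb s))).
apply: (lin_rel chM ch_unit ch_sep) => //.
- by apply/allP=> x /mapP[th _ ->] /=; rewrite wsum_shape sum1_card card_ord rW.
- apply: cweight_flatten => s; rewrite mem_enum unfold_in => /andP[_ /eqP ds].
  by rewrite cweight_scale rW cweight_xcb.
move=> S d; rewrite heval_flatten big_enum /=.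
have -> : heval (hvar d) (pcb k) = (\sum_c hvar d c 1%N) ^+ k.
  rewrite /heval big_map big_enum /= -[in RHS](card_ord k) -prodr_const bigA_distr_bigA /=.
  by apply: eq_bigr => th _; rewrite mul1r hprod_shape.
rewrite (psum_JT dl_lt posK col_pos dl_pos (hvar0 d) kN kr) big_mkcondr /=.
apply: eq_bigr => s _; rewrite heval_scale heval_xcb; case: eqP => // nd.
have [->|/npaths_deg] := eqVneq (npaths k s) 0; first by rewrite mul0r.
by move/nd.
Qed.

End SchurCombinations.

Lemma multiplicative_character (gT : finGroupType) (G : {group gT}) (f : gT -> algC) :
  f 1%g = 1 -> {in G &, forall x y, f (x * y)%g = f x * f y} ->
  exists2 psi : 'CF(G), psi \is a character & {in G, forall x, psi x = f x}.
Proof.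
move=> f1 fM; pose rf g : 'M[algC]_1 := (f g)%:M.
have rP : mx_repr G rf by split=> [|x y Gx Gy]; rewrite /rf ?f1 // fM // scalar_mxM.
exists (cfRepr (MxRepresentation rP)); first exact: cfRepr_char.
by move=> x Gx; rewrite cfunE Gx mulr1n /= mxtrace_scalar mulr1n.
Qed.

(** * Induced characters *)

Section OrbitInduction.

Variables (gT : finGroupType) (X : finType) (to : {action gT &-> X}) (G : {group gT}).
Variable phi : X -> gT -> algC.

Definition equivariant (D : {set X}) := forall x g h, x \in D -> h \in G -> g \in G ->
  to x g = x -> phi (to x h) (g ^ h) = phi x g.

(** Inducing from a point stabilizer sums the transported values over the fixed points of [A] in the
    orbit. *)
Lemma Ind_orbit D x0 (psi : 'CF('C_G[x0 | to])) A : equivariant D ->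
  orbit to G x0 \subset D ->
  {in 'C_G[x0 | to], forall g, psi g = phi x0 g} -> A \in G ->
  'Ind[G] psi A = \sum_(x in orbit to G x0 | to x A == x) phi x A.
Proof.
move=> phiJ /subsetP sD psiE GA; rewrite cfIndE ?subsetIl //.
(* The element [y] is counted at the point [x0 y^-1], because [A ^ y] fixes [x0] exactly when [A]
   fixes that point. *)
rewrite (partition_big (fun y => to x0 y^-1%g) (mem (orbit to G x0))) /=; last first.
  by move=> y Gy; rewrite mem_orbit ?groupV.
rewrite mulr_sumr big_mkcondr; apply: eq_bigr => x ox.
have fibre : #|[set y in G | to x0 y^-1%g == x]| = #|'C_G[x0 | to]|.
  have [a Ga Dx] := orbitP ox.
  rewrite -[RHS](card_lcoset _ a^-1%g); apply: eq_card => y.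
  rewrite mem_lcoset invgK !inE sub1set inE groupMl // actM Dx.
  by rewrite -[to x y == x0](inj_eq (act_inj to y^-1%g)) actK eq_sym.
have -> : \sum_(y in G | to x0 y^-1%g == x) psi (A ^ y)%g
   = \sum_(y in [set y in G | to x0 y^-1%g == x]) (if to x A == x then phi x A else 0).
  apply: eq_big => [y|y /andP[Gy /eqP Dx]]; first by rewrite inE.
  have xy : to x y = x0 by rewrite -Dx actKV.
  have StE : ((A ^ y)%g \in 'C_G[x0 | to]) = (to x A == x).
    rewrite !inE sub1set inE groupJ //= conjgE !actM -xy actK.
    by rewrite (inj_eq (act_inj to y)).
  case: ifP => fx; last by rewrite cfun0 // StE fx.
  by rewrite psiE ?StE // -{1}xy phiJ ?(eqP fx) // sD.
rewrite sumr_const fibre; set z := (if _ then _ else _); rewrite -[z *+ _]mulr_natl mulrA mulVf ?mul1r //.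
by rewrite pnatr_eq0 -lt0n cardG_gt0.
Qed.

(** One induced character for each orbit on [D]. *)
Lemma fixed_sum_character (D : {set X}) : equivariant D -> [acts G, on D | to] ->
  (forall x, x \in D -> exists2 psi : 'CF('C_G[x | to]), psi \is a character
      & {in 'C_G[x | to], forall g, psi g = phi x g}) ->
  exists2 xi : 'CF(G), xi \is a character
    & {in G, forall A, xi A = \sum_(x in D | to x A == x) phi x A}.
Proof.
move=> eqv; move: {2}#|D| (leqnn #|D|) => k; elim: k D eqv => [|k IH] D eqv lek aD psiD.
  exists 0; first exact: cfun0_char.
  move=> A GA; rewrite cfunE big1 // => x /andP[xD _].
  by move: lek; rewrite leqn0 cards_eq0 => /eqP D0; rewrite D0 inE in xD.
have [->|[x0 x0D]] := set_0Vmem D.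
  exists 0; first exact: cfun0_char.
  by move=> A GA; rewrite cfunE big1 // => x; rewrite inE.
pose O := orbit to G x0.
have sOD : O \subset D by rewrite acts_sub_orbit.
have [psi psi_char psiE] := psiD _ x0D.
have [||||xi xi_char xiE] := IH (D :\: O).
- by move=> x g h /setDP[xD _]; apply: eqv.
- rewrite -ltnS (leq_trans _ lek) // proper_card // properE subsetDl /=.
  by apply/subsetPn; exists x0; rewrite // inE orbit_refl.
- apply/subsetP=> g Gg; rewrite inE in_setT /= inE; apply/subsetP=> x; rewrite !inE.
  case/andP=> nO xD; rewrite (acts_act aD) ?xD ?andbT //.
  apply: contra nO => /orbitP[b Gb Db]; rewrite -(actK to g x) -Db -actM.
  by rewrite mem_orbit // groupM ?groupV.
- by move=> x /setDP[xD _]; apply: psiD.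
exists ('Ind[G] psi + xi); first by rewrite rpredD // cfInd_char.
move=> A GA; rewrite cfunE xiE // (Ind_orbit eqv sOD psiE GA).
rewrite [RHS](bigID (mem O)) /=; congr (_ + _).
  apply: eq_bigl => x; rewrite -/O [RHS]andbC; case xO: (x \in O) => //=.
  by rewrite (subsetP sOD _ xO).
by apply: eq_bigl => x; rewrite !inE [RHS]andbC andbA.
Qed.

End OrbitInduction.

Section ChainCharacters.

Variables (F : finFieldType) (m : nat).
Notation n := m.+1.
Notation gT := {'GL_n[F]}.
Notation subsp := (subsp F m).
Variables (C : finType) (ch : C -> F -> algC).
Hypothesis chM : forall c x y, x != 0 -> y != 0 -> ch c (x * y) = ch c x * ch c y.
Hypothesis ch_unit : forall c x, x != 0 -> ch c x * (ch c x)^* = 1.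
Implicit Types (W : subsp) (A g h : gT).

Lemma sact_is_action : is_action [set: gT] (@sact F m).
Proof.
apply: is_total_action => [U|U g h]; [exact: sact1 | exact: sactM].
Qed.
Canonical subsp_action := Action sact_is_action.

Lemma tact1 R (t : R.-tuple subsp) : tact 1 t = t.
Proof. by apply/val_inj; rewrite /= -[RHS]map_id; apply: eq_map => U; rewrite sact1. Qed.

Lemma tact_is_action R : is_action [set: gT] (fun t : R.-tuple subsp => fun g => tact g t).
Proof.
apply: is_total_action => [t|t g h]; [exact: tact1 | exact: tactM].
Qed.
Canonical chain_action R := Action (tact_is_action R).

Lemma fl_tact W R (t : R.-tuple subsp) i h : sact W h = W -> (i <= R)%N ->
  fl W (tact h t) i = sact (fl W t i) h.
Proof. by move=> sW; case: i => [|i] iR; [rewrite /fl /= sW | apply: fl_map]. Qed.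

Lemma fl_tact2 W R (t : R.-tuple subsp) i h : (i <= R)%N ->
  fl (sact W h) (tact h t) i = sact (fl W t i) h.
Proof.
case: i => [//|i] iR; rewrite /fl /= (nth_map (spn 0)) //.
by rewrite size_tuple.
Qed.

Lemma detres_sact U g h : sact U g = U ->
  detres (sact U h) (GLval (g ^ h)%g) = detres U (GLval g).
Proof.
move=> sU; have stU : stablemx U (GLval g) by rewrite stable_sact sU.
have sUh : stablemx (sact U h) (GLval (g ^ h)%g).
  by rewrite stable_sact conjgE -!sactM mulKVg sactM sU.
rewrite -(detres_conj (GLval_unit h) stU).
have -> : GLval (g ^ h)%g = invmx (GLval h) *m GLval g *m GLval h.
  by rewrite conjgE mulgA !GL_MxE GL_VxE.
apply/esym/detres_eqmx; first by apply: eqmx_sym; apply: sactE.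
move: sUh; rewrite conjgE mulgA !GL_MxE GL_VxE //.
Qed.

Lemma tact_stab W R (t : R.-tuple subsp) h : sact W h = W -> (tact h t == t) = stab W t h.
Proof.
move=> sW; rewrite /stab /= sW eqxx /=.
apply/eqP/allP => [E U Ut|s].
  apply/eqP; have /(congr1 val) /= := E.
  by rewrite -[in RHS](map_id t) => /eq_in_map/(_ U Ut).
by apply/val_inj; rewrite /= -[RHS]map_id; apply/eq_in_map => U /s /eqP.
Qed.

Lemma stab_sact W R (t : R.-tuple subsp) g h :
  stab (sact W h) (tact h t) (g ^ h)%g = stab W t g.
Proof.
have E U : (sact (sact U h) (g ^ h)%g == sact U h) = (sact U g == U).
  rewrite conjgE -!sactM mulKVg sactM; apply/eqP/eqP => [/(congr1 (fun V => sact V h^-1%g))|->] //.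
  by rewrite !sactK.
by rewrite /stab /= E all_map; congr (_ && _); apply: eq_all => U /=; rewrite E.
Qed.

Lemma wt_sact R (c : 'I_R -> C) W (t : R.-tuple subsp) g h : stab W t g ->
  wt ch c (sact W h) (tact h t) (g ^ h)%g = wt ch c W t g.
Proof.
move=> st; apply: eq_bigr => i _.
by rewrite !fl_tact2 ?(ltnW (ltn_ord i)) // !detres_sact ?stab_fl.
Qed.

Lemma chain_sact R (k : 'I_R -> nat) W (t : R.-tuple subsp) h :
  chain k (sact W h) (tact h t) = chain k W t.
Proof.
rewrite /chain fl_tact2 // sact_rank; congr (_ && _); apply: eq_forallb => i.
by rewrite !fl_tact2 ?(ltnW (ltn_ord i)) // !sact_rank sact_sub.
Qed.

Lemma tact_inj R h : injective (@tact F m R h).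
Proof. by move=> t u E; rewrite -[t]tact1 -[u]tact1 -(mulgV h) !tactM E. Qed.

Lemma hc_sact R (k : 'I_R -> nat) (c : 'I_R -> C) W g h :
  hc ch k c (sact W h) (g ^ h)%g = hc ch k c W g.
Proof.
rewrite /hc (reindex_inj (@tact_inj R h)) /=; apply: eq_big => [t|t /andP[_]].
  by rewrite chain_sact stab_sact.
by rewrite stab_sact; apply: wt_sact.
Qed.

Lemma hcomb_sact cb W g h : hcomb ch cb (sact W h) (g ^ h)%g = hcomb ch cb W g.
Proof. by apply: eq_bigr => x _; rewrite /hcs hc_sact. Qed.

Lemma hc_character (H : {group gT}) R (k : 'I_R -> nat) (c : 'I_R -> C) W :
  (forall h, h \in H -> sact W h = W) ->
  exists2 xi : 'CF(H), xi \is a character & {in H, forall A, xi A = hc ch k c W A}.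
Proof.
move=> HW; pose D := [set t : R.-tuple subsp | chain k W t].
have [|||xi xi_char xiE] := @fixed_sum_character _ _ (chain_action R) H (wt ch c W) D.
- move=> t g h _ Hh Hg /eqP; rewrite /= (tact_stab (W := W)) ?HW // => st.
  by rewrite -{1}(HW h Hh) wt_sact.
- apply/subsetP=> h Hh; rewrite inE in_setT /= inE; apply/subsetP=> t; rewrite !inE /=.
  by rewrite -{2}(HW h Hh) chain_sact.
- move=> t _; apply: multiplicative_character; first exact: wt1.
  move=> g h; rewrite !inE !sub1set !inE /= => /andP[Hg sg] /andP[Hh sh].
  by apply: (wtM chM); rewrite -(tact_stab (W := W)) ?HW.
exists xi => // A HA; rewrite xiE //; apply: eq_bigl => t.
by rewrite inE /= (tact_stab (W := W)) ?HW.
Qed.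

Lemma hcomb_virtual (H : {group gT}) cb W : (forall h, h \in H -> sact W h = W) ->
  exists2 xi : 'CF(H), xi \in 'Z[irr H] & {in H, forall A, xi A = hcomb ch cb W A}.
Proof.
move=> HW; elim: cb => [|x cb [xi xiZ xiE]].
  by exists 0; rewrite ?rpred0 // => A HA; rewrite cfunE /hcomb big_nil.
have [nu nu_char nuE] := hc_character (fun i => (tnth (in_tuple x.2) i).1)
  (fun i => (tnth (in_tuple x.2) i).2) HW.
exists (nu *~ x.1 + xi); first by rewrite rpredD // rpredMz // char_vchar.
move=> A HA; rewrite cfunE xiE // /hcomb big_cons /hcs -nuE //; congr (_ + _).
rewrite -scaler_int cfunE //.
Qed.

(** Splitting off the largest proper member [U] of the flag. This identifies induction from a
    hyperplane stabilizer with the addition of a part of size 1. *)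
Lemma hc_cons R (k : 'I_R.+1 -> nat) (c : 'I_R.+1 -> C) W A :
  hc ch k c W A = \sum_(U : subsp | [&& (U <= W)%MS, \rank W == (k ord0 + \rank U)%N,
      sact W A == W & sact U A == U])
    ch (c ord0) (detres W (GLval A) / detres U (GLval A))
      * hc ch (fun i => k (lift ord0 i)) (fun i => c (lift ord0 i)) U A.
Proof.
rewrite /hc; under [RHS]eq_bigr => U _ do rewrite mulr_sumr.
rewrite pair_big_dep /=.
rewrite (reindex (fun p : subsp * R.-tuple subsp => [tuple of p.1 :: p.2])) /=; last first.
  exists (fun t : R.+1.-tuple subsp => (thead t, [tuple of behead t])) => [[U t] _|t _] /=.
    by congr (_, _); apply: val_inj.
  by rewrite -tuple_eta.
have flS U (t : R.-tuple subsp) i : fl W [tuple of U :: t] i.+1 = fl U t i by [].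
apply: eq_big => [[U t]|[U t] _] /=; last first.
  by rewrite /wt big_ord_recl; congr (_ * _); apply: eq_bigr => i _; rewrite /= flS.
rewrite /chain.
have -> : [forall i : 'I_R.+1, (fl W (U :: t) i.+1 <= fl W (U :: t) i)%MS
     && (\rank (fl W (U :: t) i) == k i + \rank (fl W (U :: t) i.+1))%N]
  = [&& (U <= W)%MS, \rank W == (k ord0 + \rank U)%N &
     [forall i : 'I_R, (fl U t i.+1 <= fl U t i)%MS
     && (\rank (fl U t i) == k (lift ord0 i) + \rank (fl U t i.+1))%N]].
  apply/forallP/and3P => [H|[UW rW /forallP H] i].
    by have /andP[] := H ord0; split=> //; apply/forallP=> i; have := H (lift ord0 i).
  by case: (unliftP ord0 i) => [j ->|->]; [apply: H | rewrite UW rW].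
rewrite /stab /= -[fl W (U :: t) R.+1]/(fl U t R).
set b1 := (U <= W)%MS; set b2 := (\rank W == _); set b3 := [forall _, _].
set b4 := (_ == 0%N); set b5 := (sact W A == W); set b6 := (sact U A == U); set b7 := all _ _.
by case: b1 b2 b3 b4 b5 b6 b7 => [] [] [] [] [] [] [].
Qed.

End ChainCharacters.

(* Orbits of a 2-group without fixed points have even length. *)
Lemma sum_2group_even (gT : finGroupType) (T : {group gT}) (D : {set gT}) (f : gT -> algC) :
  (2.-group T)%g -> [acts T, on D | 'J] ->
  {in D & T, forall x h, f (x ^ h)%g = f x} -> {in D, forall x, f x \in Aint} ->
  (forall x, x \in D -> exists2 h, h \in T & (x ^ h)%g != x) ->
  (2 %| \sum_(x in D) f x)%A.
Proof.
move=> T2 aD fJ fA nofix.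
rewrite (set_partition_big _ (orbit_partition aD)) /= rpred_sum // => O /imsetP[x xD ->].
rewrite (eq_bigr (fun=> f x)); last by move=> y /orbitP[h Th <-]; apply: fJ.
rewrite sumr_const -[f x *+ _]mulr_natr.
have : (2 %| #|orbit 'J T x|)%N.
  have := dvdn_orbit 'J T x; rewrite -(part_pnat_id T2) p_part.
  move/(dvdn_pfactor _ _ (isT : prime 2))=> [[|k] _ E]; last by rewrite E expnS dvdn_mulr.
  have [h Th] := nofix x xD.
  by have := mem_orbit 'J x Th; rewrite (card_orbit1 E) inE => ->.
case/dvdnP=> k ->; rewrite natrM mulrA unfold_in pnatr_eq0 /= mulfK ?pnatr_eq0 //.
by rewrite rpredM ?fA ?Aint_nat ?rpred_nat.
Qed.

(** * The stabilizer of a hyperplane *)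

Section StandardHyperplane.

Variables (F : finFieldType) (m : nat).
Notation n := m.+1.
Notation gT := {'GL_n[F]}.
Notation subsp := (subsp F m).
Notation SL := (SL_group n F).
Implicit Types (U W : subsp) (A g h : gT).

Definition V1 : subsp := spn 1%:M.
Definition W0 : subsp := spn (pid_mx m).

Lemma sact_V1 g : sact V1 g = V1.
Proof.
apply: subsp_eq; apply: eqmx_trans (sactE _ _) _; apply: eqmx_trans (eqmxMr _ (spnE _)) _.
apply: eqmx_trans _ (eqmx_sym (spnE _)); rewrite mul1mx; apply/eqmxP.
by rewrite submx1 sub1mx row_full_unit GLval_unit.
Qed.

Lemma rank_V1 : \rank V1 = n.
Proof. by rewrite spnE mxrank1. Qed.

Lemma rank_W0 : \rank W0 = m.
Proof. by rewrite spnE rank_pid_mx. Qed.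

Lemma inSL g : (g \in SL) = (\det (GLval g) == 1).
Proof. by rewrite inE. Qed.

Definition hstab : {group gT} := 'C_SL[W0 | subsp_action F m]%G.

Lemma in_hstab g : (g \in hstab) = (\det (GLval g) == 1) && (sact W0 g == W0).
Proof. by rewrite !inE sub1set inE. Qed.

Lemma hstab_sub : hstab \subset SL.
Proof. exact: subsetIl. Qed.

(** As [B'] does not span the whole space, the determinant can be corrected by a homothety that is
    trivial on the span of [B']. *)
Lemma SL_exchange r (B B' : 'M[F]_(r, n)) : (r < n)%N -> row_free B -> row_free B' ->
  exists2 g, g \in SL & B *m GLval g = B'.
Proof.
move=> rn fB fB'; have [A uA BA] := row_free_exchange fB fB'.
have [v nv] : exists v : 'rV_n, ~~ (v <= B')%MS.
  have : ~~ (1%:M <= B')%MS.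
    by rewrite sub1mx /row_full (eqP fB') neq_ltn rn.
  by case/row_subPn=> i ni; exists (row i 1%:M).
have [phi Bphi vphi] := separating_functional nv.
have d0 : \det A != 0 by rewrite -unitfE -unitmxE.
have d1 : (\det A)^-1 != 0 by rewrite invr_eq0.
have uh := homothety_unit d1 vphi.
have [|g Dg] := @GL_lift F m (A *m homothety (\det A)^-1 phi v); first by rewrite unitmx_mul uA.
exists g; last by rewrite Dg mulmxA BA mulmx_homothety Bphi mul0mx scaler0 addr0.
rewrite inSL Dg det_mulmx.
have <- := detres_full (homothety (\det A)^-1 phi v) (eqmx_refl 1%:M).
by rewrite detres_homothety ?submx1 // mulfV.
Qed.

Lemma hstab_lift g : sact W0 g = W0 ->
  exists2 h, h \in hstab & W0 *m GLval h = W0 *m GLval g.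
Proof.
move=> sg; have r0 : (\rank W0 < n)%N by rewrite rank_W0.
have fB' : row_free (row_base W0 *m GLval g).
  by rewrite /row_free mxrankMfree ?GLval_free // (eqP (row_base_free W0)).
have [h hSL Eh] := SL_exchange r0 (row_base_free W0) fB'.
have E : W0 *m GLval h = W0 *m GLval g.
  have : (W0 <= row_base W0)%MS by rewrite eq_row_base.
  case/submxP=> X E; transitivity (X *m (row_base W0 *m GLval h)); first by rewrite mulmxA -E.
  by rewrite Eh mulmxA -E.
by exists h => //; rewrite in_hstab -inSL hSL /= /sact E -{2}sg.
Qed.

Lemma hyperplane_orbit U : (U \in orbit (subsp_action F m) SL W0) = (\rank U == m).
Proof.
apply/orbitP/eqP => [[g _ <-]|rU]; first by rewrite -[RHS]rank_W0; apply: sact_rank.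
have e : \rank U = \rank W0 by rewrite rU rank_W0.
pose B := castmx (e, erefl n) (row_base U).
have fB : row_free B by rewrite row_free_castmx row_base_free.
have r0 : (\rank W0 < n)%N by rewrite rank_W0.
have [g gSL Eg] := SL_exchange r0 (row_base_free W0) fB.
exists g => //=; apply: subsp_eq; apply: eqmx_trans (sactE _ _) _.
apply: eqmx_trans (eqmxMr _ (eqmx_sym (eq_row_base _))) _; rewrite Eg.
exact: eqmx_trans (eqmx_cast _ _) (eq_row_base _).
Qed.

Definition flag0 : m.-tuple subsp := [tuple spn (pid_mx (m - i.+1)) | i < m].

Lemma fl_flag0 i : (i <= m)%N -> fl W0 flag0 i = spn (pid_mx (m - i)).
Proof.
case: i => [|i] im; first by rewrite subn0.
by rewrite /fl /= -[i]/(nat_of_ord (Ordinal im)) nth_mktuple.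
Qed.

Lemma chain_flag0 : chain (R := m) (fun=> 1%N) W0 flag0.
Proof.
apply/andP; split; last by rewrite fl_flag0 // subnn spnE rank_pid_mx.
apply/forallP=> i; have im := ltn_ord i.
rewrite !fl_flag0 ?(ltnW im) // !spnE !rank_pid_mx; try lia.
have E : pid_mx (m - i.+1) = pid_mx (m - i.+1) *m (pid_mx (m - i) : 'M[F]_n) :> 'M[F]_n.
  by rewrite mul_pid_mx; congr pid_mx; lia.
by rewrite {1}E submxMl; lia.
Qed.

(* For a complete flag [t] these are the elements acting trivially on the quotients. *)
Definition ratio1 (t : m.-tuple subsp) : {set gT} :=
  [set A in hstab | stab W0 t A && [forall i : 'I_m,
     detres (fl W0 t i) (GLval A) == detres (fl W0 t i.+1) (GLval A)]].

Lemma hstab_W0 h : h \in hstab -> sact W0 h = W0.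
Proof. by rewrite in_hstab => /andP[_ /eqP]. Qed.

Lemma ratio1_conj t A h : h \in hstab -> ((A ^ h)%g \in ratio1 (tact h t)) = (A \in ratio1 t).
Proof.
move=> hQ; have sW := hstab_W0 hQ; rewrite [LHS]in_set [RHS]in_set groupJr //.
case AQ: (A \in hstab) => //=; have := stab_sact W0 t A h; rewrite sW => ->.
case st: (stab W0 t A) => //=; apply: eq_forallb => i.
rewrite !(fl_tact _ sW) ?(ltnW (ltn_ord i)) //.
by rewrite !detres_sact ?(stab_fl _ st).
Qed.

Lemma flags_transitive (t : m.-tuple subsp) : chain (R := m) (fun=> 1%N) W0 t ->
  exists2 h, h \in hstab & t = tact h flag0.
Proof.
(* Transitivity on single flags is the case of pairs whose second flag has only the members [W0] and
   0. *)
move=> ct; pose u := [tuple of nseq 1 (spn 0 : subsp)].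
have cu : chain (fun _ : 'I_1 => m) W0 u.
  rewrite /chain /= /fl /= spnE mxrank0 eqxx andbT; apply/forallP=> -[[|//] i1].
  have -> : nat_of_ord (Ordinal i1) = 0%N by [].
  have r0 : \rank (spn 0 : subsp) = 0%N by rewrite spnE mxrank0.
  by rewrite /= r0 rank_W0 addn0 eqxx andbT spnE sub0mx.
have [g Dg] := isty_exists ct cu; have [g0 Dg0] := isty_exists chain_flag0 cu.
have [E _] : (forall i, mdeg (g i) = 1%N) /\ _ := isty_margins ct cu (introT idP (etrans (Dg g) (eqxx g))).
have [E0 _] : (forall i, mdeg (g0 i) = 1%N) /\ _ :=
  isty_margins chain_flag0 cu (introT idP (etrans (Dg0 g0) (eqxx g0))).
have gg : g = g0.
  apply/ffunP=> i; apply/val_inj/mnmP=> j /=.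
  by move: (E i) (E0 i); rewrite !mdegE !big_ord1 (ord1 j) => -> ->.
have tyg : isty W0 t u g by rewrite Dg.
have tyg0 : isty W0 flag0 u g by rewrite Dg0 gg.
have [h hQ [-> _]] := pair_transitive hstab_lift chain_flag0 cu tyg0 ct cu tyg.
by exists h.
Qed.

Lemma ratio1_sum (psi : 'CF(hstab)) (t : m.-tuple subsp) : chain (R := m) (fun=> 1%N) W0 t ->
  \sum_(A in ratio1 t) psi A = \sum_(A in ratio1 flag0) psi A.
Proof.
move=> /flags_transitive[h hQ ->].
rewrite (reindex_inj (conjg_inj h)) /=; apply: eq_big => [A|A _]; first exact: ratio1_conj.
exact: cfunJ.
Qed.

(* Acts by conjugation on [ratio1 flag0] with 1 as only fixed point. *)
Definition sign_torus : {set gT} :=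
  [set h in hstab | is_diag_mx (GLval h) & (h ^+ 2 == 1)%g].

Lemma in_sign_torus g : (g \in sign_torus) =
  [&& g \in hstab, is_diag_mx (GLval g) & (g ^+ 2 == 1)%g].
Proof. by rewrite [LHS]in_set. Qed.

Lemma sign_torus_group_set : group_set sign_torus.
Proof.
have comm (g h : gT) : is_diag_mx (GLval g) -> is_diag_mx (GLval h) -> (g * h = h * g)%g.
  move=> /diag_mxP[d Dd] /diag_mxP[e De]; apply: val_inj.
  by rewrite -![val _]/(GLval _) !GL_MxE Dd De diag_mxC.
apply/group_setP; split.
  rewrite in_sign_torus; apply/and3P; split; first exact: group1.
    by rewrite GL_1E scalar_mx_is_diag.
  by rewrite expg1n.
move=> g h; rewrite !in_sign_torus => /and3P[gQ gd /eqP g2] /and3P[hQ hd /eqP h2].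
rewrite groupM // expgMn; last exact: comm.
rewrite g2 h2 mulg1 eqxx andbT andTb.
move: gd hd => /diag_mxP[d Dd] /diag_mxP[e De].
by rewrite GL_MxE Dd De mulmx_diag diag_mx_is_diag.
Qed.
Canonical sign_torus_group := Group sign_torus_group_set.

Lemma sign_torus_2group : (2.-group sign_torus)%g.
Proof.
rewrite -pnat_exponent; apply: pnat_dvd (pnat_id (isT : prime 2)).
by apply/exponentP=> h; rewrite in_sign_torus => /and3P[_ _ /eqP].
Qed.

Hypothesis charF : (2 : F) != 0.
Hypothesis m2 : (1 < m)%N.

Definition signs (i j : 'I_n) : 'rV[F]_n := \row_k (if (k == i) || (k == j) then -1 else 1).

Lemma diag_stab_pid (d : 'rV[F]_n) k : stablemx (pid_mx k : 'M[F]_n) (diag_mx d).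
Proof.
have -> : pid_mx k *m diag_mx d = diag_mx d *m pid_mx k :> 'M[F]_n.
  apply/matrixP=> x y; rewrite mul_mx_diag mul_diag_mx !mxE.
  case: eqP => [/val_inj->|_] /=; first by rewrite mulrC.
  by rewrite mul0r mulr0.
exact: submxMl.
Qed.

Lemma sign_in_torus i j : i != j ->
  exists2 h, h \in sign_torus & GLval h = diag_mx (signs i j).
Proof.
move=> nij; have s2 k : signs i j 0 k * signs i j 0 k = 1.
  by rewrite mxE; case: ifP; rewrite ?mulrNN mulr1.
have d1 : \det (diag_mx (signs i j)) = 1.
  rewrite det_diag (bigD1 i) //= (bigD1 j) 1?eq_sym //= !mxE !eqxx orbT /=.
  rewrite big1 ?mulr1 ?mulrNN ?mulr1 // => k /andP[ki kj].
  by rewrite mxE (negPf ki) (negPf kj).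
have [|h Dh] := @GL_lift F m (diag_mx (signs i j)); first by rewrite unitmxE d1 unitr1.
exists h => //; rewrite in_sign_torus in_hstab Dh d1 eqxx diag_mx_is_diag /=.
rewrite -stable_sact Dh; apply/andP; split.
  by rewrite (eqmx_stable _ (spnE _)) diag_stab_pid.
apply/eqP/val_inj; rewrite -[val _]/(GLval _) -[RHS]/(GLval 1%g) expgS expg1 GL_MxE Dh.
rewrite mulmx_diag; transitivity (1%:M : 'M[F]_n); last by [].
rewrite -diag_const_mx; congr diag_mx.
by apply/rowP=> k; rewrite !mxE -[RHS](s2 k) !mxE.
Qed.

(** A third index [k] exists because [n > 2]. Conjugation by the signs at [i] and [k] negates the
    entry [(i, j)], which therefore vanishes in characteristic other than 2. *)
Lemma sign_commute_diag A : (forall h, h \in sign_torus -> (A ^ h)%g = A) ->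
  is_diag_mx (GLval A).
Proof.
move=> fixA; apply/is_diag_mxP=> i j nij; apply/eqP.
suff : 2 * GLval A i j == 0 by rewrite mulf_eq0 (negPf charF).
have [k /andP[ki kj]] : exists k : 'I_n, (k != i) && (k != j).
  have /card_gt0P[k] : (0 < #|~: [set i; j]|)%N.
    by have := cardsC [set i; j]; rewrite cardsU1 cards1 card_ord; case: (i \notin _) => /=; lia.
  by rewrite !inE negb_or; exists k.
have nik : i != k by rewrite eq_sym.
have [h hT Dh] := sign_in_torus nik.
have Ah : (A * h = h * A)%g by rewrite -{2}(fixA h hT) conjgE !mulgA mulgV mul1g.
have /(congr1 (fun g : gT => GLval g i j)) := Ah.
have ji : (j == i) = false by apply/negbTE; rewrite eq_sym -val_eqE.
have jk : (j == k) = false by rewrite eq_sym (negPf kj).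
rewrite !GL_MxE Dh mul_mx_diag mul_diag_mx [LHS]mxE [RHS]mxE ![signs _ _ _ _]mxE ji jk eqxx /=.
by move=> E; rewrite mulr_natl mulr2n -{1}[GLval A i j]mulr1 E mulN1r addNr.
Qed.

Lemma detres_diag_pid (d : 'rV[F]_n) k : (k <= n)%N ->
  detres (spn (pid_mx k : 'M[F]_n)) (diag_mx d) = \prod_(j < k) d 0 (inord j).
Proof.
move=> kn; transitivity (\det (diag_mx (\row_(j < k) d 0 (inord j) : 'rV[F]_k))).
  apply: (@detres_unique _ _ _ (pid_mx k : 'M[F]_(k, n))).
  - by rewrite /row_free rank_pid_mx.
  - apply: eqmx_trans _ (eqmx_sym (spnE _)); apply/eqmxP/andP; split.
      apply/submxP; exists (pid_mx k); rewrite mul_pid_mx; congr pid_mx; lia.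
    apply/submxP; exists (pid_mx k : 'M_(n, k)); rewrite mul_pid_mx; congr pid_mx; lia.
  apply/matrixP=> x y; rewrite mul_mx_diag mul_diag_mx !mxE.
  case: eqP => [xy|_] /=; last by rewrite mul0r mulr0.
  by rewrite mulrC xy inord_val.
by rewrite det_diag; apply: eq_bigr => j _; rewrite mxE.
Qed.

(** The product of the first [k] diagonal entries is the determinant on a member of [flag0], hence 1
    for [k <= m]; for [k = n] it is the determinant of [A], which is 1 as well. *)
Lemma diag_ratio1 A : A \in ratio1 flag0 -> is_diag_mx (GLval A) -> A = 1%g.
Proof.
rewrite [A \in _]in_set => /and3P[AQ st /forallP rat] /diag_mxP[d Dd].
have det1k k : (k <= n)%N -> \prod_(j < k) d 0 (inord j) = 1.
  rewrite leq_eqVlt => /predU1P[->|].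
    rewrite -detres_diag_pid // -Dd (@detres_full _ _ _ (GLval A)).
      by apply/eqP; move: AQ; rewrite in_hstab => /andP[].
    by apply: eqmx_trans (spnE _) _; rewrite pid_mx_1; apply: eqmx_refl.
  rewrite ltnS; elim: k => [|k IH] km; first by rewrite big_ord0.
  have im : (m - k.+1 < m)%N by lia.
  have /eqP := rat (Ordinal im); rewrite /= !fl_flag0 //; try lia.
  have -> : (m - (m - k.+1) = k.+1)%N by lia.
  have -> : (m - (m - k.+1).+1 = k)%N by lia.
  by rewrite Dd !detres_diag_pid; try lia; rewrite (IH (ltnW km)).
have d1 j : d 0 j = 1.
  have := det1k j.+1 (ltn_ord j); rewrite big_ord_recr /= det1k ?mul1r ?inord_val //.
  exact: ltnW.
apply: val_inj; transitivity (1%:M : 'M[F]_n); last by [].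
rewrite -[LHS]/(GLval A) Dd -diag_const_mx.
by congr diag_mx; apply/rowP=> j; rewrite d1 mxE.
Qed.

Lemma torus_flag0 h : h \in sign_torus -> tact h flag0 = flag0.
Proof.
rewrite in_sign_torus => /and3P[_ /diag_mxP[d Dd] _]; apply/val_inj.
rewrite -[RHS]map_id; apply/eq_in_map => U /mapP[i _ ->]; apply/eqP.
by rewrite -stable_sact Dd (eqmx_stable _ (spnE _)) diag_stab_pid.
Qed.

Lemma ratio1_parity (psi : 'CF(hstab)) : psi \in 'Z[irr hstab] ->
  (2 %| \sum_(A in ratio1 flag0) psi A - psi 1%g)%A.
Proof.
move=> Zpsi; have U1 : 1%g \in ratio1 flag0.
  rewrite in_set group1 stab1; apply/forallP=> i.
  by rewrite !detres_id ?GL_1E ?mulmx1.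
have sUQ : {subset ratio1 flag0 <= hstab} by move=> A; rewrite in_set => /andP[].
have sTQ : {subset sign_torus <= hstab} by move=> h; rewrite in_sign_torus => /and3P[].
rewrite (bigD1 1%g) //=; set S := \sum_(_ | _) _.
have -> : psi 1%g + S - psi 1%g = S by rewrite addrAC subrr add0r.
rewrite /S.
rewrite (eq_bigl (mem (ratio1 flag0 :\ 1%g))); last by move=> A; rewrite !inE andbC.
apply: (sum_2group_even sign_torus_2group).
- apply/subsetP=> h hT; rewrite inE in_setT /= inE; apply/subsetP=> A.
  rewrite in_setD1 => /andP[A1 AU]; rewrite inE in_setD1 /= conjg_eq1 A1 /=.
  by rewrite -(torus_flag0 hT) ratio1_conj // sTQ.
- by move=> A h /setD1P[_ /sUQ AQ] /sTQ hQ; rewrite cfunJ.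
- by move=> A _; apply: Aint_vchar.
move=> A /setD1P[A1 AU]; apply/exists_inP; apply: contraNT A1 => nex.
apply/eqP/diag_ratio1 => //; apply: sign_commute_diag => h hT; apply/eqP.
by apply: contraNT nex => Ah; apply/exists_inP; exists h.
Qed.

(** All complete flags give the same sum, so pairing with [P] is a constant multiple of [s]. The
    value at the trivial character fixes the constant: ['[psi, P] * s 1 = s psi], where [s psi] and
    [psi 1] agree modulo 2 and [s 1] is odd. *)
Lemma flag_sum_parity (P psi : 'CF(hstab)) (K : nat) :
  P \in 'Z[irr hstab] -> psi \in 'Z[irr hstab] -> '[1, P] = 1 ->
  {in hstab, forall A, P A = K%:R * \sum_(t : m.-tuple subsp | chain (R := m) (fun=> 1%N) W0 t)
      (A \in ratio1 t)%:R} ->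
  (2 %| '[psi, P] - psi 1%g)%A.
Proof.
move=> ZP Zpsi P1 PE; pose s (f : 'CF(hstab)) := \sum_(A in ratio1 flag0) f A.
pose N := #|[pred t : m.-tuple subsp | chain (R := m) (fun=> 1%N) W0 t]|.
have dotE (f : 'CF(hstab)) : '[f, P] = #|hstab|%:R^-1 * (K%:R * N%:R) * s f.
  rewrite cfdotE -mulrA; congr (_ * _).
  rewrite (eq_bigr (fun A => \sum_(t : m.-tuple subsp | chain (R := m) (fun=> 1%N) W0 t)
     K%:R * ((A \in ratio1 t)%:R * f A))); last first.
    move=> A AQ; rewrite PE // rmorphM rmorph_nat rmorph_sum mulrCA -mulr_sumr; congr (_ * _).
    by rewrite mulr_sumr; apply: eq_bigr => t _; rewrite rmorph_nat mulrC.
  rewrite exchange_big /= -mulrA /N -sum1_card natr_sum mulr_suml mulr_sumr.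
  apply: eq_bigr => t ct; rewrite mul1r -mulr_sumr; congr (_ * _).
  rewrite /s -(ratio1_sum f ct) big_mkcond [RHS]big_mkcond; apply: eq_bigr => A _.
  case AU: (A \in ratio1 t); last by rewrite mul0r if_same.
  by rewrite mul1r ifT //; move: AU; rewrite in_set => /andP[].
have E : '[psi, P] * s 1 = s psi.
  by rewrite dotE mulrAC -dotE P1 mul1r.
have Za : '[psi, P] \in Aint by rewrite Aint_Cint // Cint_cfdot_vchar.
have := ratio1_parity Zpsi; have := ratio1_parity (rpred1 _ : 1 \in 'Z[irr hstab]).
rewrite -/(s psi) -/(s 1) -E cfun1E group1 => d1 d2.
have -> : '[psi, P] - psi 1%g = ('[psi, P] * s 1 - psi 1%g) - '[psi, P] * (s 1 - 1) by ring.
rewrite rpredB // -eqAmod0 -(mulr0 '[psi, P]) eqAmodMl // eqAmod0.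
exact: d1.
Qed.

End StandardHyperplane.

(** * From GL_n to SL_n *)

Section SpecialLinearProducts.

Variables (F : finFieldType) (m : nat).
Notation n := m.+1.
Notation gT := {'GL_n[F]}.
Notation subsp := (subsp F m).
Notation SL := (SL_group n F).
Notation W0 := (W0 F m).
Notation V1 := (V1 F m).
Notation hstab := (hstab F m).
Variables (C : finType) (ch : C -> F -> algC).
Hypothesis chM : forall c x y, x != 0 -> y != 0 -> ch c (x * y) = ch c x * ch c y.
Hypothesis ch_unit : forall c x, x != 0 -> ch c x * (ch c x)^* = 1.
Hypothesis ch_sep : forall c d, c != d -> exists2 x, x != 0 & ch c x != ch d x.
(* [C] is the character group of [F^*]: [c0] is trivial, [K] is the order, [tw] the product. *)
Variables (c0 : C) (K : nat) (tw : C -> C -> C).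
Hypothesis ch_triv : forall x, x != 0 -> ch c0 x = 1.
Hypothesis K0 : (0 < K)%N.
Hypothesis ch_sum : forall x, x != 0 -> \sum_c ch c x = K%:R * (x == 1)%:R.
Hypothesis ch_tw : forall e c x, x != 0 -> ch (tw e c) x = ch e x * ch c x.
Implicit Types (U W : subsp) (A g h : gT) (c d e : C).

Lemma ch_ext c d : (forall x, x != 0 -> ch c x = ch d x) -> c = d.
Proof.
move=> E; apply: contraTeq isT => /ch_sep[x x0]; rewrite E // eqxx.
by [].
Qed.

Lemma tw_triv e : tw e c0 = e.
Proof. by apply: ch_ext => x x0; rewrite ch_tw // ch_triv // mulr1. Qed.

Lemma tw_inj e : injective (tw e).
Proof.
move=> c d E; apply: ch_ext => x x0; apply: (mulfI (ch_neq0 ch_unit e x0)).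
by rewrite -!ch_tw // E.
Qed.

Lemma hcs_cons k c M W A : hcs ch ((k, c) :: M) W A =
  \sum_(U : subsp | [&& (U <= W)%MS, \rank W == (k + \rank U)%N, sact W A == W & sact U A == U])
    ch c (detres W (GLval A) / detres U (GLval A)) * hcs ch M U A.
Proof.
rewrite /hcs hc_cons; apply: eq_bigr => U _; congr (_ * _).
by apply: eq_hc => i; rewrite !(tnth_nth (k, c)).
Qed.

Lemma hcs_nil A : hcs ch [::] (spn 0) A = 1.
Proof.
rewrite /hcs /hc (big_pred1 [tuple]) => [|t]; first by rewrite /wt big_ord0.
rewrite (tuple0 t); transitivity true; last exact/esym/eqxx.
rewrite /chain /stab /= /fl /= sact0 eqxx spnE mxrank0 eqxx !andbT.
by apply/forallP=> -[].
Qed.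

Lemma hcs_one k c W A : \rank W = k -> sact W A = W ->
  hcs ch [:: (k, c)] W A = ch c (detres W (GLval A)).
Proof.
move=> rW sA; rewrite hcs_cons (big_pred1 (spn 0)) => [|U].
  by rewrite (detres0 (W := spn 0)) ?spnE ?mxrank0 // divr1 hcs_nil mulr1.
rewrite /= sA eqxx rW -{1}(addn0 k) eqn_add2l eq_sym mxrank_eq0 /=.
apply/and3P/eqP => [[_ /eqP U0 _]|->].
  apply: subsp_eq; rewrite U0; exact: eqmx_sym (spnE 0).
split; first by rewrite spnE sub0mx.
  by rewrite -mxrank_eq0 spnE mxrank0.
by rewrite sact0.
Qed.

Lemma GL_lift_self W (g : gT) : sact W g = W ->
  exists2 h, h \in [set: gT] & W *m GLval h = W *m GLval g.
Proof. by exists g; rewrite ?inE. Qed.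

Lemma detV1 A : detres V1 (GLval A) = \det (GLval A).
Proof. by apply: detres_full; apply: spnE. Qed.

Lemma det_neq0 A : \det (GLval A) != 0.
Proof. by rewrite -unitfE -unitmxE GLval_unit. Qed.

Lemma sum_ch_det e : \sum_(A : gT) ch e (\det (GLval A)) = #|[set: gT]|%:R * (e == c0)%:R.
Proof.
pose k1 (_ : 'I_1) := n; pose d1 (_ : 'I_1) := c0.
have := @Gram_shape _ _ _ _ chM ch_unit ch_sep [set: gT]%G V1 [:: (1, [:: (n, e)])] 1 k1 d1
  (@GL_lift_self V1) (fun h _ => sact_V1 h).
rewrite /cweight /= /wsum big_seq1 rank_V1 eqxx big_ord1 => /(_ isT erefl).
rewrite /heval big_seq1 /hprod big_seq1 mul1r mcoeff_hsym /= => E.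
have N0 : #|[set: gT]|%:R != 0 :> algC by rewrite pnatr_eq0 -lt0n cardG_gt0.
transitivity (\sum_(A in [set: gT]) hcomb ch [:: (1, [:: (n, e)])] V1 A
   * (hcs ch (shape_of k1 d1) V1 A)^*).
  rewrite [LHS]big_mkcond [RHS]big_mkcond; apply: eq_bigr => A _; rewrite inE.
  have -> : shape_of k1 d1 = [:: (n, c0)].
    by rewrite /shape_of enum_ordSl /= (size0nil (size_enum_ord 0)).
  rewrite !hcs_one ?rank_V1 ?sact_V1 // !detV1.
  rewrite /hcomb big_seq1 mul1r hcs_one ?rank_V1 ?sact_V1 // detV1.
  by rewrite (ch_triv (det_neq0 A)) rmorph1 mulr1.
rewrite -[LHS](mulVKf N0) E; congr (_ * _).
rewrite mdegE big_ord1 mnmE eqxx /=; case: (eqVneq e c0) => [_|ne].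
  by rewrite (_ : _ \subset _) //; apply/subsetP=> j; rewrite !inE.
rewrite (_ : _ \subset _ = false) //; apply/negbTE/subsetPn; exists ord0.
  by rewrite inE mnmE.
by rewrite inE.
Qed.

(** The condition [det = 1] is detected by averaging the colours of the determinant. *)
Lemma sum_SL (f : gT -> algC) :
  \sum_(A in SL) f A = K%:R^-1 * \sum_e \sum_(A : gT) f A * (ch e (\det (GLval A)))^*.
Proof.
rewrite exchange_big mulr_sumr big_mkcond; apply: eq_bigr => A _.
rewrite -mulr_sumr -rmorph_sum /= ch_sum ?det_neq0 // rmorphM !rmorph_nat mulrCA.
rewrite mulKf ?pnatr_eq0 -?lt0n // inE.
by case: eqP; rewrite ?mulr1 ?mulr0.
Qed.

Lemma card_SL : #|[set: gT]|%:R = K%:R * #|SL|%:R :> algC.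
Proof.
have Kn : K%:R != 0 :> algC by rewrite pnatr_eq0 -lt0n.
rewrite -[in RHS]sum1_card natr_sum (sum_SL (fun=> 1)) mulVKf //.
rewrite (bigD1 c0) //= [X in _ + X]big1 => [|e ne]; last first.
  under eq_bigr => A _ do rewrite mul1r.
  by rewrite -rmorph_sum sum_ch_det (negPf ne) mulr0 rmorph0.
rewrite addr0; under eq_bigr => A _ do rewrite mul1r.
by rewrite -rmorph_sum sum_ch_det eqxx mulr1 rmorph_nat.
Qed.

Lemma hcs_twist S (k : 'I_S -> nat) (c : 'I_S -> C) e A :
  hcs ch (shape_of k (fun p => tw e (c p))) V1 A
  = ch e (\det (GLval A)) * hcs ch (shape_of k c) V1 A.
Proof.
rewrite !hcs_shape /hc mulr_sumr; apply: eq_bigr => t /andP[ct st].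
have d0 i : detres (fl V1 t i) (GLval A) != 0 by rewrite detres_GL0 ?(stab_fl _ st).
have dq i : detres (fl V1 t i) (GLval A) / detres (fl V1 t i.+1) (GLval A) != 0.
  by rewrite mulf_neq0 ?invr_eq0.
rewrite /wt; under eq_bigr => i _ do rewrite ch_tw //.
rewrite big_split; congr (_ * _); rewrite -(ch_prod chM ch_unit) //.
rewrite (telescope_div (f := fun i => detres (fl V1 t i) (GLval A))) //.
by rewrite (detres0 _ (chain_last ct)) divr1 detV1.
Qed.

(** Summing over the colours of one step of the flag gives [K] if [A] acts trivially on that
    quotient, and 0 otherwise. *)
Lemma P_eval A : A \in hstab -> hcomb ch (pcb C m) W0 A =
  (K ^ m)%:R * \sum_(t : m.-tuple subsp | chain (R := m) (fun=> 1%N) W0 t) (A \in ratio1 t)%:R.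
Proof.
move=> AQ; rewrite /hcomb big_map big_enum /=.
under eq_bigr => th _ do rewrite mul1r hcs_shape /hc.
rewrite (exchange_big_dep (fun t : m.-tuple subsp => chain (R := m) (fun=> 1%N) W0 t && stab W0 t A)) //=.
rewrite big_mkcondr mulr_sumr; apply: eq_bigr => t ct.
have -> : (A \in ratio1 t) = stab W0 t A && [forall i : 'I_m,
     detres (fl W0 t i) (GLval A) == detres (fl W0 t i.+1) (GLval A)].
  by rewrite [LHS]in_set AQ.
case: ifP => st; last by rewrite mulr0.
have d0 i : detres (fl W0 t i) (GLval A) != 0 by rewrite detres_GL0 ?(stab_fl _ st).
have dq i : detres (fl W0 t i) (GLval A) / detres (fl W0 t i.+1) (GLval A) != 0.
  by rewrite mulf_neq0 ?invr_eq0.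
have -> : \sum_(th : {ffun 'I_m -> C} | chain (R := m) (fun=> 1%N) W0 t && stab W0 t A) wt ch th W0 t A
   = \prod_(i < m) \sum_c ch c (detres (fl W0 t i) (GLval A) / detres (fl W0 t i.+1) (GLval A)).
  by rewrite ct st bigA_distr_bigA.
under eq_bigr => i _ do rewrite ch_sum //.
rewrite big_split /= prodr_const card_ord natrX; congr (_ * _).
case: forallP => [H|/forallP/forallPn[i ni]].
  rewrite big1 // => i _; rewrite (eqP (H i)) divff ?eqxx //.
rewrite (bigD1 i) //= (_ : _ == 1 = false) ?mul0r //.
by apply: contraNF ni => /eqP/divr1_eq ->.
Qed.

(** The trivial character is the function of the one-step flag of colour [c0]; among all colourings
    of the complete flags only the constant [c0] pairs with it, and with value 1. *)
Lemma P_triv : #|hstab|%:R^-1 * (\sum_(A in hstab) (hcomb ch (pcb C m) W0 A)^*) = 1.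
Proof.
pose cb : seq (int * seq (nat * C)) := [:: (1, [:: (m, c0)])].
have cb1 A : A \in hstab -> hcomb ch cb W0 A = 1.
  move=> AQ; have sA := hstab_W0 AQ.
  rewrite /hcomb big_seq1 mul1r hcs_one ?rank_W0 // ch_triv //.
  exact: detres_GL0.
rewrite (eq_bigr (fun A => \sum_(th : {ffun 'I_m -> C})
   hcomb ch cb W0 A * (hcs ch (shape_of (fun=> 1%N) th) W0 A)^*)); last first.
  move=> A AQ; rewrite {1}/hcomb big_map big_enum rmorph_sum /=; apply: eq_bigr => th _.
  by rewrite cb1 // !mul1r.
rewrite exchange_big mulr_sumr (bigD1 [ffun=> c0]) //= [X in _ + X]big1 => [|th nth].
  rewrite (Gram_shape chM ch_unit ch_sep _ (@hstab_lift F m) (@hstab_W0 F m)).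
  - rewrite /heval big_seq1 /hprod big_seq1 mul1r mcoeff_hsym /= addr0.
    rewrite mdegE (eq_bigr (fun=> 1%N)) => [|i _]; last by rewrite mnmE.
    rewrite sum1_card card_ord eqxx (_ : _ \subset _) //.
    by apply/subsetP=> j _; rewrite inE ffunE.
  - by rewrite /cweight /= /wsum big_seq1 rank_W0 eqxx.
  by rewrite sum1_card card_ord rank_W0.
rewrite (Gram_shape chM ch_unit ch_sep _ (@hstab_lift F m) (@hstab_W0 F m)).
- rewrite /heval big_seq1 /hprod big_seq1 mul1r mcoeff_hsym /=.
  rewrite (_ : _ \subset _ = false) ?andbF //; apply/negbTE/subsetPn.
  have [j nj] : exists j, th j != c0.
    apply/existsP; apply: contraNT nth => /existsPn H.
    by apply/eqP/ffunP=> j; rewrite ffunE; apply/eqP; rewrite -[_ == _]negbK H.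
  by exists j; rewrite !inE ?mnmE.
- by rewrite /cweight /= /wsum big_seq1 rank_W0 eqxx.
by rewrite sum1_card card_ord rank_W0.
Qed.

(** The fixed points of [A] in the orbit of [W0] are the stable hyperplanes, and the trivial colour
    puts weight 1 on the remaining quotient. *)
Lemma Ind_box cb (psi : 'CF(hstab)) :
  {in hstab, forall A, psi A = hcomb ch cb W0 A} ->
  {in SL, forall A, 'Ind[SL] psi A = hcomb ch (box c0 cb) V1 A}.
Proof.
move=> psiE A ASL.
rewrite (@Ind_orbit _ _ (subsp_action F m) SL (hcomb ch cb) setT) ?subsetT //; last first.
  by move=> U g h _ _ _ _; apply: hcomb_sact.
rewrite /hcomb exchange_big /box big_map; apply: eq_bigr => x _.
rewrite -mulr_sumr hcs_cons; congr (_ * _).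
apply: eq_big => [U|U /andP[_ /eqP sU]].
  rewrite hyperplane_orbit sact_V1 eqxx rank_V1 add1n eqSS [m == _]eq_sym.
  by rewrite (spnE 1%:M) submx1.
rewrite ch_triv ?mul1r //.
by rewrite mulf_neq0 ?invr_eq0 ?detres_GL0 ?sact_V1.
Qed.

Variables (R r : nat) (col : 'I_R -> C) (dl : 'I_R -> nat).
Variable pos : C -> nat -> 'I_R.
Hypothesis dl_lt : forall p, (dl p < r)%N.
Hypothesis posK : forall p, pos (col p) (dl p) = p.
Hypothesis col_pos : forall c k, (k < r)%N -> col (pos c k) = c.
Hypothesis dl_pos : forall c k, (k < r)%N -> dl (pos c k) = k.

Notation mono := (mono col dl).
Notation d0 := (d0 dl).
Notation xcb := (xcb col dl).
Implicit Types s t : 'X_{1..R}.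

(** The size of the partition of colour [c] is the difference of the two sums; it is odd for [c0]
    and for no other colour. *)
Definition odd_only_c0 s := forall c,
  odd (\sum_(p | col p == c) s p) = odd (\sum_(p | col p == c) dl p) (+) (c == c0).

(** The scalar product over SL_n is the sum of those over GL_n with all the twists of X_t by [ch e]
    of the determinant. A twist by [e != c0] makes [e] the colour of odd size, so that the colour
    sizes no longer match those of X_s. *)
Lemma xcb_SL s t : mono s -> mono t -> mdeg s = (n + d0)%N -> mdeg t = (n + d0)%N ->
  odd_only_c0 s -> odd_only_c0 t ->
  #|SL|%:R^-1 * (\sum_(A in SL) hcomb ch (xcb s) V1 A * (hcomb ch (xcb t) V1 A)^*) = (s == t)%:R.
Proof.
move=> ms mt ds dt os ot.
have N0 : #|[set: gT]|%:R != 0 :> algC by rewrite pnatr_eq0 -lt0n cardG_gt0.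
have Kn : K%:R != 0 :> algC by rewrite pnatr_eq0 -lt0n.
have S0 : #|SL|%:R != 0 :> algC by rewrite pnatr_eq0 -lt0n cardG_gt0.
have Hl := @GL_lift_self V1; have HW h : h \in [set: gT]%G -> sact V1 h = V1 by rewrite sact_V1.
have := xcb_ortho chM ch_unit ch_sep dl_lt posK col_pos dl_pos Hl HW ms mt.
rewrite rank_V1 => /(_ ds dt) <-; rewrite sum_SL mulrA -invfM mulrC [_ * K%:R]mulrC -card_SL mulrC.
congr (_ * _); rewrite (bigD1 c0) //= [X in _ + X]big1 ?addr0 => [|e ne].
  rewrite [RHS]big_mkcond; apply: eq_bigr => A _.
  by rewrite inE (ch_triv (det_neq0 A)) rmorph1 mulr1.
have ht := cweight_xcb col dt; have hs := cweight_xcb col ds.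
transitivity (\sum_(x <- xcb t) x.1%:~R * \sum_(A in [set: gT]) hcomb ch (xcb s) V1 A
    * (ch e (\det (GLval A)) * hcs ch x.2 V1 A)^*).
  under [RHS]eq_bigr => x _ do rewrite mulr_sumr.
  rewrite exchange_big /= [RHS]big_mkcond; apply: eq_bigr => A _; rewrite inE.
  have -> : (hcomb ch (xcb t) V1 A)^* = \sum_(x <- xcb t) x.1%:~R * (hcs ch x.2 V1 A)^*.
    by rewrite /hcomb rmorph_sum; apply: eq_bigr => x _; rewrite rmorphM /= rmorph_int.
  rewrite mulr_sumr mulr_suml; apply: eq_bigr => x _; rewrite rmorphM /=; ring.
rewrite /xcb big_map big1_seq // => sg /andP[_]; rewrite mem_enum inE => /andP[/forallP cs /forallP le] /=.
under eq_bigr => A _ do rewrite -hcs_twist.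
have sumt : (\sum_p (t p - dl (sg p)) = n)%N.
  apply/eqP; rewrite -(eqn_add2r d0) -dt mdegE (d0_perm dl sg) -big_split.
  by apply/eqP; apply: eq_bigr => p _; rewrite /= subnK.
rewrite -/(xcb s).
have := Gram_shape chM ch_unit ch_sep (fun p => tw e (col p)) Hl HW.
rewrite rank_V1 => /(_ _ _ hs sumt) G.
rewrite -[X in _ * X](mulVKf N0) G /heval raddf_sum big1_seq ?rmorph0 ?mulr0 // => y /andP[_ ys].
have E z S (P : {mpoly int[S]}) l : (z%:~R * P)@_l = z * P@_l.
  by rewrite mulrzl raddfMz /= -mulrzl intz.
rewrite /= E; apply/eqP; rewrite mulf_eq0; apply/orP; right; apply/negPn/negP => /(hprod_colour e).
have := xcb_csize e ys => cz cy.
(* After the twist the size of colour [e] is the size of colour [c0] in [t], which is odd, while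
   that of [e] in [s] is even. *)
have et : (\sum_(j < R | tw e (col j) == e) [multinom (t p - dl (sg p))%N | p < R] j
   + \sum_(p | col p == c0) dl p = \sum_(p | col p == c0) t p)%N.
  have -> : (\sum_(p | col p == c0) dl p = \sum_(p | col p == c0) dl (sg p))%N.
    rewrite (reindex_inj (@perm_inj _ sg)) /=; apply: eq_bigl => p.
    by rewrite (eqP (cs p)).
  rewrite (eq_bigl (fun j => col j == c0)) => [|j]; last first.
    by rewrite -{2}(tw_triv e) (inj_eq (@tw_inj e)).
  by rewrite -big_split; apply: eq_bigr => p _ /=; rewrite mnmE subnK.
have := os e; have := ot c0; rewrite -et -cz -cy eqxx (negPf ne) !oddD addbF.
by do 3!case: (odd _).
Qed.

End SpecialLinearProducts.

Section ClassFunctionOf.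

Variables (gT : finGroupType) (H : {group gT}).

(** An explicit projection to class functions. It returns the class function that agrees with [f] on
    [H] as soon as there is one, so the virtual characters below are definable without choosing
    witnesses. *)
Definition cfun_of (f : gT -> algC) : 'CF(H) :=
  \sum_i (#|H|%:R^-1 * \sum_(x in H) f x * ('chi[H]_i x)^*) *: 'chi_i.

Lemma cfun_ofE f (xi : 'CF(H)) : {in H, forall x, xi x = f x} -> cfun_of f = xi.
Proof.
move=> E; rewrite [RHS]cfun_sum_cfdot; apply: eq_bigr => i _; rewrite cfdotE.
by congr (_ * _ *: _); apply: eq_bigr => x /E ->.
Qed.

End ClassFunctionOf.

Lemma dvdC_of_dvdA (x : algC) : x \is a Num.int -> (2 %| x)%A -> (2%N %| x)%C.
Proof.
case/intrP=> z -> H; have A2 : z%:~R / 2 \in Aint by move: H; rewrite unfold_in pnatr_eq0.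
rewrite [X in is_true X]unfold_in /dvdC pnatr_eq0 /=; apply: Cint_rat_Aint => //.
by rewrite rpred_div ?rpred_int ?rpred_nat.
Qed.

Lemma dvdC_int2 (z : int) : (2%N %| z%:~R)%C = (z%:~R == 0 :> 'F_2).
Proof.
have E k : (2%N %| k%:R)%C = (k%:R == 0 :> 'F_2).
  by rewrite (dvdC_nat 2) (dvdn_pcharf (pchar_Fp (isT : prime 2))).
case: z => k; first exact: E.
by rewrite NegzE !mulrNz rpredN oppr_eq0 -!pmulrn E.
Qed.

Lemma dvdC_sum_ex (I : finType) (P : pred I) (f : I -> algC) :
  ~~ (2%N %| \sum_(i | P i) f i)%C -> exists2 i, P i & ~~ (2%N %| f i)%C.
Proof.
move=> nd; apply/exists_inP; apply: contraR nd => /exists_inPn all2.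
by rewrite rpred_sum // => i /all2; rewrite negbK.
Qed.

(** * Characters of odd degree *)

Section OddCharacters.

Variables (F : finFieldType) (m : nat).
Notation n := m.+1.
Notation gT := {'GL_n[F]}.
Notation subsp := (subsp F m).
Notation SL := (SL_group n F).
Notation W0 := (W0 F m).
Notation V1 := (V1 F m).
Notation hstab := (hstab F m).
Hypothesis charF : (2 : F) != 0.
Hypothesis m2 : (1 < m)%N.
Hypothesis m_even : ~~ odd m.
Variables (C : finType) (ch : C -> F -> algC).
Hypothesis chM : forall c x y, x != 0 -> y != 0 -> ch c (x * y) = ch c x * ch c y.
Hypothesis ch_unit : forall c x, x != 0 -> ch c x * (ch c x)^* = 1.
Hypothesis ch_sep : forall c d, c != d -> exists2 x, x != 0 & ch c x != ch d x.
Variables (c0 : C) (K : nat) (tw : C -> C -> C).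
Hypothesis ch_triv : forall x, x != 0 -> ch c0 x = 1.
Hypothesis K0 : (0 < K)%N.
Hypothesis ch_sum : forall x, x != 0 -> \sum_c ch c x = K%:R * (x == 1)%:R.
Hypothesis ch_tw : forall e c x, x != 0 -> ch (tw e c) x = ch e x * ch c x.

Variables (R r : nat) (col : 'I_R -> C) (dl : 'I_R -> nat).
Variable pos : C -> nat -> 'I_R.
Hypothesis dl_lt : forall p, (dl p < r)%N.
Hypothesis posK : forall p, pos (col p) (dl p) = p.
Hypothesis col_pos : forall c k, (k < r)%N -> col (pos c k) = c.
Hypothesis dl_pos : forall c k, (k < r)%N -> dl (pos c k) = k.
Hypothesis mr : (m < r)%N.

Notation mono := (mono col dl).
Notation d0 := (d0 dl).
Notation xcb := (xcb col dl).
Notation npaths := (npaths col dl).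
Notation oddc := (oddc col dl).
Notation level := (level dl).
Let N := (m + d0).+1.
Notation T := 'X_{1..R < N}.
Implicit Types (s t : 'X_{1..R}).

Definition lev t := mono t && (mdeg t == m + d0)%N.

Definition Yf t : 'CF(hstab) := cfun_of hstab (hcomb ch (xcb t) W0).
Definition Xf s : 'CF(SL) := cfun_of SL (hcomb ch (xcb s) V1).
Definition Pf : 'CF(hstab) := cfun_of hstab (hcomb ch (pcb C m) W0).

Lemma Yf_spec t : Yf t \in 'Z[irr hstab] /\ {in hstab, forall A, Yf t A = hcomb ch (xcb t) W0 A}.
Proof.
have [xi Zxi xiE] := hcomb_virtual chM ch_unit (xcb t) (@hstab_W0 F m).
by rewrite /Yf (cfun_ofE xiE).
Qed.

Lemma Xf_spec s : Xf s \in 'Z[irr SL] /\ {in SL, forall A, Xf s A = hcomb ch (xcb s) V1 A}.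
Proof.
have [xi Zxi xiE] := hcomb_virtual chM ch_unit (xcb s) (H := SL) (fun h _ => sact_V1 h).
by rewrite /Xf (cfun_ofE xiE).
Qed.

Lemma Pf_spec : Pf \in 'Z[irr hstab] /\ {in hstab, forall A, Pf A = hcomb ch (pcb C m) W0 A}.
Proof.
have [xi Zxi xiE] := hcomb_virtual chM ch_unit (pcb C m) (@hstab_W0 F m).
by rewrite /Pf (cfun_ofE xiE).
Qed.

Lemma Yf_ortho s t : lev s -> lev t -> '[Yf s, Yf t] = (s == t)%:R.
Proof.
move=> /andP[ms /eqP ds] /andP[mt /eqP dt]; rewrite cfdotE.
have := xcb_ortho chM ch_unit ch_sep dl_lt posK col_pos dl_pos
  (@hstab_lift F m) (@hstab_W0 F m) ms mt.
rewrite rank_W0 => /(_ ds dt) <-; congr (_ * _); apply: eq_bigr => A AQ.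
by rewrite !(proj2 (Yf_spec _)).
Qed.

Lemma Xf_ortho s t : mono s -> mono t -> mdeg s = (n + d0)%N -> mdeg t = (n + d0)%N ->
  odd_only_c0 c0 col dl s -> odd_only_c0 c0 col dl t -> '[Xf s, Xf t] = (s == t)%:R.
Proof.
move=> ms mt ds dt os ot; rewrite cfdotE.
rewrite -(xcb_SL (m := m) chM ch_unit ch_sep ch_triv K0 ch_sum ch_tw dl_lt posK col_pos dl_pos ms mt) //.
by congr (_ * _); apply: eq_bigr => A AS; rewrite !(proj2 (Xf_spec _)).
Qed.

Lemma Pf_expand : Pf = \sum_(t : T | lev t) (npaths m t)%:~R *: Yf t.
Proof.
apply/cfun_inP => A AQ; rewrite (proj2 Pf_spec) // sum_cfunE.
rewrite (pcb_expand chM ch_unit ch_sep dl_lt posK col_pos dl_pos (rank_W0 F m) (ltnW mr)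
  (ltnSn _) (hstab_W0 AQ)).
by apply: eq_bigr => t _; rewrite cfunE (proj2 (Yf_spec _)).
Qed.

Lemma Ind_Yf t : lev t -> 'Ind[SL] (Yf t) = \sum_(p | col p == c0) Xf (t + U_(p))%MM.
Proof.
move=> /andP[mt /eqP dt]; apply/cfun_inP => A AS.
rewrite (Ind_box ch_triv (proj2 (Yf_spec t))) // sum_cfunE.
rewrite (xcb_Pieri chM ch_unit ch_sep dl_lt posK col_pos dl_pos c0 mt dt mr (rank_V1 F m) (sact_V1 A)).
by apply: eq_bigr => p _; rewrite (proj2 (Xf_spec _)).
Qed.

Lemma Xf_rep t p : lev t -> ~~ mono (t + U_(p))%MM -> Xf (t + U_(p))%MM = 0.
Proof.
move=> /andP[mt /eqP dt] nm; apply/cfun_inP => A AS; rewrite (proj2 (Xf_spec _)) // cfunE.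
apply: (xcb_rep chM ch_unit ch_sep mt dt nm); [exact: rank_V1 | exact: sact_V1].
Qed.

Lemma lev_level t : mdeg t = (m + d0)%N -> level t = m.
Proof. by move=> dt; rewrite /level dt addnK. Qed.

Lemma oddcE t : mdeg t = (m + d0)%N -> oddc t = ~~ (2%N %| (npaths m t)%:~R)%C.
Proof. by move=> dt; rewrite /oddc lev_level // dvdC_int2. Qed.

Lemma lev_T t : lev t -> exists u : T, t = u.
Proof.
move=> /andP[_ /eqP dt]; have tN : (mdeg t < N)%N by rewrite dt.
by exists (BMultinom tN).
Qed.

Lemma up_odd_only t p : lev t -> oddc t -> col p = c0 -> odd_only_c0 c0 col dl (t + U_(p))%MM.
Proof.
move=> /andP[_ /eqP dt] ot cp c; have lt := lev_level dt.
have E := oddc_even_colour c (leqnn (level t)) _ ot.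
rewrite -E ?lt //; rewrite (eq_bigr (fun q => t q + (q == p))%N) => [|q _]; last first.
  by rewrite mnmDE mnm1E eq_sym.
rewrite big_split /= oddD; congr (_ (+) _).
case: (eqVneq c c0) => [->|nc].
  by rewrite (bigD1 p) ?cp //= eqxx big1 // => q /andP[_ /negPf->].
by rewrite big1 // => q /eqP cq; case: eqP => // qp; rewrite -cq qp cp eqxx in nc.
Qed.

Lemma mdeg_up t p : lev t -> mdeg (t + U_(p))%MM = (n + d0)%N.
Proof. by move=> /andP[_ /eqP dt]; rewrite mdegD mdeg1 dt; lia. Qed.

Lemma Pf_parity (psi : 'CF(hstab)) : psi \in 'Z[irr hstab] -> (2%N %| '[psi, Pf] - psi 1%g)%C.
Proof.
move=> Zpsi; have [ZP PE] := Pf_spec; apply: dvdC_of_dvdA.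
  by rewrite rpredB ?Cint_cfdot_vchar // Cint_vchar1.
apply: (flag_sum_parity charF m2 (K := (K ^ m)%N)) => //.
  rewrite cfdotE -[RHS](P_triv m chM ch_unit ch_sep ch_triv).
  by congr (_ * _); apply: eq_bigr => A AQ; rewrite cfun1E AQ mul1r PE.
by move=> A AQ; rewrite PE // (P_eval ch_sum).
Qed.

Lemma cfdot_Pf (psi : 'CF(hstab)) :
  '[psi, Pf] = \sum_(t : T | lev t) (npaths m t)%:~R * '[psi, Yf t].
Proof.
rewrite Pf_expand raddf_sum; apply: eq_bigr => t _.
by rewrite /= cfdotZr rmorph_int.
Qed.

(** A virtual character of norm 1 is irreducible up to sign; its pairing with P is [npaths m t] up
    to sign, which therefore has the parity of the degree. *)
Lemma hstab_odd_of t : lev t -> exists j, exists b : bool,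
  Yf t = (-1) ^+ b *: 'chi_j /\ (j \in Irr_p' 2 hstab) = oddc t.
Proof.
move=> lt; have [ZY _] := Yf_spec t.
have [b [j Yj]] : exists b : bool, exists i, Yf t = (-1) ^+ b *: 'chi_i.
  by apply: vchar_norm1P => //; rewrite Yf_ortho // eqxx.
exists j, b; split=> //; have jE : 'chi_j = (-1) ^+ b *: Yf t.
  by rewrite Yj scalerA -expr2 sqrr_sign scale1r.
have := Pf_parity (irr_vchar j); rewrite cfdot_Pf.
have [u tu] := lev_T lt; rewrite (bigD1 u) -?tu //= big1 => [|s /andP[ls ns]]; last first.
  rewrite jE cfdotZl Yf_ortho // tu (_ : (_ == _) = false) ?mulr0 //.
  by apply/negbTE; rewrite eq_sym; apply: contra ns => /eqP E; apply/eqP/val_inj.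
rewrite {1}jE cfdotZl Yf_ortho // eqxx mulr1 addr0 => dv; rewrite inE oddcE; last first.
  by case/andP: lt => _ /eqP.
congr (~~ _); have Zs : (-1) ^+ b \is a @Num.int algC by rewrite rpredX // rpredN rpred1.
apply/idP/idP => d2.
  have E : (npaths m t)%:~R = ((npaths m t)%:~R * (-1) ^+ b) * (-1) ^+ b :> algC.
    by rewrite -mulrA -expr2 sqrr_sign mulr1.
  rewrite E dvdC_mulr // -[_ * _](subrK ('chi_j 1%g)) rpredD //.
by rewrite -[_ 1%g](subKr ((npaths m t)%:~R * (-1) ^+ b)) rpredB // dvdC_mulr.
Qed.

(** An odd degree forces an odd term in the pairing with P, hence a Y_t that involves ['chi_j]. As
    Y_t depends only on the action on [W0], the odd characters are inflated from there. *)
Lemma hstab_odd_ex j : j \in Irr_p' 2 hstab ->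
  exists t, exists b : bool, [/\ lev t, oddc t & Yf t = (-1) ^+ b *: 'chi_j].
Proof.
rewrite inE => jodd; have := Pf_parity (irr_vchar j); rewrite cfdot_Pf => dv.
have : ~~ (2%N %| \sum_(t : T | lev t) (npaths m t)%:~R * '['chi_j, Yf t])%C.
  by apply: contra jodd => d2;
    rewrite -[_ 1%g](subKr (\sum_(t : T | lev t) (npaths m t)%:~R * '['chi_j, Yf t])) rpredB.
case/dvdC_sum_ex=> t lt nd; have [k [b [Yk oE]]] := hstab_odd_of lt.
have kj : k = j.
  apply/eqP; apply: contraR nd => nkj.
  by rewrite Yk cfdotZr cfdot_irr eq_sym (negPf nkj) !mulr0 rpred0.
exists t, b; split=> //; last by rewrite Yk kj.
by rewrite -oE kj inE.
Qed.

Lemma cfdot_Res_Yf i t : lev t ->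
  '['Res[hstab] 'chi[SL]_i, Yf t] = \sum_(p | col p == c0) '['chi_i, Xf (t + U_(p))%MM].
Proof. by move=> lt; rewrite cfdot_Res_l Ind_Yf // raddf_sum. Qed.

(** Pairing the restriction with P again yields an odd term, hence [t] and [p] with [t] odd. That
    [t] with [p] raised is odd too comes from comparing the degree with [npaths] at that
    configuration. *)
Lemma SL_odd_ex i : i \in Irr_p' 2 SL -> exists t, exists p, exists b : bool,
  [/\ lev t, oddc t, col p = c0, mono (t + U_(p))%MM & oddc (t + U_(p))%MM
      /\ Xf (t + U_(p))%MM = (-1) ^+ b *: 'chi_i].
Proof.
rewrite inE => iodd.
have ZR : 'Res[hstab] 'chi_i \in 'Z[irr hstab] by rewrite cfRes_vchar ?irr_vchar.
have := Pf_parity ZR; rewrite cfdot_Pf cfRes1 => dv.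
have : ~~ (2%N %| \sum_(t : T | lev t) (npaths m t)%:~R * '['Res[hstab] 'chi_i, Yf t])%C.
  by apply: contra iodd => d2; rewrite -['chi_i 1%g]
    (subKr (\sum_(t : T | lev t) (npaths m t)%:~R * '['Res[hstab] 'chi_i, Yf t])) rpredB.
case/dvdC_sum_ex=> t lt; rewrite cfdot_Res_Yf // mulr_sumr => /dvdC_sum_ex[p /eqP cp nd].
have Zx u : '['chi_i, Xf u] \is a Num.int by rewrite Cint_cfdot_vchar ?irr_vchar // (proj1 (Xf_spec _)).
have dt : mdeg t = (m + d0)%N by case/andP: lt => _ /eqP.
have ot : oddc t by rewrite oddcE //; apply: contra nd => d2; rewrite dvdC_mulr.
have mS : mono (t + U_(p))%MM.
  by apply: contraR nd => nm; rewrite Xf_rep // cfdot0r mulr0 rpred0.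
have oS := up_odd_only lt ot cp; have dS := mdeg_up p lt.
have [b [k Xk]] : exists b : bool, exists i, Xf (t + U_(p))%MM = (-1) ^+ b *: 'chi_i.
  by apply: vchar_norm1P; rewrite ?(proj1 (Xf_spec _)) // Xf_ortho // eqxx.
have ki : k = i.
  apply/eqP; apply: contraR nd => nki.
  by rewrite Xk cfdotZr cfdot_irr eq_sym (negPf nki) !mulr0 rpred0.
rewrite {k}ki in Xk; exists t, p, b; split=> //; split=> //.
have iE : 'chi_i = (-1) ^+ b *: Xf (t + U_(p))%MM.
  by rewrite Xk scalerA -expr2 sqrr_sign scale1r.
move: oS dS mS iE Xk; set S := (t + U_(p))%MM => oS dS mS iE Xk.
have lS : level S = n by rewrite /level dS addnK.
rewrite -[oddc S]/(par col dl (level S) S != 0) lS /par -dvdC_int2; apply: contra iodd => dS2.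
rewrite -['chi_i 1%g](subKr (\sum_(t : T | lev t) (npaths m t)%:~R * '['Res[hstab] 'chi_i, Yf t])).
rewrite rpredB //; rewrite -[\sum_(t | _) _](subrK (npaths n S)%:~R) rpredD //.
(* Both quantities are sums over the ways to add a bead step [q] to some [u], weighted by
   [npaths m u]. They are compared term by term modulo 2, where only odd [u] count. *)
rewrite (npathsS col S (ltnSn _)) rmorph_sum [X in X - _]big_mkcond -sumrB /=.
rewrite rpred_sum // => u _; rewrite rmorph_sum /=.
have -> : (if lev u then (npaths m u)%:~R * '['Res[hstab] 'chi_i, Yf u] else 0)
  = \sum_q (npaths m u)%:~R * (if lev u && (col q == c0) then '['chi_i, Xf (u + U_(q))%MM] else 0).
  case: ifP => lu /=; last by rewrite big1 // => q _; rewrite mulr0.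
  rewrite cfdot_Res_Yf // mulr_sumr big_mkcond; apply: eq_bigr => q _.
  by case: ifP; rewrite ?mulr0.
rewrite -sumrB rpred_sum // => q _; rewrite intrM -mulrBr.
have [d2|nd2] := boolP (2%N %| (npaths m u)%:~R)%C.
  by rewrite dvdC_mulr // rpredB ?rpred_int //; case: ifP => _; rewrite ?Zx ?rpred0.
have nz : npaths m u != 0 by apply: contraNneq nd2 => ->; rewrite rpred0.
have du := npaths_deg nz; have bu := npaths_inj nz.
have ou : oddc u by rewrite oddcE.
have [lu|nlu] := boolP (lev u); last first.
  rewrite /= (_ : (_ == _) = false) ?subr0 ?mulr0 ?rpred0 //.
  apply/negbTE; apply: contra nlu => /eqP E; rewrite /lev du eqxx andbT.
  by apply: (mono_down (p := q) bu); rewrite E.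
(* A box of another colour cannot lead to [S]: colour [c0] would keep an even size. *)
have [cq|ncq] /= := eqVneq (col q) c0; last first.
  rewrite (_ : (_ == _) = false) ?subr0 ?mulr0 ?rpred0 //.
  apply/negP => /eqP E; have := oS c0; rewrite -E eqxx addbT.
  have /andP[_ /eqP du'] := lu.
  rewrite -(oddc_even_colour c0 (leqnn (level u)) _ ou) ?(lev_level du') //.
  rewrite (eq_bigr u) => [|x /eqP cx]; first by case: (odd _).
  rewrite mnmDE mnm1E; case: eqP => [qx|_]; last by rewrite addn0.
  by rewrite qx cx eqxx in ncq.
have [mq|nmq] := boolP (mono (u + U_(q))%MM); last first.
  rewrite Xf_rep // cfdot0r (_ : (_ == _) = false) ?subr0 ?mulr0 ?rpred0 //.
  by apply: contraNF nmq => /eqP ->.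
rewrite iE cfdotZl Xf_ortho ?mdeg_up //; last exact: up_odd_only.
rewrite (eq_sym S); case: eqP => _; last by rewrite mulr0 subr0 mulr0 rpred0.
rewrite dvdC_mull ?rpred_int //; case: (b); rewrite ?expr0 ?expr1 mulr1 ?subrr ?rpred0 //.
by rewrite -opprD rpredN (dvdC_nat 2 2).
Qed.

Lemma sign_scale_neq0 (b : bool) : (-1) ^+ b != 0 :> algC.
Proof. by rewrite signr_eq0. Qed.

Lemma level_S t p : lev t -> level (t + U_(p))%MM = n.
Proof. by move=> lt; rewrite /level mdeg_up // addnK. Qed.

Lemma mult_formula i k t p t' (b b' : bool) : lev t -> oddc t -> col p = c0 ->
  mono (t + U_(p))%MM -> Xf (t + U_(p))%MM = (-1) ^+ b *: 'chi_i ->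
  lev t' -> oddc t' -> Yf t' = (-1) ^+ b' *: 'chi_k ->
  '['Res[hstab] 'chi_i, 'chi_k] = (-1) ^+ b * (-1) ^+ b' *
     \sum_(q | col q == c0) (t + U_(p) == t' + U_(q))%MM%:R.
Proof.
move=> lt ot cp mS Xi lt' ot' Yk.
have iE : 'chi_i = (-1) ^+ b *: Xf (t + U_(p))%MM.
  by rewrite Xi scalerA -expr2 sqrr_sign scale1r.
have kE : 'chi_k = (-1) ^+ b' *: Yf t'.
  by rewrite Yk scalerA -expr2 sqrr_sign scale1r.
rewrite kE cfdotZr rmorph_sign cfdot_Res_Yf // -mulrA mulrCA; congr (_ * _).
rewrite mulr_sumr; apply: eq_bigr => q /eqP cq; rewrite iE cfdotZl; congr (_ * _).
have [mq|nmq] := boolP (mono (t' + U_(q))%MM).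
  by rewrite Xf_ortho ?mdeg_up //; apply: up_odd_only.
rewrite (Xf_rep lt' nmq) cfdot0r (_ : (_ == _) = false) //.
by apply: contraNF nmq => /eqP <-.
Qed.

Lemma down_inj t p t' q : lev t -> oddc t -> lev t' -> oddc t' -> oddc (t + U_(p))%MM ->
  (t + U_(p) = t' + U_(q))%MM -> p = q /\ t = t'.
Proof.
move=> lt ot lt' ot' oS E.
have pq : p = q.
  apply: (oddc_down_inj dl_lt posK col_pos dl_pos (leqnn (level (t + U_(p))%MM))) => //.
  - by rewrite level_S.
  - by rewrite mnmDE mnm1E eqxx addn1.
  - by rewrite addmK.
  - by rewrite E mnmDE mnm1E eqxx addn1.
  by rewrite E addmK.
by split=> //; apply: (@addIm _ U_(p)%MM); rewrite E pq.
Qed.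

Lemma mult_canonical_hstab : ~~ (2 %| #|SL : hstab|)%N -> mult_canonical 2 SL hstab.
Proof.
move=> odd_index; split=> //.
  move=> i /SL_odd_ex[t [p [b [lt ot cp mS [oS Xi]]]]].
  have [j [b' [Yj jP]]] := hstab_odd_of lt; exists j; first by rewrite jP.
  move=> k kP; have [t' [b2 [lt' ot' Yk]]] := hstab_odd_ex kP.
  have mE := mult_formula lt ot cp mS Xi lt' ot' Yk.
  have [tt'|ntt'] := eqVneq t t'.
    have kj : k = j.
      apply/eqP; have := congr1 (fun f => '[f, Yf t']) Yk.
      rewrite Yf_ortho // eqxx -{1}tt' Yj cfdotZl cfdotZr cfdot_irr.
      by case: eqP => // _; rewrite !mulr0 => /eqP; rewrite oner_eq0.
    have s1 : \sum_(q | col q == c0) (t + U_(p) == t' + U_(q))%MM%:R = 1 :> algC.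
      rewrite (bigD1 p) ?cp //= -tt' eqxx big1 ?addr0 // => q /andP[_ nq].
      rewrite (_ : (_ == _) = false) //; apply: contraNF nq => /eqP E.
      by have [->] := down_inj lt ot lt ot oS E.
    rewrite kj eqxx -kj.
    (* The multiplicity is a product of two signs and also a natural number, so it is 1. *)
    have : '['Res[hstab] 'chi_i, 'chi_k] \is a Num.nat.
      by rewrite Cnat_cfdot_char_irr ?cfRes_char ?irr_char.
    rewrite mE s1 mulr1 -signr_addb; case: (_ (+) _); rewrite ?expr1 ?expr0 //.
    by move/natr_ge0; rewrite oppr_ge0 ler10.
  have s0 : \sum_(q | col q == c0) (t + U_(p) == t' + U_(q))%MM%:R = 0 :> algC.
    rewrite big1 // => q _; rewrite (_ : (_ == _) = false) //.
    by apply: contraNF ntt' => /eqP /(down_inj lt ot lt' ot' oS)[_ ->].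
  rewrite mE s0 mulr0 (_ : (k == j) = false) //; apply: contraNF ntt' => /eqP kj.
  have := Yf_ortho lt lt'; rewrite Yj Yk kj cfdotZl cfdotZr cfdot_irr eqxx mulr1.
  case: eqP => // _ /eqP.
  by rewrite mulf_eq0 fmorph_eq0 !(negPf (sign_scale_neq0 _)).
move=> i i' j /SL_odd_ex[t [p [b [lt ot cp mS [oS Xi]]]]].
move=> /SL_odd_ex[t' [p' [b' [lt' ot' cp' mS' [oS' Xi']]]]] /hstab_odd_ex[u [b2 [lu ou Yj]]].
have key t0 p0 i0 (b0 : bool) : lev t0 -> oddc t0 -> col p0 = c0 -> mono (t0 + U_(p0))%MM ->
    Xf (t0 + U_(p0))%MM = (-1) ^+ b0 *: 'chi_i0 -> '['Res[hstab] 'chi_i0, 'chi_j] != 0 ->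
    exists2 q, col q = c0 & (t0 + U_(p0) = u + U_(q))%MM.
  move=> l0 o0 cp0 m0 X0; rewrite (mult_formula l0 o0 cp0 m0 X0 lu ou Yj) => nz.
  have /existsP[q /andP[/eqP cq /eqP E]] : [exists q, (col q == c0) && (t0 + U_(p0) == u + U_(q))%MM].
    apply: contraNT nz => /existsPn none; rewrite big1 ?mulr0 // => q cq.
    by have := none q; rewrite cq /= => /negPf->.
  by exists q.
move=> /(key t p i b lt ot cp mS Xi)[q cq E] /(key t' p' i' b' lt' ot' cp' mS' Xi')[q' cq' E'].
have qq' : q = q'.
  have /andP[_ /eqP du] := lu.
  apply: (oddc_up_inj dl_lt posK col_pos dl_pos (leqnn (level u))) => //.
  - by rewrite lev_level.
  - by rewrite -E.
  - by rewrite -E'.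
  by rewrite cq cq'.
have : Xf (t + U_(p))%MM = Xf (t' + U_(p'))%MM by rewrite E E' qq'.
rewrite Xi Xi' => /(congr1 (fun f => '[f, 'chi_i])); rewrite !cfdotZl !cfdot_irr eqxx.
case: (eqVneq i' i) => [->//|_] /eqP; rewrite mulr1 mulr0.
by rewrite (negPf (sign_scale_neq0 _)).
Qed.

End OddCharacters.

(** * The number of hyperplanes *)

Section HyperplaneCount.

Variables (F : finFieldType) (m : nat).
Notation n := m.+1.
Notation subsp := (subsp F m).

(** The fibres of the map from nonzero functionals to their kernels are punctured lines, with
    [#|F| - 1] elements each. *)
Lemma hyperplane_functional (U : subsp) : \rank U = m ->
  exists2 phi : 'cV[F]_n, phi != 0 &
    forall psi : 'cV[F]_n, (spn (kermx psi) == U) && (psi != 0)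
      = (psi \in [set a *: phi | a in predC1 0]).
Proof.
move=> rU; have [v nv] : exists v : 'rV_n, ~~ (v <= U)%MS.
  have : ~~ (1%:M <= U)%MS by rewrite sub1mx /row_full rU neq_ltn ltnSn.
  by case/row_subPn=> i ni; exists (row i 1%:M).
have [phi Uphi vphi] := separating_functional nv.
have phi0 : phi != 0.
  apply: contraTneq isT => E; have := matrix_nonzero1 F 0.
  by rewrite -vphi E mulmx0 eqxx.
exists phi => // psi.
have kerE (f : 'cV[F]_n) : f != 0 -> U *m f = 0 -> spn (kermx f) = U.
  move=> f0 Uf; apply/subsp_eq/eqmx_sym; apply: eqmx_trans _ (eqmx_sym (spnE _)).
  have sU : (U <= kermx f)%MS by apply/sub_kermxP.
  apply/eqmxP; rewrite -(mxrank_leqif_eq sU) rU mxrank_ker.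
  have -> : \rank f = 1%N; last by rewrite subn1.
  by apply/eqP; rewrite eqn_leq rank_leq_col lt0n mxrank_eq0.
apply/andP/imsetP => [[/eqP E psi0]|[a a0 ->]]; last first.
  have nz : a *: phi != 0 by rewrite scaler_eq0 negb_or phi0 andbT; move: a0; rewrite inE.
  by split=> //; rewrite kerE // -scalemxAr Uphi scaler0.
have Upsi : U *m psi = 0 by apply/sub_kermxP; rewrite -(spnE (kermx psi)) E.
pose a := (v *m psi) 0 0; have vpsi : v *m psi = a%:M by rewrite [LHS]mx11_scalar.
have full : row_full (U + v)%MS.
  have lt : (U < U + v)%MS.
    by rewrite ltmxE addsmxSl addsmx_sub submx_refl nv.
  by rewrite /row_full eqn_leq rank_leq_col -{1}rU rank_ltmx.
have E2 : psi = a *: phi.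
  apply/eqP; rewrite -subr_eq0; apply/eqP.
  have : (U + v <= kermx (psi - a *: phi))%MS.
    rewrite addsmx_sub; apply/andP; split; apply/sub_kermxP.
      by rewrite mulmxBr -scalemxAr Upsi Uphi scaler0 subr0.
    by rewrite mulmxBr -scalemxAr vpsi vphi scalemx1 subrr.
  move/(submx_trans (submx_full 1%:M full))/sub_kermxP.
  by rewrite mul1mx.
exists a => //; rewrite !inE; apply: contra psi0 => /eqP a0.
by rewrite E2 a0 scale0r.
Qed.

Lemma odd_sum_powers q k : odd q -> odd (\sum_(i < k) q ^ i)%N = odd k.
Proof.
move=> oq; elim: k => [|k IH]; first by rewrite big_ord0.
by rewrite big_ord_recr /= oddD IH oddX oq orbT addbT.
Qed.

(** The index is the number [1 + q + ... + q^(n-1)] of hyperplanes, a sum of an odd number of odd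
    terms. *)
Lemma index_hstab_odd : odd #|F| -> odd n -> odd #|SL_group n F : hstab F m|.
Proof.
move=> oF on; rewrite /hstab -card_orbit.
have -> : #|orbit (subsp_action F m) (SL_group n F) (W0 F m)| = (\sum_(i < n) #|F| ^ i)%N.
  have q1 : (0 < #|F|.-1)%N by have := finNzRing_gt1 F; case: #|F| => [|[]].
  apply/eqP; rewrite -(eqn_pmul2l q1) -predn_exp; apply/eqP.
  have -> : (#|F| ^ n).-1 = #|[set psi : 'cV[F]_n | psi != 0]|.
    by rewrite cardsE cardC1 card_mx muln1.
  rewrite -[RHS]sum1_card [RHS](partition_big (fun psi : 'cV[F]_n => spn (kermx psi))
     (mem (orbit (subsp_action F m) (SL_group n F) (W0 F m)))) /=; last first.
    move=> psi; rewrite inE => psi0; rewrite hyperplane_orbit spnE mxrank_ker.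
    have -> : \rank psi = 1%N; last by rewrite subn1.
    by apply/eqP; rewrite eqn_leq rank_leq_col lt0n mxrank_eq0.
  rewrite mulnC -sum_nat_const; apply: eq_bigr => U; rewrite hyperplane_orbit => /eqP rU.
  have [phi phi0 phiE] := hyperplane_functional rU.
  rewrite sum1dep_card -(cardC1 (0 : F)).
  rewrite -(card_imset _ (_ : injective (fun a => a *: phi))).
    by apply: eq_card => psi; rewrite -phiE inE inE andbC.
  move=> a b /eqP; rewrite -subr_eq0 -scalerBl scaler_eq0 (negPf phi0) orbF subr_eq0.
  by move/eqP.
by rewrite odd_sum_powers.
Qed.

End HyperplaneCount.

(** * The character group of the multiplicative group of the field *)

Section Colours.

Variable F : finFieldType.
Notation uF := [set: {unit F}]%G.

Definition colour := Iirr uF.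

(** The value at 0 is a default; the assumptions on colours concern nonzero elements. *)
Definition colour_val (c : colour) (x : F) : algC :=
  if insub x is Some u then 'chi[uF]_c (u : {unit F}) else 0.

Lemma colour_unit x : x != 0 -> exists2 u : {unit F}, FinRing.uval u = x &
  forall c, colour_val c x = 'chi[uF]_c u.
Proof.
move=> x0; have ux : x \is a GRing.unit by rewrite unitfE.
exists (FinRing.unit F ux) => // c; rewrite /colour_val.
by rewrite (insubT (fun x => x \is a GRing.unit) ux).
Qed.

Lemma units_abelian : abelian uF.
Proof. by apply/centsP=> u _ v _; apply: val_inj; rewrite /= mulrC. Qed.

Lemma colour_lin (c : colour) : 'chi[uF]_c \is a linear_char.
Proof. exact: (char_abelianP _ units_abelian). Qed.

Lemma colour_valM c x y : x != 0 -> y != 0 ->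
  colour_val c (x * y) = colour_val c x * colour_val c y.
Proof.
move=> x0 y0; have [u Du uE] := colour_unit x0; have [v Dv vE] := colour_unit y0.
have [w Dw wE] := colour_unit (mulf_neq0 x0 y0); rewrite uE vE wE.
have -> : w = (u * v)%g by apply: val_inj; rewrite /= -[LHS]/(FinRing.uval w) Dw -Du -Dv.
by rewrite lin_charM ?colour_lin ?inE.
Qed.

Lemma colour_val_unit c x : x != 0 -> colour_val c x * (colour_val c x)^* = 1.
Proof.
move=> x0; have [u Du uE] := colour_unit x0; rewrite uE -normCK.
by rewrite normC_lin_char ?expr1n ?colour_lin ?inE.
Qed.

Lemma colour_val_sep c d : c != d -> exists2 x, x != 0 & colour_val c x != colour_val d x.
Proof.
move=> ncd; have /existsP[u nu] : [exists u : {unit F}, 'chi[uF]_c u != 'chi[uF]_d u].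
  apply: contraNT ncd => /existsPn E; apply/eqP/irr_inj/cfunP => u.
  by apply/eqP; rewrite -[_ == _]negbK E.
have x0 : FinRing.uval u != 0 by rewrite -unitfE; apply: (valP u).
exists (FinRing.uval u) => //; have [v Dv vE] := colour_unit x0.
by rewrite !vE (_ : v = u) //; apply: val_inj.
Qed.

Lemma colour_val0 x : x != 0 -> colour_val 0 x = 1.
Proof.
move=> x0; have [u Du uE] := colour_unit x0.
by rewrite uE irr0 cfun1E inE.
Qed.

Lemma colour_sum x : x != 0 -> \sum_c colour_val c x = #|uF|%:R * (x == 1)%:R.
Proof.
move=> x0; have [u Du uE] := colour_unit x0.
under eq_bigr => c _ do rewrite uE.
have := second_orthogonality_relation u (group1 uF).
rewrite (eq_bigr (fun c => 'chi[uF]_c u)) => [->|c _]; last first.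
  by rewrite lin_char1 ?colour_lin // rmorph1 mulr1.
rewrite class1G inE -mulr_natr; congr (_%:R * _%:R).
  apply: eq_card => v; rewrite [LHS]in_setI; apply: andb_idr => _; apply/cent1P.
  by apply: (centsP units_abelian); rewrite inE.
by rewrite -Du; congr nat_of_bool; apply/eqP/eqP => [->//|E]; apply: val_inj.
Qed.

Definition twist (e c : colour) : colour := cfIirr ('chi[uF]_e * 'chi[uF]_c).

Lemma colour_twist e c x : x != 0 ->
  colour_val (twist e c) x = colour_val e x * colour_val c x.
Proof.
move=> x0; have [u Du uE] := colour_unit x0.
by rewrite !uE cfIirrE ?cfunE // lin_char_irr // rpredM ?colour_lin.
Qed.

End Colours.

(** The group of units has even order, hence an element [x] of order 2; if 2 were 0 then
    [(x - 1) ^ 2 = 0], so [x = 1]. *)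
Lemma odd_card_char (F : finFieldType) : odd #|F| -> (2 : F) != 0.
Proof.
move=> oddF; apply/eqP => F2.
have d2 : (2 %| #|[set: {unit F}]%G|)%N.
  by rewrite card_finField_unit dvdn2; case: #|F| oddF => // k; rewrite /= negbK.
have [x _ o2] := Cauchy (isT : prime 2) d2.
have x2 : FinRing.uval x ^+ 2 = 1 by rewrite -FinRing.val_unitX -o2 expg_order.
have : (FinRing.uval x - 1) ^+ 2 == 0.
  by rewrite sqrrB1 x2 -[_ *+ 2]mulr_natr F2 mulr0 subr0; apply/eqP; exact: F2.
rewrite expf_eq0 /= subr_eq0 => /eqP x1.
have x1g : x = 1%g by apply: val_inj.
by rewrite x1g order1 in o2.
Qed.

Section Canonical.

Variables (F : finFieldType) (m : nat).
Notation n := m.+1.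
Notation SL := (SL_group n F).
Notation hstab := (hstab F m).

Lemma mult_canonical_SL : (1 < m)%N -> ~~ odd m -> odd #|F| ->
  mult_canonical 2 SL hstab.
Proof.
move=> m2 me oF.
(* The abacus has [n = m + 1] beads of each colour, so that [m < r]. *)
pose I : finType := (colour F * 'I_n)%type.
pose col (p : 'I_#|{: I}|) := (enum_val p).1.
pose dl (p : 'I_#|{: I}|) : nat := (enum_val p).2.
pose pos (c : colour F) (k : nat) : 'I_#|{: I}| := enum_rank ((c, inord k) : I).
apply: (@mult_canonical_hstab F m (odd_card_char oF) m2 me _ (@colour_val F)
  (@colour_valM F) (@colour_val_unit F) (@colour_val_sep F) 0 #|[set: {unit F}]| (@twist F)
  (@colour_val0 F) _ (@colour_sum F) (@colour_twist F) _ n col dl pos); last first.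
- by rewrite dvdn2 negbK; apply: index_hstab_odd.
- exact: ltnSn.
- by move=> c k kn; rewrite /dl /pos enum_rankK /= inordK.
- by move=> c k _; rewrite /col /pos enum_rankK.
- by move=> p; rewrite /pos /col /dl inord_val -surjective_pairing enum_valK.
- by move=> p; rewrite /dl ltn_ord.
by rewrite cardG_gt0.
Qed.

End Canonical.

(** * Maximal parabolic subgroups with the given Levi subgroup *)

Section MaximalParabolics.

Variables (F : finFieldType) (m : nat).
Notation n := m.+1.
Notation gT := {'GL_n[F]}.
Notation SL := (SL_group n F).
Notation hstab := (hstab F m).
Implicit Types (g h x : gT) (U : 'M[F]_n).

Lemma trinv_unit g : (GLval g^-1%g)^T \in unitmx.
Proof. by rewrite unitmx_tr GLval_unit. Qed.

Definition trinv g : gT := Sub ((GLval g^-1%g)^T) (trinv_unit g).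

Lemma trinvE g : GLval (trinv g) = (GLval g^-1%g)^T.
Proof. exact: SubK. Qed.

Lemma trinvM : {in SL &, {morph trinv : g h / (g * h)%g}}.
Proof.
move=> g h _ _; apply: val_inj; rewrite -![val _]/(GLval _) GL_MxE !trinvE invMg.
by rewrite GL_MxE trmx_mul.
Qed.
Canonical trinv_morphism := Morphism trinvM.

Lemma trinvK : involutive trinv.
Proof.
move=> g; apply: val_inj; rewrite -[LHS]/(GLval _) trinvE.
have -> : (trinv g)^-1%g = trinv g^-1%g.
  apply: (mulgI (trinv g)); rewrite mulgV; apply: val_inj.
  rewrite -![val _]/(GLval _) GL_MxE !trinvE -trmx_mul -GL_MxE invgK mulgV GL_1E.
  by rewrite trmx1.
by rewrite trinvE invgK trmxK.
Qed.

Lemma trinv_SL g : (trinv g \in SL) = (g \in SL).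
Proof.
rewrite !inSL trinvE det_tr GL_VxE det_inv invr_eq1.
by [].
Qed.

Lemma injm_trinv : ('injm trinv)%g.
Proof. by apply/injmP=> g h _ _; apply: (can_inj trinvK). Qed.

Lemma morphim_trinv (A : {set gT}) : A \subset SL ->
  (trinv @* A)%g = [set g in SL | trinv g \in A].
Proof.
move=> /subsetP sA; apply/setP=> g; apply/morphimP/setIdP => [[h _ hA ->]|[gS gA]].
  by rewrite trinv_SL sA // trinvK.
by apply: (MorphimSpec (z := trinv g)); rewrite ?trinv_SL //= trinvK.
Qed.

Notation pidn := (@pid_mx F n n).
Notation copidn := (@copid_mx F n).

Lemma stable_pid (A : 'M[F]_n) k : (k <= n)%N ->
  stablemx (pidn k) A = (pidn k *m A *m copidn k == 0).
Proof.
move=> kn; have idk : pidn k *m pidn k = pidn k by rewrite pid_mx_id.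
apply/idP/eqP => [/submxP[X ->]|E].
  by rewrite -mulmxA /copid_mx mulmxBr mulmx1 idk subrr mulmx0.
apply/submxP; exists (pidn k *m A); apply/eqP.
by move/eqP: E; rewrite /copid_mx mulmxBr mulmx1 subr_eq0.
Qed.

Lemma stable_copid (A : 'M[F]_n) k : (k <= n)%N ->
  stablemx (copidn k) A = (copidn k *m A *m pidn k == 0).
Proof.
move=> kn; have idk : copidn k *m pidn k = 0.
  by rewrite /copid_mx mulmxBl mul1mx pid_mx_id // subrr.
apply/idP/eqP => [/submxP[X ->]|E]; first by rewrite -mulmxA idk mulmx0.
apply/submxP; exists (copidn k *m A).
by rewrite {2}/copid_mx mulmxBr mulmx1 E subr0.
Qed.

(** Stability of the two coordinate subspaces is the vanishing of one off-diagonal block each, and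
    transposition exchanges the blocks. *)
Lemma stable_trinv g k : (k <= n)%N ->
  stablemx (copidn k) (GLval g) = stablemx (pidn k) (GLval (trinv g)).
Proof.
move=> kn.
have stV (U : 'M[F]_n) h : stablemx U (GLval h) -> stablemx U (GLval h^-1%g).
  move=> st; have := stab_stable 0 (stabV (W := spn U) (t := [::]) (g := h) _).
  rewrite /fl /= => H; rewrite -(eqmx_stable _ (spnE U)); apply: H.
  by rewrite /stab /= andbT -stable_sact (eqmx_stable _ (spnE U)).
have trE (B : 'M[F]_n) : stablemx (pidn k) B^T = stablemx (copidn k) B.
  rewrite stable_pid // stable_copid // -(inj_eq (@trmx_inj _ _ _)) trmx0 !trmx_mul trmxK.
  by rewrite mulmxA tr_pid_mx (_ : (copidn k)^T = copidn k) // /copid_mx linearB /= trmx1 tr_pid_mx.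
rewrite trinvE trE; apply/idP/idP; first exact: stV.
by move/stV; rewrite invgK.
Qed.

Lemma in_hstabE g : (g \in hstab) = (g \in SL) && stablemx (pidn m) (GLval g).
Proof. by rewrite in_hstab inSL -stable_sact (eqmx_stable _ (spnE _)). Qed.

Lemma conj_stable U g x : stablemx U (GLval (g ^ x^-1)%g) = stablemx (U *m GLval x) (GLval g).
Proof.
rewrite conjgE invgK !GL_MxE.
have -> : stablemx U (GLval x *m (GLval g *m GLval x^-1%g))
   = (U *m (GLval x *m (GLval g *m GLval x^-1%g)) *m GLval x <= U *m GLval x)%MS.
  by rewrite submxMfree ?GLval_free.
by rewrite -!mulmxA -[GLval x^-1%g *m GLval x]GL_MxE mulVg GL_1E mulmx1 !mulmxA.
Qed.

Lemma hyperplane_stab x : x \in SL -> (hstab :^ x)%g = SL_stab (n := n) [:: (pidn m *m GLval x : 'M[F]_n)].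
Proof.
move=> xS; apply/setP=> g; rewrite mem_conjg in_hstabE [RHS]inE /= andbT conj_stable.
by congr (_ && _); rewrite groupJr // groupV.
Qed.

Lemma line_stab x : x \in SL ->
  ((trinv @* hstab) :^ x)%g = SL_stab (n := n) [:: (copidn m *m GLval x : 'M[F]_n)].
Proof.
move=> xS; apply/setP=> g; rewrite mem_conjg morphim_trinv ?hstab_sub //.
rewrite in_set in_hstabE trinv_SL -stable_trinv // [RHS]inE /= andbT conj_stable andbA andbb.
by congr (_ && _); rewrite groupJr // groupV.
Qed.

Hypothesis m2 : (1 < m)%N.

Lemma transvection (i j : 'I_n) : i != j -> (i < m)%N -> (j < m)%N ->
  exists2 g, g \in GL_GL1_cap_SL n F & GLval g = 1%:M + delta_mx i j.
Proof.
move=> nij im jm; have d1 : \det (1%:M + delta_mx i j : 'M[F]_n) = 1.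
  have -> : delta_mx i j = (delta_mx i 0 : 'cV[F]_n) *m (delta_mx 0 j : 'rV[F]_n).
    by rewrite mul_delta_mx.
  by rewrite det_1D_rank1 mul_delta_mx_0 1?eq_sym // mxE addr0.
have [|g Dg] := @GL_lift F m (1%:M + delta_mx i j); first by rewrite unitmxE d1 unitr1.
exists g => //; rewrite inE inE Dg d1 eqxx /=; apply/forallP=> a; apply/forallP=> b.
apply/implyP=> ab; rewrite !mxE.
have ne : a != b by apply: contraTneq ab => ->; rewrite eqxx.
rewrite (negPf ne) add0r (_ : (_ && _) = false) ?eqxx //.
apply: contraTF ab => /andP[/eqP-> /eqP->].
by rewrite -!val_eqE /= !(ltn_eqF) ?eqxx.
Qed.

Lemma row_delta (v : 'rV[F]_n) (i j : 'I_n) : v *m delta_mx i j = v 0 i *: delta_mx 0 j.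
Proof.
have -> : delta_mx i j = (delta_mx i 0 : 'cV[F]_n) *m (delta_mx 0 j : 'rV[F]_n).
  by rewrite mul_delta_mx.
by rewrite mulmxA -colE [col i v]mx11_scalar mul_scalar_mx mxE.
Qed.

Lemma row_pid (v : 'rV[F]_n) (i : 'I_n) : (v *m pidn m) 0 i = v 0 i *+ (i < m)%N.
Proof.
rewrite mxE (bigD1 i) //= big1 ?addr0 => [|k ki].
  by rewrite mxE eqxx; case: (_ < _)%N; rewrite ?mulr1 ?mulr0.
by rewrite mxE (_ : (k == i :> nat) = false) ?mulr0 //; apply/negbTE.
Qed.

(** Let a vector of [U] have a nonzero coordinate [i < m]. Transvections in the Levi subgroup
    produce from it the basis vectors [j != i] below [m], and from one of these the basis vector
    [i]; such a [j] exists since [m > 1]. *)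
Lemma Levi_stable U : (forall g, g \in GL_GL1_cap_SL n F -> stablemx U (GLval g)) ->
  (U <= copidn m)%MS \/ (pidn m <= U)%MS.
Proof.
move=> stU.
have shift (v : 'rV[F]_n) (i j : 'I_n) : (v <= U)%MS -> i != j -> (i < m)%N -> (j < m)%N ->
    v 0 i != 0 -> ((delta_mx 0 j : 'rV[F]_n) <= U)%MS.
  move=> vU nij im jm vi; have [g gL Dg] := transvection nij im jm.
  have : (v *m GLval g <= U)%MS by apply: submx_trans (submxMr _ vU) (stU g gL).
  rewrite Dg mulmxDr mulmx1 row_delta => le.
  have : (v 0 i *: (delta_mx 0 j : 'rV[F]_n) <= U)%MS.
    by rewrite -[X in (X <= _)%MS](addKr v) addmx_sub // eqmx_opp.
  by move/(scalemx_sub (v 0 i)^-1); rewrite scalerA mulVf // scale1r.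
have [|/row_subPn[k nk]] := boolP (U <= copidn m)%MS; [by left | right].
pose v := row k U; have vU : (v <= U)%MS by apply: row_sub.
have [i im vi] : exists2 i : 'I_n, (i < m)%N & v 0 i != 0.
  apply/exists_inP; apply: contraR nk => /exists_inPn v0; apply/submxP; exists v.
  rewrite /copid_mx mulmxBr mulmx1 (_ : v *m pidn m = 0) ?subr0 //.
  apply/rowP=> i; rewrite row_pid [RHS]mxE; case im: (i < m)%N => //.
  by rewrite mulr1n; apply/eqP; have := v0 i im; rewrite negbK.
have [j jm nij] : exists2 j : 'I_n, (j < m)%N & i != j.
  have k1 : (1 < n)%N by apply: ltn_trans m2 _.
  case: (eqVneq i ord0) => [->|ni]; last by exists ord0; rewrite //= ltnW.
  by exists (Ordinal k1).
have ej := shift v i j vU nij im jm vi.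
have ei : ((delta_mx 0 i : 'rV[F]_n) <= U)%MS.
  by apply: (shift _ j i ej) => //; [rewrite eq_sym | rewrite mxE !eqxx oner_neq0].
apply/row_subP=> l; have [lm|lm] := ltnP l m; last first.
  rewrite (_ : row l (pidn m) = 0) ?sub0mx //; apply/rowP=> x.
  by rewrite !mxE ltnNge lm andbF.
have -> : row l (pidn m) = delta_mx 0 l.
  apply/rowP=> x; rewrite !mxE lm andbT eqxx /=; congr (_%:R).
  by rewrite eq_sym.
by have [<-//|nil] := eqVneq i l; apply: (shift v i l vU nil im lm vi).
Qed.

Lemma rank_copid : \rank (copidn m) = 1%N.
Proof. by rewrite rank_copid_mx // subSnn. Qed.

Lemma rank_pid : \rank (pidn m) = m.
Proof. by rewrite rank_pid_mx. Qed.

Definition trivially_stable U := forall g : gT, stablemx U (GLval g).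

Lemma Levi_stable_cases U : (forall g, g \in GL_GL1_cap_SL n F -> stablemx U (GLval g)) ->
  [\/ trivially_stable U, (U :=: copidn m)%MS | (U :=: pidn m)%MS].
Proof.
case/Levi_stable=> le.
  have [r0|r0] := eqVneq (\rank U) 0%N.
    constructor 1 => g; have /eqP := r0; rewrite mxrank_eq0 => /eqP ->.
    by rewrite mul0mx sub0mx.
  constructor 2; apply/eqmxP; rewrite -(mxrank_leqif_eq le) rank_copid eqn_leq lt0n r0 andbT.
  by rewrite -rank_copid mxrankS.
have [rm|rm] := eqVneq (\rank U) m.
  constructor 3; apply/eqmx_sym/eqmxP; rewrite -(mxrank_leqif_eq le) rank_pid rm.
  by [].
constructor 1 => g; apply: submx_full.
rewrite /row_full eqn_leq rank_leq_col ltn_neqAle eq_sym rm /=.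
by rewrite -{1}rank_pid mxrankS.
Qed.

Lemma copid_pid_incomparable : ~~ (copidn m <= pidn m)%MS /\ ~~ (pidn m <= copidn m)%MS.
Proof.
split; last by apply: contraL m2 => /mxrankS; rewrite rank_copid rank_pid -leqNgt.
apply/negP => /submxP[X E].
have : copidn m *m copidn m = copidn m by rewrite copid_mx_id.
rewrite {1}E -mulmxA mul_pid_mx_copid // mulmx0 => E0.
by have := rank_copid; rewrite -E0 mxrank0.
Qed.

(** Each member of the flag of [Q] is stable under the Levi subgroup, hence trivial, the line or the
    hyperplane. Line and hyperplane are incomparable, so only one of them can occur, and one does
    because [Q] is proper. *)
Lemma Levi_parabolic (Q : {set gT}) x : Q \proper SL_set n F ->
  Levi_subgroup Q (GL_GL1_cap_SL n F :^ x)%g ->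
  Q = SL_stab (n := n) [:: (pidn m *m GLval x : 'M[F]_n)] \/
  Q = SL_stab (n := n) [:: (copidn m *m GLval x : 'M[F]_n)].
Proof.
move=> propQ [k [W [_ _ DQ DL]]].
pose P (i : 'I_k) : 'M[F]_n := (\sum_(j < k | (j <= i)%N) W j)%MS.
have memQ g : (g \in Q) = (g \in SL_set n F) && [forall i, stablemx (P i) (GLval g)].
  rewrite DQ inE; congr (_ && _); apply/allP/forallP => [H i|H U /mapP[i _ ->]]; last exact: H.
  by apply: H; apply/mapP; exists i; rewrite ?mem_enum.
(* Conjugating back by [x] makes the members stable under the standard Levi subgroup. *)
pose P' i := P i *m GLval x^-1%g.
have PE i : P i = P' i *m GLval x by rewrite /P' -mulmxA -[GLval x^-1%g *m GLval x]GL_MxE mulVg GL_1E mulmx1.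
have cases i : [\/ trivially_stable (P' i), (P' i :=: copidn m)%MS | (P' i :=: pidn m)%MS].
  apply: Levi_stable_cases => g gL; rewrite -conj_stable invgK.
  move: gL; rewrite -(memJ_conjg _ x) DL inE => /andP[_ /allP stW].
  rewrite /P sumsmxMr; apply/sumsmx_subP => j ji.
  apply: (sumsmx_sup j ji).
  by have /(_ (W j)) := stW; apply; apply: map_f; apply: mem_enum.
have Pmono (i j : 'I_k) : (i <= j)%N -> (P' i <= P' j)%MS.
  move=> ij; apply: submxMr; apply/sumsmx_subP => l li; apply: (sumsmx_sup l) => //.
  exact: leq_trans li ij.
have stE (U V : 'M[F]_n) g : (U :=: V)%MS ->
    stablemx (U *m GLval x) (GLval g) = stablemx (V *m GLval x) (GLval g).
  by move=> E; apply: eqmx_stable; apply: eqmxMr.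
have triv i g : trivially_stable (P' i) -> stablemx (P i) (GLval g).
  by move=> tr; rewrite PE -conj_stable tr.
have [nc np] := copid_pid_incomparable.
have [/existsP[i /eqmxP Ei]|nopid] := boolP [exists i, (P' i == pidn m)%MS].
  left; apply/setP=> g; rewrite memQ [RHS]inE /= andbT; congr (_ && _).
  apply/forallP/idP => [/(_ i)|st j]; first by rewrite PE (stE _ _ _ Ei).
  case: (cases j) => [/triv //|Ej|Ej]; last by rewrite PE (stE _ _ _ Ej).
  have [ij|/ltnW ji] := leqP i j.
    by case/negP: np; rewrite -Ei -Ej Pmono.
  by case/negP: nc; rewrite -Ej -Ei Pmono.
right.
have [/existsP[i /eqmxP Ei]|nocopid] := boolP [exists i, (P' i == copidn m)%MS].
  apply/setP=> g; rewrite memQ [RHS]inE /= andbT; congr (_ && _).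
  apply/forallP/idP => [/(_ i)|st j]; first by rewrite PE (stE _ _ _ Ei).
  case: (cases j) => [/triv //|Ej|/eqmxP Ej]; first by rewrite PE (stE _ _ _ Ej).
  by case/existsP: nopid; exists j.
case/negP: (properxx (SL_set n F)); rewrite {1}(_ : SL_set n F = Q) //.
apply/setP=> g; rewrite memQ; case gS: (g \in _) => //=; apply/esym/forallP => i.
case: (cases i) => [/triv //|/eqmxP Ei|/eqmxP Ei].
  by case/existsP: nocopid; exists i.
by case/existsP: nopid; exists i.
Qed.

End MaximalParabolics.

Lemma mult_canonical_conj (gT : finGroupType) p (G H : {group gT}) x : H \subset G -> x \in G ->
  mult_canonical p G H -> mult_canonical p G (H :^ x)%G.
Proof.
move=> sHG xG mc; have := mult_canonical_morphim (f := conjgm G x) sHG (injm_conj G x) mc.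
have -> : (conjgm G x @* G)%G = G by apply: val_inj; rewrite /= morphim_conj setIid conjGid.
by have -> : (conjgm G x @* H)%G = (H :^ x)%G by apply: val_inj; rewrite /= morphim_conj (setIidPr sHG).
Qed.

Theorem theoremB (n : nat) (F : finFieldType) (Q : {group {'GL_n[F]}}) :
  (1 < n)%N -> odd n -> odd #|F| ->
  maximal_parabolic Q ->
  (exists2 x, x \in SL_group n F & Levi_subgroup Q (GL_GL1_cap_SL n F :^ x)%g) ->
  restriction_canonical 2 (SL_group n F) Q.
Proof.
case: n Q => [|m] Q; first by [].
move=> n2 oddn oddF [_ propQ _] [x xS LQ].
have m2 : (1 < m)%N by case: m {Q propQ x xS LQ} n2 oddn => [|[|]].
have mc := mult_canonical_SL m2 oddn oddF.
have sH := hstab_sub F m.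
have [DQ|DQ] := Levi_parabolic m2 propQ LQ.
  have -> : Q = (hstab F m :^ x)%G by apply: val_inj; rewrite /= DQ hyperplane_stab.
  apply: canonical_of_mult => //; first exact: conj_subG.
  exact: mult_canonical_conj.
have sT : (trinv_morphism F m @* hstab F m)%g \subset SL_group m.+1 F.
  by rewrite morphim_trinv // setIdE subsetIl.
have -> : Q = ((trinv_morphism F m @* hstab F m) :^ x)%G.
  by apply: val_inj; rewrite /= DQ -line_stab.
apply: canonical_of_mult => //; first exact: conj_subG.
apply: mult_canonical_conj => //.
have := mult_canonical_morphim sH (injm_trinv F m) mc.
have -> // : (trinv_morphism F m @* SL_group m.+1 F)%G = SL_group m.+1 F.
by apply: val_inj; rewrite /= morphim_trinv //; apply/setP=> g; rewrite in_set trinv_SL andbb.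
Qed.
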